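(* Let $T$ be a POL for the massive scalar boson and $t$ its kernel. The following statements are equivalent. (a) $T$ is finite. (b) $t$ is finite, i.e. there are finitely many measurable $f_l:\mathbb{R}^3\to\mathbb{C}$ with $t(k,p)=\sum_l\overline{f_l(k)}f_l(p)$ for all $k,p\ne0$. (c) $T$ is a kinematic deformation of the Newton-Wigner localization, i.e. there are finitely many measurable bounded $f_l:\mathbb{R}^3\to\mathbb{C}$ with $T=\sum_lf_l(P)^*\,E^{NW}f_l(P)$.
   Context: The massive scalar boson is described on $L^2(\mathbb{R}^3)$ (momentum space), on which $\tilde{\mathcal E}=ISU(2)$, the covering group of the Euclidean group, acts by $(U^{(0)}(b,B)\phi)(p)=e^{-ibp}\phi(B^{-1}\cdot p)$. A POL is a normalized positive operator valued measure $T$ on the Borel sets of $\mathbb{R}^3$ ($T(\mathbb{R}^3)=I$), with values in operators on $L^2(\mathbb{R}^3)$, satisfying $U^{(0)}(g)T(\Delta)U^{(0)}(g)^{-1}=T(g\cdot\Delta)$ for all $g\in\tilde{\mathcal E}$. The kernel of $T$ is a measurable, rotation invariant, positive definite kernel $t$ on $\mathbb{R}^3\setminus\{0\}$ with $t(p,p)=1$ for all $p$ and separable reproducing kernel Hilbert space, such that for $\phi\in L^1\cap L^2$ and measurable $\Delta$ $$\langle\phi,T(\Delta)\phi\rangle=(2\pi)^{-3}\int_\Delta\int\int t(k,p)e^{i(p-k)x}\overline{\phi(k)}\phi(p)\,d^3k\,d^3p\,d^3x;$$ it is determined by $T$ up to null sets, and kernels differing only on null sets are identified (so (b) means that $T$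 has a kernel of the stated form). $E^{can}(\Delta)$ denotes multiplication by the indicator function $1_\Delta$, $\mathcal{F}$ the unitary Fourier transformation with kernel $(2\pi)^{-3/2}e^{-ixy}$ (on $L^2$ of scalar or vector valued functions). $E^{NW}=\mathcal{F}E^{can}\mathcal{F}^{-1}$ on $L^2(\mathbb{R}^3)$ is the Newton-Wigner localization. $f(P)$ is the multiplication operator by $f$, $(f(P)\phi)(p)=f(p)\phi(p)$. $T$ is called finite if it is the trace of a Euclidean covariant projection valued measure with finite dimensional spinor space: there are a finite dimensional unitary representation $D$ of $SU(2)$ on a Hilbert space $\mathcal{S}^{fin}$ and an isometry $j:L^2(\mathbb{R}^3)\to L^2(\mathbb{R}^3,\mathcal{S}^{fin})$ intertwining $U^{(0)}$ with the representation $(D_{\tilde{\mathcal E}}(b,B)\varphi)(p)=e^{-ibp}D(B)\varphi(B^{-1}\cdot p)$ such that $T=j^*\mathcal{F}E^{can}\mathcal{F}^{-1}j$. *)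

(* Defs.v *)
From HB Require Import structures.
From mathcomp Require Import all_boot all_order all_algebra.
From mathcomp Require Import complex.
From mathcomp Require Import all_classical all_reals all_analysis.
From mathcomp Require Import measurable_realfun.

Set Implicit Arguments.
Unset Strict Implicit.
Unset Printing Implicit Defensive.

Import Order.TTheory GRing.Theory Num.Theory.
Import numFieldNormedType.Exports.

Local Open Scope classical_set_scope.
Local Open Scope complex_scope.
Local Open Scope sesquilinear_scope.
Local Open Scope ring_scope.

(* Elements of L^2 are represented by measurable square integrable functions,
   not by classes; accordingly operators act on functions, only their values
   on square integrable functions matter, and equality of elements of L^2 is
   equality almost everywhere. *)

Lemma product_measure_sigma_finite (R : realType) d1 d2
    (T1 : measurableType d1) (T2 : measurableType d2)
    (m1 : {sigma_finite_measure set T1 -> \bar R})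
    (m2 : {sigma_finite_measure set T2 -> \bar R}) :
  sigma_finite setT (m1 \x m2)%E.
Proof.
have /sigma_finiteP[F [TF ndF Foo]] := sigma_finiteT m1.
have /sigma_finiteP[G [TG ndG Goo]] := sigma_finiteT m2.
exists (fun n => F n `*` G n).
  rewrite -setXTT TF TG predeqE => -[x y]; split.
    move=> [/= [n _ Fnx] [k _ Gky]]; exists (maxn n k) => //; split.
    - by move: x Fnx; exact/subsetPset/ndF/leq_maxl.
    - by move: y Gky; exact/subsetPset/ndG/leq_maxr.
  by move=> [n _ []/= ? ?]; split; exists n.
move=> k; have [? ?] := Foo k; have [? ?] := Goo k.
split; first exact: measurableX.
by rewrite product_measure1E// lte_mul_pinfty// ge0_fin_numE.
Qed.

Definition R2 (R : realType) : measurableType _ :=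
  (measurableTypeR R * measurableTypeR R)%type.

(* The space R^3 with its Borel sets; the coordinates of p are p.1.1, p.1.2
   and p.2. *)
Definition R3 (R : realType) : measurableType _ :=
  (R2 R * measurableTypeR R)%type.

Notation wave R := (R3 R -> R[i]).
Notation spinor R n := (R3 R -> 'cV[R[i]]_n).

Section SpaceAndIntegral.
Context {R : realType}.

(* Lebesgue measure; the intermediate plane makes both iterated products
   inherit the structure of a sigma-finite measure. *)
Definition leb2 : set (R2 R) -> \bar R :=
  (@lebesgue_measure R \x @lebesgue_measure R)%E.

HB.instance Definition _ :=
  Measure.copy leb2 (@lebesgue_measure R \x @lebesgue_measure R)%E.

HB.instance Definition _ := @Measure_isSigmaFinite.Build _ _ _ leb2
  (product_measure_sigma_finite (@lebesgue_measure R) (@lebesgue_measure R)).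

Definition leb3 : set (R3 R) -> \bar R := (leb2 \x @lebesgue_measure R)%E.

HB.instance Definition _ := Measure.copy leb3 (leb2 \x @lebesgue_measure R)%E.

HB.instance Definition _ := @Measure_isSigmaFinite.Build _ _ _ leb3
  (product_measure_sigma_finite leb2 (@lebesgue_measure R)).

Definition dot3 (p x : R3 R) : R :=
  p.1.1 * x.1.1 + p.1.2 * x.1.2 + p.2 * x.2.

Definition expi (a : R) : R[i] := cos a +i* sin a.

Definition cmeasurable d (X : measurableType d) (D : set X) (f : X -> R[i]) :=
  measurable_fun D (fun x => complex.Re (f x)) /\
  measurable_fun D (fun x => complex.Im (f x)).

Definition cint (D : set (R3 R)) (f : wave R) : R[i] :=
  (\int[leb3]_(x in D) complex.Re (f x)) +i*
  (\int[leb3]_(x in D) complex.Im (f x)).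

Definition Lpow (q : nat) : set (wave R) := [set f |
  cmeasurable setT f /\
  (\int[leb3]_x ((Normc.normc (f x)) ^+ q)%:E < +oo)%E].

Definition L2 : set (wave R) := Lpow 2.

(* Conjugate linear in the first argument. *)
Definition ip (f g : wave R) : R[i] := cint setT (fun p => (f p)^* * g p).

Definition L2v n : set (spinor R n) :=
  [set f | forall i, L2 (fun p => f p i ord0)].

Definition ipv n (f g : spinor R n) : R[i] :=
  \sum_i ip (fun p => f p i ord0) (fun p => g p i ord0).

Definition liftv n (A : wave R -> wave R) (f : spinor R n) : spinor R n :=
  fun p => \col_i A (fun q => f q i ord0) p.

End SpaceAndIntegral.

Section Operators.
Context {R : realType}.

Definition linear_op n (A : wave R -> spinor R n) :=
  forall (c : R[i]) (f g : wave R), L2 f -> L2 g ->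
    A (fun p => c * f p + g p) = (fun p => c *: A f p + A g p) %[ae leb3].

Definition isometryv n (j : wave R -> spinor R n) :=
  [/\ forall f, L2 f -> L2v (j f),
      linear_op j &
      forall f g, L2 f -> L2 g -> ipv (j f) (j g) = ip f g].

Record bounded_op (A : wave R -> wave R) : Prop := BoundedOp {
  bop_L2 : forall f, L2 f -> L2 (A f) ;
  bop_ae : forall f g, L2 f -> L2 g ->
    f = g %[ae leb3] -> A f = A g %[ae leb3] ;
  bop_lin : forall (c : R[i]) f g, L2 f -> L2 g ->
    A (fun p => c * f p + g p) = (fun p => c * A f p + A g p) %[ae leb3] ;
  bop_bnd : exists M : R, forall f, L2 f ->
    complex.Re (ip (A f) (A f)) <= M * complex.Re (ip f f) }.

Definition is_adjoint (X Y : Type) (HX : set X) (ipX : X -> X -> R[i])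
    (HY : set Y) (ipY : Y -> Y -> R[i]) (A : X -> Y) (A' : Y -> X) :=
  (forall y, HY y -> HX (A' y)) /\
  forall x y, HX x -> HY y -> ipX x (A' y) = ipY (A x) y.

Definition is_inverse (A A' : wave R -> wave R) :=
  [/\ forall f, L2 f -> L2 (A' f),
      forall f, L2 f -> A (A' f) = f %[ae leb3] &
      forall f, L2 f -> A' (A f) = f %[ae leb3]].

(* f(P) *)
Definition mulop (f g : wave R) : wave R := fun p => f p * g p.

Definition Ecan (Delta : set (R3 R)) : wave R -> wave R :=
  mulop (fun p => (\1_Delta p)%:C).

(* F is the unitary operator with kernel (2 pi)^(-3/2) exp(- i x y); these
   conditions determine F on L^2 up to null sets.  Its surjectivity is the
   existence of an inverse F'. *)
Record is_fourier (F F' : wave R -> wave R) : Prop := IsFourier {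
  fourier_bop : bounded_op F ;
  fourier_isom : forall f g, L2 f -> L2 g -> ip (F f) (F g) = ip f g ;
  fourier_inv : is_inverse F F' ;
  fourier_ker : forall f, Lpow 1 f -> L2 f ->
    F f = (fun x => ((2 * pi) `^ (- (3 / 2)))%:C *
            cint setT (fun y => expi (- dot3 x y) * f y)) %[ae leb3] }.

Definition ENW (F F' : wave R -> wave R) (Delta : set (R3 R))
    : wave R -> wave R := F \o Ecan Delta \o F'.

End Operators.

Section Euclidean.
Context {R : realType}.

Definition SU2 : set 'M[R[i]]_2 :=
  [set B | B \is unitarymx /\ \det B = 1].

Definition pauli (p : R3 R) : 'M[R[i]]_2 := \matrix_(i, j)
  if i == 0 then (if j == 0 then p.2%:C else p.1.1 -i* p.1.2)
  else (if j == 0 then p.1.1 +i* p.1.2 else (- p.2)%:C).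

(* B . p is determined by pauli (B . p) = B * pauli p * B^*; its coordinates
   are read off from the first column of this matrix. *)
Definition su2_rot (B : 'M[R[i]]_2) (p : R3 R) : R3 R :=
  let X := B *m pauli p *m B ^t* in
  (complex.Re (X 1 0), complex.Im (X 1 0), complex.Re (X 0 0)).

(* The elements (b, B) of ISU(2). *)
Definition ISU2 : set (R3 R * 'M[R[i]]_2) := [set g | SU2 g.2].

Definition isu_act (g : R3 R * 'M[R[i]]_2) (x : R3 R) : R3 R :=
  g.1 + su2_rot g.2 x.

Definition isu_inv (g : R3 R * 'M[R[i]]_2) : R3 R * 'M[R[i]]_2 :=
  (- su2_rot (invmx g.2) g.1, invmx g.2).

Definition U0 (g : R3 R * 'M[R[i]]_2) (f : wave R) : wave R :=
  fun p => expi (- dot3 g.1 p) * f (su2_rot (invmx g.2) p).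

Record is_unitary_rep n (D : 'M[R[i]]_2 -> 'M[R[i]]_n) : Prop :=
  IsUnitaryRep {
  rep_mul : forall A B, SU2 A -> SU2 B -> D (A *m B) = D A *m D B ;
  rep_unitary : forall B, SU2 B -> D B \is unitarymx ;
  rep_cont : forall B, SU2 B -> forall e : R, 0 < e ->
    exists2 d : R, 0 < d & forall B', SU2 B' ->
      (forall i j, Normc.normc (B' i j - B i j) < d) ->
      forall i j, Normc.normc (D B' i j - D B i j) < e }.

Definition DE n (D : 'M[R[i]]_2 -> 'M[R[i]]_n) (g : R3 R * 'M[R[i]]_2)
    (f : spinor R n) : spinor R n :=
  fun p => expi (- dot3 g.1 p) *: (D g.2 *m f (su2_rot (invmx g.2) p)).

End Euclidean.

Section Kernels.
Context {R : realType}.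

(* H, with inner product ipH, is the Hilbert space of functions on X with
   reproducing kernel K; K(., x) is the element representing evaluation
   at x. *)
Record is_rkhs (X : Type) (K : X -> X -> R[i]) (H : set (X -> R[i]))
    (ipH : (X -> R[i]) -> (X -> R[i]) -> R[i]) : Prop := IsRKHS {
  rkhs_zero : H (fun=> 0) ;
  rkhs_lin : forall (c : R[i]) f g, H f -> H g ->
    H (fun x => c * f x + g x) ;
  rkhs_ip_lin : forall (c : R[i]) h f g, H h -> H f -> H g ->
    ipH h (fun x => c * f x + g x) = c * ipH h f + ipH h g ;
  rkhs_ip_herm : forall f g, H f -> H g -> ipH g f = (ipH f g)^* ;
  rkhs_ip_pos : forall f, H f -> 0 <= ipH f f ;
  rkhs_ip_def : forall f, H f -> ipH f f = 0 -> forall x, f x = 0 ;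
  rkhs_complete : forall u : nat -> X -> R[i], (forall n, H (u n)) ->
    (forall e : R, 0 < e -> exists N, forall m n, (N <= m)%N -> (N <= n)%N ->
       complex.Re (ipH (u m \- u n) (u m \- u n)) < e) ->
    exists2 f, H f &
      (fun n => complex.Re (ipH (u n \- f) (u n \- f))) @ \oo --> (0 : R) ;
  rkhs_ker : forall x, H (fun y => K y x) ;
  rkhs_repr : forall f, H f -> forall x, ipH (fun y => K y x) f = f x }.

Definition separable_space (X : Type) (H : set (X -> R[i]))
    (ipH : (X -> R[i]) -> (X -> R[i]) -> R[i]) :=
  exists2 d : nat -> X -> R[i], (forall n, H (d n)) &
    forall f, H f -> forall e : R, 0 < e ->
      exists n, complex.Re (ipH (f \- d n) (f \- d n)) < e.

Definition separable_rkhs (X : Type) (K : X -> X -> R[i]) :=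
  exists (H : set (X -> R[i])) ipH, is_rkhs K H ipH /\ separable_space H ipH.

(* t is a kernel on the space without the origin, i.e., only the values
   t k p for k and p different from 0 matter. *)
Record is_kernel (T : set (R3 R) -> wave R -> wave R)
    (t : R3 R -> R3 R -> R[i]) : Prop := IsKernel {
  ker_meas : cmeasurable [set kp : R3 R * R3 R | kp.1 != 0 /\ kp.2 != 0]
    (fun kp => t kp.1 kp.2) ;
  ker_rot : forall B, SU2 B -> forall k p : R3 R, k != 0 -> p != 0 ->
    t (su2_rot B k) (su2_rot B p) = t k p ;
  ker_pos : forall n (p : 'I_n -> R3 R) (c : 'I_n -> R[i]),
    (forall i, p i != 0) ->
    0 <= \sum_i \sum_j (c i)^* * c j * t (p i) (p j) ;
  ker_diag : forall p : R3 R, p != 0 -> t p p = 1 ;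
  ker_sep : @separable_rkhs {p : R3 R | p != 0}
    (fun k p => t (val k) (val p)) ;
  ker_formula : forall f, Lpow 1 f -> L2 f ->
    forall Delta, measurable Delta ->
    ip f (T Delta f) = ((2 * pi) ^- 3)%:C *
      cint Delta (fun x => cint setT (fun p => cint setT (fun k =>
        t k p * expi (dot3 (p - k) x) * (f k)^* * f p))) }.

End Kernels.

Section POL.
Context {R : realType}.
Implicit Types (T : set (R3 R) -> wave R -> wave R) (F : wave R -> wave R).

Record is_POL T : Prop := IsPOL {
  pol_bop : forall Delta, measurable Delta -> bounded_op (T Delta) ;
  pol_pos : forall Delta, measurable Delta ->
    forall f, L2 f -> 0 <= ip f (T Delta f) ;
  pol_sigma : forall f, L2 f ->
    semi_sigma_additive (fun Delta => (complex.Re (ip f (T Delta f)))%:E) ;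
  pol_norm : forall f, L2 f -> T setT f = f %[ae leb3] ;
  pol_cov : forall g, ISU2 g -> forall Delta, measurable Delta ->
    forall f, L2 f ->
    U0 g (T Delta (U0 (isu_inv g) f)) = T (isu_act g @` Delta) f
      %[ae leb3] }.

Definition finite_POL F F' T :=
  exists (n : nat) (D : 'M[R[i]]_2 -> 'M[R[i]]_n)
      (j : wave R -> spinor R n) (j' : spinor R n -> wave R),
    [/\ is_unitary_rep D,
        isometryv j,
        is_adjoint L2 ip (@L2v R n) (@ipv R n) j j',
        forall g, ISU2 g -> forall f, L2 f ->
          j (U0 g f) = DE D g (j f) %[ae leb3] &
        forall Delta, measurable Delta -> forall f, L2 f ->
          T Delta f = j' (liftv F (liftv (Ecan Delta) (liftv F' (j f))))
            %[ae leb3]].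

(* The kernel t of T is only determined up to null sets, so it is finite if
   it agrees almost everywhere with a kernel of T which is a finite sum. *)
Definition is_finite_kernel T (t : R3 R -> R3 R -> R[i]) :=
  exists t' : R3 R -> R3 R -> R[i],
    [/\ is_kernel T t',
        (\forall kp \ae (leb3 \x leb3)%E, t' kp.1 kp.2 = t kp.1 kp.2) &
        exists (n : nat) (f : 'I_n -> wave R),
          (forall l, cmeasurable setT (f l)) /\
          forall k p : R3 R, k != 0 -> p != 0 ->
            t' k p = \sum_l (f l k)^* * f l p].

Definition kinematic_deformation F F' T :=
  exists (n : nat) (f : 'I_n -> wave R) (f' : 'I_n -> wave R -> wave R),
    [/\ forall l, cmeasurable setT (f l),
        forall l, exists M : R, forall p, Normc.normc (f l p) <= M,
        forall l, is_adjoint L2 ip L2 ip (mulop (f l)) (f' l) &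
        forall Delta, measurable Delta -> forall f0, L2 f0 ->
          T Delta f0 =
            (fun p => \sum_l f' l (ENW F F' Delta (mulop (f l) f0)) p)
            %[ae leb3]].

End POL.

(* Main.v *)
Require Import Defs.
From HB Require Import structures.
From mathcomp Require Import all_boot all_order all_algebra.
From mathcomp Require Import complex.
From mathcomp Require Import all_classical all_reals all_analysis.
From mathcomp Require Import measurable_realfun.
From mathcomp Require Import ring lra.

Set Implicit Arguments.
Unset Strict Implicit.
Unset Printing Implicit Defensive.

Import Order.TTheory GRing.Theory Num.Theory.
Import numFieldNormedType.Exports.

Local Open Scope classical_set_scope.
Local Open Scope complex_scope.
Local Open Scope sesquilinear_scope.
Local Open Scope ring_scope.

(** A kernel of finite rank [t(k,p) = \sum_l conj (f_l k) * f_l p], bounded because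
    [t(p,p) = 1], and a deformation [T = \sum_l f_l(P)^* E^NW f_l(P)] correspond to
    each other: the quadratic form of [T Delta] is an integral over [Delta] of a
    continuous function of position, so [T] determines [t] up to null sets.

    Diagonalizing the Gram matrix of the [f_l] for a Gaussian weight, one may take
    them linearly independent modulo null sets.  Rotation invariance of [t] then gives
    matrices [D(B)] with [f(B.p) = D(B) f(p)] for almost every [p], and independence
    makes [D] multiplicative and unitary.  Integrating [t] against [f] replaces [f] by
    a representative for which this holds for every [p].  The Fourier transform
    of this [f] times a Gaussian is a Lipschitz family transforming under the same [D],
    whence [D] is continuous, and [phi |-> phi * f] is the isometry exhibiting [T] as
    a finite trace.

    Conversely, an intertwining isometry [j] commutes with all factors
    [exp(-ibp)]; by injectivity of the Fourier transformation it is multiplication by a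
    vector valued function of norm 1, whose components are the [f_l]. *)

(** * Rotations and Lebesgue measure *)

(** The difficulty lies in null sets. A kernel must be rotation invariant and equal to 1 on the
    diagonal at every nonzero point, whereas [T] fixes it only up to null sets of pairs, and the
    diagonal is itself such a null set.

    For a single rotation B the relation f(B.p) = D(B) f(p) first fails on a null set that depends
    on B. As SU(2) is uncountable, these sets cannot be collected into one; the given kernel, which
    is invariant at every point, has to enter under an integral. The norm of f is 1 almost
    everywhere because T(R^3) = I, and the exceptional set is repaired sphere by sphere, SU(2) being
    transitive on spheres.

    The Gaussian weight is rotation invariant, makes bounded functions integrable and absorbs the
    factors |p| produced by Lipschitz estimates in position space. The same estimates make the
    position density of the quadratic form continuous, so that vanishing integrals over small cubes
    force it to vanish at x = 0, where all phases disappear and only the kernel and the test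
    functions remain. *)

Lemma lebesgue_measure_shift (R : realType) (a : R)
    (A : set (measurableTypeR R)) : measurable A ->
  lebesgue_measure ((fun x : measurableTypeR R => x + a : measurableTypeR R) @^-1` A)
  = lebesgue_measure A.
Proof.
move=> mA.
have mphi : measurable_fun setT (fun x : measurableTypeR R => x + a : measurableTypeR R).
  by apply: measurable_funD.
rewrite -[LHS]/(pushforward lebesgue_measure
  (fun x : measurableTypeR R => x + a : measurableTypeR R) A).
apply/esym/lebesgue_measure_unique => //= _ [[b c]] _ <-.
rewrite /pushforward /= (_ : _ @^-1` _ = `](b - a), (c - a)]%classic); last first.
  by apply/seteqP; split=> x /=; rewrite !in_itv/= ltrBlDr lerBrDr.
rewrite !lebesgue_measure_itv/= !lte_fin ltrD2r -!EFinB.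
by have -> : c - a - (b - a) = c - b by ring.
Qed.

Section fibre_maps.
Local Open Scope ereal_scope.
Context d1 d2 (T1 : measurableType d1) (T2 : measurableType d2) (R : realType)
  (m1 : {sigma_finite_measure set T1 -> \bar R})
  (m2 : {sigma_finite_measure set T2 -> \bar R}).

Lemma product_measure_fibre2 (psi : T1 -> T2 -> T2) (A : set (T1 * T2)) :
  (forall x B, measurable B -> m2 (psi x @^-1` B) = m2 B) ->
  measurable A ->
  (m1 \x m2) ((fun p => (p.1, psi p.1 p.2)) @^-1` A) = (m1 \x m2) A.
Proof.
move=> psi_m mA; rewrite /product_measure1; apply: eq_integral => x _ /=.
rewrite -[RHS](psi_m x); last exact: measurable_xsection.
by congr (m2 _); apply/seteqP; split=> y /=; rewrite /xsection /= !inE.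
Qed.

(** The product measure integrates the measures of the sections over the first factor. A map that
    moves the first coordinate is handled by the reversed iterated measure, which agrees with it by
    uniqueness on rectangles. *)
Lemma product_measure_fibre1 (psi : T2 -> T1 -> T1) (A : set (T1 * T2)) :
  (forall y B, measurable B -> m1 (psi y @^-1` B) = m1 B) ->
  measurable A ->
  measurable ((fun p => (psi p.2 p.1, p.2)) @^-1` A) ->
  (m1 \x m2) ((fun p => (psi p.2 p.1, p.2)) @^-1` A) = (m1 \x m2) A.
Proof.
move=> psi_m mA mpA.
have E X : measurable X -> (m1 \x m2) X = (m1 \x^ m2) X.
  by move=> mX; apply: product_measure_unique => // B C mB mC; rewrite /= product_measure2E.
rewrite !E// /product_measure2; apply: eq_integral => y _ /=.
rewrite -[RHS](psi_m y); last exact: measurable_ysection.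
by congr (m1 _); apply/seteqP; split=> x /=; rewrite /ysection /= !inE.
Qed.

End fibre_maps.

Section rotation_invariance.
Context {R : realType}.
Implicit Types (phi psi : R3 R -> R3 R).

Definition mpres phi := measurable_fun setT phi /\
  forall A, measurable A -> leb3 (phi @^-1` A) = leb3 A.

Lemma mpres_comp phi psi : mpres phi -> mpres psi -> mpres (phi \o psi).
Proof.
move=> [mphi phiE] [mpsi psiE]; split; first exact: measurableT_comp.
move=> A mA; rewrite comp_preimage psiE ?phiE//.
by rewrite -[X in measurable X]setTI; exact: mphi.
Qed.

Lemma measurable_coord1 : measurable_fun setT (fun p : R3 R => p.1.1 : measurableTypeR R).
Proof. exact: (measurableT_comp measurable_fst measurable_fst). Qed.

Lemma measurable_coord2 : measurable_fun setT (fun p : R3 R => p.1.2 : measurableTypeR R).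
Proof. exact: (measurableT_comp measurable_snd measurable_fst). Qed.

Lemma measurable_coord3 : measurable_fun setT (fun p : R3 R => p.2 : measurableTypeR R).
Proof. exact: measurable_snd. Qed.

Lemma measurable_R3 d (T : measurableType d) (f g h : T -> R) :
  measurable_fun setT f -> measurable_fun setT g -> measurable_fun setT h ->
  measurable_fun setT (fun x => (f x, g x, h x) : R3 R).
Proof.
move=> mf mg mh; apply: measurable_fun_pair => //.
exact: measurable_fun_pair.
Qed.

(** Shears translate each fibre by a constant, so they preserve the measure by Fubini and
    translation invariance; the rotations are composed of them. *)
Definition shear1 (a b : R) (p : R3 R) : R3 R :=
  (p.1.1 + (a * p.1.2 + b * p.2), p.1.2, p.2).
Definition shear2 (a b : R) (p : R3 R) : R3 R :=
  (p.1.1, p.1.2 + (a * p.1.1 + b * p.2), p.2).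
Definition shear3 (a b : R) (p : R3 R) : R3 R :=
  (p.1.1, p.1.2, p.2 + (a * p.1.1 + b * p.1.2)).

Let mlin (f g h : R3 R -> R) (a b : R) : measurable_fun setT f ->
  measurable_fun setT g -> measurable_fun setT h ->
  measurable_fun setT (fun p => f p + (a * g p + b * h p)).
Proof.
by move=> *; apply: measurable_funD => //; apply: measurable_funD;
  apply: measurable_funM.
Qed.

Lemma mpres_shear3 a b : mpres (shear3 a b).
Proof.
split.
  apply: measurable_R3; [exact: measurable_coord1|exact: measurable_coord2|].
  exact: (mlin _ _ measurable_coord3 measurable_coord1 measurable_coord2).
move=> A mA.
have := @product_measure_fibre2 _ _ _ _ R (@leb2 R) lebesgue_measure
  (fun q (z : measurableTypeR R) => z + (a * q.1 + b * q.2) : measurableTypeR R) A.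
move=> H; apply: etrans (H _ mA) => {H}.
  by congr (leb3 _); apply/seteqP; split=> -[[x y] z].
by move=> q B mB; apply: lebesgue_measure_shift.
Qed.

Lemma mpres_shear2 a b : mpres (shear2 a b).
Proof.
have m2 : measurable_fun setT (shear2 a b).
  apply: measurable_R3; [exact: measurable_coord1| |exact: measurable_coord3].
  exact: (mlin _ _ measurable_coord2 measurable_coord1 measurable_coord3).
split=> // A mA.
have := @product_measure_fibre1 _ _ _ _ R (@leb2 R) lebesgue_measure
  (fun z (q : R2 R) => (q.1, q.2 + (a * q.1 + b * z)) : R2 R) A.
move=> H; apply: etrans (H _ mA _) => {H}.
- by congr (leb3 _); apply/seteqP; split=> -[[x y] z].
- move=> z B mB.
  have := @product_measure_fibre2 _ _ _ _ R lebesgue_measure lebesgue_measure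
    (fun x (y : measurableTypeR R) => y + (a * x + b * z) : measurableTypeR R) B.
  move=> H; apply: etrans (H _ mB) => {H}.
    by congr (leb2 _); apply/seteqP; split=> -[x y].
  by move=> x C mC; apply: lebesgue_measure_shift.
- have /(_ measurableT A mA) := m2; rewrite setTI.
  by congr measurable; apply/seteqP; split=> -[[x y] z].
Qed.

Lemma mpres_shear1 a b : mpres (shear1 a b).
Proof.
have m1 : measurable_fun setT (shear1 a b).
  apply: measurable_R3; [|exact: measurable_coord2|exact: measurable_coord3].
  exact: (mlin _ _ measurable_coord1 measurable_coord2 measurable_coord3).
split=> // A mA.
have := @product_measure_fibre1 _ _ _ _ R (@leb2 R) lebesgue_measure
  (fun z (q : R2 R) => (q.1 + (a * q.2 + b * z), q.2) : R2 R) A.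
move=> H; apply: etrans (H _ mA _) => {H}.
- by congr (leb3 _); apply/seteqP; split=> -[[x y] z].
- move=> z B mB.
  have := @product_measure_fibre1 _ _ _ _ R lebesgue_measure lebesgue_measure
    (fun y (x : measurableTypeR R) => x + (a * y + b * z) : measurableTypeR R) B.
  move=> H; apply: etrans (H _ mB _) => {H}.
    by congr (leb2 _); apply/seteqP; split=> -[x y].
    by move=> x C mC; apply: lebesgue_measure_shift.
  have : measurable_fun setT (fun q : R2 R => (q.1 + (a * q.2 + b * z), q.2) : R2 R).
    apply: measurable_fun_pair; last exact: measurable_snd.
    apply: measurable_funD; first exact: measurable_fst.
    by apply: measurable_funD => //; apply: measurable_funM => //.
  by move=> /(_ measurableT B mB); rewrite setTI.
- have /(_ measurableT A mA) := m1; rewrite setTI.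
  by congr measurable; apply/seteqP; split=> -[[x y] z].
Qed.

Definition rot12 (c s : R) (p : R3 R) : R3 R :=
  (c * p.1.1 - s * p.1.2, s * p.1.1 + c * p.1.2, p.2).
Definition rot31 (c s : R) (p : R3 R) : R3 R :=
  (c * p.1.1 + s * p.2, p.1.2, c * p.2 - s * p.1.1).

(* A plane rotation by an angle different from pi is a product of three shears. *)
Lemma mpres_rot12 c s : c ^+ 2 + s ^+ 2 = 1 -> mpres (rot12 c s).
Proof.
have gen c' s' : s' != 0 -> c' ^+ 2 + s' ^+ 2 = 1 -> mpres (rot12 c' s').
  move=> s0 cs; rewrite (_ : rot12 c' s' =
    shear1 ((c' - 1) / s') 0 \o shear2 s' 0 \o shear1 ((c' - 1) / s') 0).
    by do !apply: mpres_comp; [exact: mpres_shear1|exact: mpres_shear2|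
      exact: mpres_shear1].
  apply/funext => -[[x y] z]; rewrite /rot12 /shear1 /shear2 /=.
  (* The shear parameter (c - 1) / s is minus the tangent of half the angle; this identity is c^2 +
     s^2 = 1. *)
  have E : - s' = ((c' - 1) / s') * (c' + 1).
    apply: (mulIf s0); rewrite mulrAC divfK//; lra.
  congr (_, _, _); last by field.
  by rewrite -[in LHS]mulNr E; field.
have [-> /= cs|s0] := eqVneq s 0; last exact: gen.
have : (c == 1) || (c == -1) by rewrite -sqrf_eq1; apply/eqP; move: cs; rewrite expr0n addr0.
(* For s = 0 and c = -1 the half turn is the square of this quarter turn. *)
have h : mpres (rot12 0 1) by apply: gen; rewrite ?oner_neq0// expr0n expr1n add0r.
case/orP => /eqP ->.
  rewrite (_ : rot12 1 0 = id); first by split=> //; exact: measurable_id.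
  by apply/funext => -[[x y] z]; rewrite /rot12/=; congr (_, _, _); ring.
rewrite (_ : rot12 (-1) 0 = rot12 0 1 \o rot12 0 1); first exact: mpres_comp.
by apply/funext => -[[x y] z]; rewrite /rot12/=; congr (_, _, _); ring.
Qed.

Lemma mpres_rot31 c s : c ^+ 2 + s ^+ 2 = 1 -> mpres (rot31 c s).
Proof.
have gen c' s' : s' != 0 -> c' ^+ 2 + s' ^+ 2 = 1 -> mpres (rot31 c' s').
  move=> s0 cs; rewrite (_ : rot31 c' s' =
    shear3 ((c' - 1) / s') 0 \o shear1 0 s' \o shear3 ((c' - 1) / s') 0).
    by do !apply: mpres_comp; [exact: mpres_shear3|exact: mpres_shear1|
      exact: mpres_shear3].
  apply/funext => -[[x y] z]; rewrite /rot31 /shear1 /shear3 /=.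
  have E : - s' = ((c' - 1) / s') * (c' + 1).
    apply: (mulIf s0); rewrite mulrAC divfK//; lra.
  congr (_, _, _); first by field.
  by rewrite -[in LHS]mulNr E; field.
have [-> /= cs|s0] := eqVneq s 0; last exact: gen.
have : (c == 1) || (c == -1) by rewrite -sqrf_eq1; apply/eqP; move: cs; rewrite expr0n addr0.
have h : mpres (rot31 0 1) by apply: gen; rewrite ?oner_neq0// expr0n expr1n add0r.
case/orP => /eqP ->.
  rewrite (_ : rot31 1 0 = id); first by split=> //; exact: measurable_id.
  by apply/funext => -[[x y] z]; rewrite /rot31/=; congr (_, _, _); ring.
rewrite (_ : rot31 (-1) 0 = rot31 0 1 \o rot31 0 1); first exact: mpres_comp.
by apply/funext => -[[x y] z]; rewrite /rot31/=; congr (_, _, _); ring.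
Qed.

(** * Quaternion parameters of SU(2) *)

Definition su2mx (a b : R[i]) : 'M[R[i]]_2 := \matrix_(i, j)
  if i == 0 then (if j == 0 then a else - b^*%C)
  else (if j == 0 then b else a^*%C).

(** The action of [su2mx a b] in real coordinates, a quadratic polynomial in the parameters.
    Identities between rotations thus become polynomial identities. *)
Definition qrot (a b : R[i]) (p : R3 R) : R3 R :=
  let: a1 +i* a2 := a in let: b1 +i* b2 := b in
  let: (x, y, z) := p in
  (2 * (a1 * b1 + a2 * b2) * z + (a1 ^+ 2 - a2 ^+ 2) * x + 2 * a1 * a2 * y
    - (b1 ^+ 2 - b2 ^+ 2) * x - 2 * b1 * b2 * y,
   2 * (a1 * b2 - a2 * b1) * z + (a1 ^+ 2 - a2 ^+ 2) * y - 2 * a1 * a2 * x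
    - 2 * b1 * b2 * x + (b1 ^+ 2 - b2 ^+ 2) * y,
   (a1 ^+ 2 + a2 ^+ 2 - b1 ^+ 2 - b2 ^+ 2) * z
    - 2 * ((a1 * b1 - a2 * b2) * x + (a1 * b2 + a2 * b1) * y)).

Definition unitq (a b : R[i]) := a * a^*%C + b * b^*%C = 1.

Lemma unitqE a b : unitq a b <->
  complex.Re a ^+ 2 + complex.Im a ^+ 2 + complex.Re b ^+ 2 + complex.Im b ^+ 2 = 1.
Proof.
rewrite /unitq; case: a => a1 a2; case: b => b1 b2 /=; split.
  by case=> H _; rewrite -[RHS]H; ring.
move=> H; apply/eqP; rewrite eq_complex /=; apply/andP; split; apply/eqP.
  by rewrite -[RHS]H; ring.
by ring.
Qed.

Lemma conjCE (x : R[i]) : Num.conj x = x^*%C.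
Proof. by []. Qed.

Lemma ord2E (i : 'I_2) : i = 0 \/ i = 1.
Proof. by case: i => [[|[|//]] ?]; [left|right]; apply: val_inj. Qed.

Lemma mx2P (A B : 'M[R[i]]_2) : A 0 0 = B 0 0 -> A 0 1 = B 0 1 ->
  A 1 0 = B 1 0 -> A 1 1 = B 1 1 -> A = B.
Proof.
by move=> *; apply/matrixP => i j; case: (ord2E i) => ->; case: (ord2E j) => ->.
Qed.

Lemma su2mxM a b c d : su2mx a b *m su2mx c d =
  su2mx (a * c - b^*%C * d) (b * c + a^*%C * d).
Proof.
apply: mx2P; rewrite !mxE !big_ord_recl big_ord0 !mxE /=; try ring.
- by rewrite rmorphD/= !rmorphM/= conjcK; ring.
- by rewrite rmorphB/= !rmorphM/= conjcK; ring.
Qed.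

Lemma su2mxC a b : (su2mx a b) ^t* = su2mx (a^*)%C (- b).
Proof.
by apply: mx2P; rewrite !mxE/= ?conjCE ?rmorphN/= ?conjcK ?opprK.
Qed.

Lemma su2mx1 : su2mx 1 0 = 1%:M.
Proof. by apply: mx2P; rewrite !mxE/= ?rmorph0 ?rmorph1 ?oppr0. Qed.

Lemma det2E (A : 'M[R[i]]_2) : \det A = A 0 0 * A 1 1 - A 0 1 * A 1 0.
Proof.
rewrite (expand_det_row _ 0) !big_ord_recl big_ord0 /cofactor !det_mx11 !mxE /=.
rewrite expr0 expr1 mul1r addr0 mulN1r mulrN.
by congr (_ * A _ _ - A _ _ * A _ _); apply: val_inj.
Qed.

Lemma su2mx_SU2 a b : unitq a b -> SU2 (su2mx a b).
Proof.
rewrite /unitq => ab; split=> /=.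
  apply/unitarymxP; rewrite su2mxC su2mxM -su2mx1; congr su2mx.
    by rewrite mulrN opprK -[RHS]ab; ring.
  by ring.
by rewrite det2E !mxE/= -[RHS]ab; ring.
Qed.

(** The conjugate transpose of [B] is its inverse, which for determinant 1 is the adjugate [A].
    Comparing entries expresses the second column of [B] through the first. *)
Lemma SU2P (B : 'M[R[i]]_2) : SU2 B -> exists a b, unitq a b /\ B = su2mx a b.
Proof.
move=> [/unitarymxP uB dB].
have BU : B \in unitmx by rewrite unitmxE dB unitr1.
pose A : 'M[R[i]]_2 := \matrix_(i, j)
  if i == 0 then (if j == 0 then B 1 1 else - B 0 1)
  else (if j == 0 then - B 1 0 else B 0 0).
have E : B ^t* = A.
  apply: (can_inj (mulKmx BU)); rewrite uB -dB det2E.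
  have l01 : lift ord0 ord0 = 1 :> 'I_2 by apply: val_inj.
  by apply: mx2P; rewrite !mxE /= ?big_ord_recl ?big_ord0 !mxE /= ?l01; ring.
have E1 : B 1 1 = (B 0 0)^*%C.
  by have := congr1 (fun M : 'M[R[i]]_2 => M 0 0) E; rewrite !mxE /= => <-.
have E2 : - B 0 1 = (B 1 0)^*%C.
  by have := congr1 (fun M : 'M[R[i]]_2 => M 0 1) E; rewrite !mxE /= => <-.
exists (B 0 0), (B 1 0); split.
  rewrite /unitq -E1 -E2 -[RHS]dB det2E; ring.
by apply: mx2P; rewrite !mxE //= -E2 opprK.
Qed.

Lemma su2mx_rot a b p : su2_rot (su2mx a b) p = qrot a b p.
Proof.
case: p => [[x y] z]; case: a => a1 a2; case: b => b1 b2.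
rewrite /su2_rot su2mxC !mxE !big_ord_recl !big_ord0 !mxE !big_ord_recl !big_ord0 !mxE /=.
by congr (_, _, _); ring.
Qed.

Lemma qrotM a b c d p : qrot a b (qrot c d p) =
  qrot (a * c - b^*%C * d) (b * c + a^*%C * d) p.
Proof.
case: p => [[x y] z]; case: a => a1 a2; case: b => b1 b2; case: c => c1 c2.
by case: d => d1 d2 /=; congr (_, _, _); ring.
Qed.

Lemma qrot_dot a b k p : unitq a b -> dot3 (qrot a b k) (qrot a b p) = dot3 k p.
Proof.
move=> /unitqE; case: p => [[x y] z]; case: k => [[u v] w]; case: a => a1 a2.
case: b => b1 b2 /=; rewrite /dot3/= => E.
(* For arbitrary parameters the dot product is multiplied by (|a|^2 + |b|^2)^2. *)
transitivity ((a1 ^+ 2 + a2 ^+ 2 + b1 ^+ 2 + b2 ^+ 2) ^+ 2 * (u * x + v * y + w * z)).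
  by ring.
by rewrite E; ring.
Qed.

Lemma qrot1 p : qrot 1 0 p = p.
Proof. by case: p => [[x y] z] /=; congr (_, _, _); ring. Qed.

Lemma su2_rotM A B (p : R3 R) : SU2 A -> SU2 B ->
  su2_rot (A *m B) p = su2_rot A (su2_rot B p).
Proof.
move=> /SU2P[a [b [_ ->]]] /SU2P[c [d [_ ->]]].
by rewrite su2mxM !su2mx_rot qrotM.
Qed.

Lemma SU2M A B : @SU2 R A -> SU2 B -> SU2 (A *m B).
Proof.
move=> [/= uA dA] [/= uB dB]; split=> /=; first exact: mul_unitarymx.
by rewrite det_mulmx dA dB mulr1.
Qed.

Lemma SU21 : @SU2 R 1%:M.
Proof. by rewrite -su2mx1; apply: su2mx_SU2; apply/unitqE => /=; ring. Qed.

Lemma su2_rot1 (p : R3 R) : su2_rot 1%:M p = p.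
Proof. by rewrite -su2mx1 su2mx_rot qrot1. Qed.

Lemma SU2V B : @SU2 R B -> SU2 (invmx B).
Proof.
move=> SB; have [_ /= dB] := SB; have [a [b [ab BE]]] := SU2P SB.
have BU : B \in unitmx by rewrite unitmxE dB unitr1.
have -> : invmx B = su2mx (a^*)%C (- b).
  apply: (can_inj (mulKmx BU)); rewrite mulmxV// BE -su2mxC.
  by have [/unitarymxP -> _] := su2mx_SU2 ab.
by apply: su2mx_SU2; rewrite /unitq conjcK rmorphN mulrNN -[RHS]ab mulrC.
Qed.

Lemma SU2_unit B : @SU2 R B -> B \in unitmx.
Proof. by move=> [_ /= dB]; rewrite unitmxE dB unitr1. Qed.

Lemma su2_rotK B : @SU2 R B -> cancel (su2_rot B) (su2_rot (invmx B)).
Proof.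
move=> SB p; rewrite -su2_rotM//; last exact: SU2V.
by rewrite mulVmx ?SU2_unit// su2_rot1.
Qed.

Lemma su2_rotVK B : @SU2 R B -> cancel (su2_rot (invmx B)) (su2_rot B).
Proof.
move=> SB p; rewrite -su2_rotM//; last exact: SU2V.
by rewrite mulmxV ?SU2_unit// su2_rot1.
Qed.

Lemma su2_rot_dot B k p : @SU2 R B -> dot3 (su2_rot B k) (su2_rot B p) = dot3 k p.
Proof. by move=> /SU2P[a [b [ab ->]]]; rewrite !su2mx_rot qrot_dot. Qed.

Lemma su2_rotZ B (c : R) (p : R3 R) : SU2 B ->
  su2_rot B (c * p.1.1, c * p.1.2, c * p.2) =
  (c * (su2_rot B p).1.1, c * (su2_rot B p).1.2, c * (su2_rot B p).2).
Proof.
move=> /SU2P[a [b [_ ->]]]; rewrite !su2mx_rot; case: p => [[x y] z].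
by case: a => a1 a2; case: b => b1 b2 /=; congr (_, _, _); ring.
Qed.

Lemma dot3_eq0 (p : R3 R) : (dot3 p p == 0) = (p == 0).
Proof.
case: p => [[x y] z]; rewrite /dot3 /= -!expr2.
rewrite !paddr_eq0 ?addr_ge0 ?sqr_ge0// !sqrf_eq0.
by rewrite -[RHS]/((_ == _) && (_ == _)) -[in RHS]/((_ == _) && (_ == _)).
Qed.

Lemma su2_rot_eq0 B (p : R3 R) : SU2 B -> (su2_rot B p == 0) = (p == 0).
Proof. by move=> SB; rewrite -dot3_eq0 su2_rot_dot// dot3_eq0. Qed.

(** Euler angles: [B] is a product of a diagonal, a real and a diagonal matrix, which act as
    rotations about the third, the second and the third axis. *)
Lemma mpres_su2_rot B : SU2 B -> mpres (su2_rot B).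
Proof.
have normcU (z : R[i]) : z * z^*%C = 1 -> complex.Re z ^+ 2 + complex.Im z ^+ 2 = 1.
  by case: z => x y /= [H _]; rewrite -[RHS]H; ring.
have phase u : u * u^*%C = 1 -> mpres (su2_rot (su2mx u 0)).
  move=> /normcU uu.
  rewrite (_ : su2_rot _ = rot12 (complex.Re u ^+ 2 - complex.Im u ^+ 2) (- (2 * complex.Re u * complex.Im u))).
    by apply: mpres_rot12; rewrite -[RHS](expr1n _ 2) -[in RHS]uu; ring.
  apply/funext => -[[x y] z]; rewrite su2mx_rot /rot12; case: u uu => u1 u2 /= uu.
  congr (_, _, _); [ring|ring|]; rewrite -[RHS]mul1r -uu; ring.
have rr c s : c ^+ 2 + s ^+ 2 = 1 -> mpres (su2_rot (su2mx c%:C s%:C)).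
  move=> cs; rewrite (_ : su2_rot _ = rot31 (c ^+ 2 - s ^+ 2) (2 * c * s)).
    by apply: mpres_rot31; rewrite -[RHS](expr1n _ 2) -[in RHS]cs; ring.
  apply/funext => -[[x y] z]; rewrite su2mx_rot /rot31 /=.
  congr (_, _, _); [ring| |ring]; rewrite -[RHS]mul1r -cs; ring.
move=> /SU2P[a [b [ab ->]]].
(* Polar form, with phase 1 for z = 0. *)
have pol (z : R[i]) : exists2 w : R[i], w * w^*%C = 1 & z = w * (Normc.normc z)%:C.
  have [->|z0] := eqVneq z 0; first by exists 1; rewrite ?rmorph1 ?mulr1// Normc.normc0 mulr0.
  have nz : (Normc.normc z)%:C != 0.
    by rewrite -[X in X != _]/(`|z|) normr_eq0.
  exists (z / (Normc.normc z)%:C); last by rewrite divfK.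
  have -> : (z / (Normc.normc z)%:C)^*%C = z^*%C / (Normc.normc z)%:C.
    by rewrite rmorphM; congr (_ * _); rewrite [LHS]conjc_inv conjc_real.
  rewrite mulrACA -invfM -sqr_normc -[(Normc.normc z)%:C]/(`|z|) -expr2 mulfV//.
  by rewrite expf_neq0.
have [wa wa1 aE] := pol a; have [wb wb1 bE] := pol b.
(* The product of the factors with parameters (u, 0), (|a|, |b|), (v, 0) has parameters u v |a| and
   u^* v |b|. Matching the phases [wa] and [wb] leads to v^2 = wa wb and u = wa v^*. *)
set v := sqrtc (wa * wb).
have vv : v ^+ 2 = wa * wb by rewrite sqr_sqrtc.
have v1 : v * v^*%C = 1.
  have H : (v * v^*%C) ^+ 2 = 1.
    rewrite exprMn -rmorphXn/= vv rmorphM/= mulrACA.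
    by rewrite wa1 wb1 mulr1.
  have : 0 <= v * v^*%C by apply: mulcJ_ge0.
  move: H; move/eqP; rewrite sqrf_eq1 => /orP[/eqP//|/eqP ->].
  by rewrite oppr_ge0 ler10.
pose u := wa * v^*%C.
have u1 : u * u^*%C = 1.
  by rewrite /u rmorphM/= conjcK mulrACA wa1 mul1r mulrC.
have uv : u * v = wa by rewrite /u -mulrA [_ * v]mulrC v1 mulr1.
have ucv : u^*%C * v = wb.
  rewrite /u rmorphM/= conjcK -mulrA -expr2 vv mulrA [wa^*%C * _]mulrC wa1 mul1r//.
have nn : Normc.normc a ^+ 2 + Normc.normc b ^+ 2 = 1.
  move/unitqE: (ab); case: (a) => a1 a2; case: (b) => b1 b2 /=.
  by rewrite !sqr_sqrtr ?addr_ge0 ?sqr_ge0// addrA.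
have -> : su2mx a b = su2mx u 0 *m su2mx (Normc.normc a)%:C (Normc.normc b)%:C *m su2mx v 0.
  rewrite !su2mxM !mul0r conjc0 !mul0r !mulr0 !subr0 !addr0 add0r {1}aE {1}bE.
  congr su2mx.
    by rewrite -{1}uv; rewrite -!mulrA [v * _]mulrC.
  by rewrite -{1}ucv -!mulrA [v * _]mulrC.
have SU : SU2 (su2mx u 0) by apply: su2mx_SU2; rewrite /unitq u1 mul0r addr0.
have SV : SU2 (su2mx v 0) by apply: su2mx_SU2; rewrite /unitq v1 mul0r addr0.
have SY : SU2 (su2mx (Normc.normc a)%:C (Normc.normc b)%:C).
  by apply: su2mx_SU2; apply/unitqE; rewrite /= !expr0n/= !addr0.
rewrite (_ : su2_rot _ = su2_rot (su2mx u 0) \o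
  su2_rot (su2mx (Normc.normc a)%:C (Normc.normc b)%:C) \o su2_rot (su2mx v 0)).
  by do !apply: mpres_comp; [exact: phase|exact: rr|exact: phase].
by apply/funext => p /=; rewrite !su2_rotM//; exact: SU2M.
Qed.

(** Both points are reached from the point of the same norm on the positive third axis. *)
Lemma su2_rot_trans (p q : R3 R) : dot3 p p = dot3 q q ->
  exists2 B, SU2 B & su2_rot B p = q.
Proof.
have pole (p' : R3 R) : exists2 B, SU2 B & su2_rot B (0, 0, Num.sqrt (dot3 p' p')) = p'.
  case: p' => [[x y] z]; set r := Num.sqrt _.
  have rE : r ^+ 2 = x ^+ 2 + y ^+ 2 + z ^+ 2.
    by rewrite sqr_sqrtr /dot3 /= -?expr2// !addr_ge0 ?sqr_ge0.
  have r0 : 0 <= r by apply: sqrtr_ge0.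
  (* The origin and the negative third axis, where the parameter [a] below would vanish or have
     denominator 0, are treated apart. *)
  have [rz|rz] := eqVneq (r + z) 0.
    have zr : z = - r by lra.
    have : x ^+ 2 + y ^+ 2 == 0 by apply/eqP; move: rE; rewrite zr; lra.
    rewrite paddr_eq0 ?sqr_ge0// !sqrf_eq0 => /andP[/eqP -> /eqP ->].
    exists (su2mx 0 1); first by apply: su2mx_SU2; apply/unitqE => /=; ring.
    by rewrite su2mx_rot zr /=; congr (_, _, _); ring.
  have zr : `|z| <= r by rewrite -[r]ger0_norm// -ler_sqr ?nnegrE// !real_normK ?num_real// rE lerDr addr_ge0 ?sqr_ge0.
  have rp : 0 < r.
    rewrite lt_neqAle r0 andbT eq_sym; apply: contraNneq rz => r00.
    by move: zr; rewrite r00 normr_le0 => /eqP ->; rewrite addr0.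
  have rzp : 0 < r + z by move: zr rz; rewrite ler_norml => /andP[? _] ?; lra.
  (* The cosine of half the polar angle of the point; the second parameter b is then determined by x
     + i y = 2 r a b. *)
  pose a := Num.sqrt ((r + z) / (2 * r)).
  have a2 : a ^+ 2 = (r + z) / (2 * r) by rewrite sqr_sqrtr// divr_ge0//; lra.
  have a0 : 0 < a by rewrite sqrtr_gt0 divr_gt0//; lra.
  have a0' : a != 0 by rewrite gt_eqF.
  have r0' : r != 0 by rewrite gt_eqF.
  have xy : x ^+ 2 + y ^+ 2 = (r - z) * (r + z) by move: rE; lra.
  have bb : (x / (2 * r * a)) ^+ 2 + (y / (2 * r * a)) ^+ 2 = (r - z) / (2 * r).
    rewrite !expr_div_n -mulrDl xy !exprMn a2.
    by field; rewrite r0' rz.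
  exists (su2mx a%:C ((x / (2 * r * a)) +i* (y / (2 * r * a)))).
    apply: su2mx_SU2; apply/unitqE => /=; rewrite expr0n addr0 -addrA bb a2.
    by field.
  rewrite su2mx_rot /=; congr (_, _, _).
  - by field; rewrite a0' r0'.
  - by field; rewrite a0' r0'.
  - transitivity (a ^+ 2 * r - ((x / (2 * r * a)) ^+ 2 + (y / (2 * r * a)) ^+ 2) * r).
      by ring.
    by rewrite bb a2; field.
move=> pq; have [A SA Ap] := pole p; have [B SB Bq] := pole q.
exists (B *m invmx A); first by apply: SU2M => //; exact: SU2V.
rewrite su2_rotM//; last exact: SU2V.
by rewrite -{1}Ap su2_rotK// pq.
Qed.

End rotation_invariance.

(** * Integrals of complex functions *)

Section complex_norm.
Context {R : realType}.
Implicit Types z w : R[i].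
Local Notation normc := (@Normc.normc R).

Lemma normc_ge0 z : 0 <= normc z.
Proof. by case: z => a b; exact: sqrtr_ge0. Qed.

Lemma normc_eq0 z : (normc z == 0) = (z == 0).
Proof.
by apply/eqP/eqP => [/Normc.eq0_normc//|->]; rewrite Normc.normc0.
Qed.

Lemma normc_sqr z : normc z ^+ 2 = complex.Re z ^+ 2 + complex.Im z ^+ 2.
Proof. by case: z => a b /=; rewrite sqr_sqrtr// addr_ge0 ?sqr_ge0. Qed.

Lemma mulJc z : z^*%C * z = (normc z ^+ 2)%:C.
Proof.
rewrite normc_sqr; case: z => a b /=; apply/eqP; rewrite eq_complex /=.
by apply/andP; split; apply/eqP; ring.
Qed.

Lemma normc_Re z : `|complex.Re z| <= normc z.
Proof.
rewrite -ler_sqr ?nnegrE ?normc_ge0// real_normK ?num_real// normc_sqr.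
by rewrite lerDl sqr_ge0.
Qed.

Lemma normc_Im z : `|complex.Im z| <= normc z.
Proof.
rewrite -ler_sqr ?nnegrE ?normc_ge0// real_normK ?num_real// normc_sqr.
by rewrite lerDr sqr_ge0.
Qed.

Lemma normc_le z : normc z <= `|complex.Re z| + `|complex.Im z|.
Proof.
rewrite -ler_sqr ?nnegrE ?normc_ge0 ?addr_ge0// normc_sqr sqrrD !real_normK ?num_real//.
by rewrite -addrA [X in _ <= _ + X]addrC addrA lerDl mulrn_wge0// mulr_ge0.
Qed.

Lemma normc_conj z : normc z^*%C = normc z.
Proof. by case: z => a b /=; rewrite sqrrN. Qed.

Lemma normc_real (x : R) : normc x%:C = `|x|.
Proof. by rewrite /= expr0n addr0 sqrtr_sqr. Qed.

Lemma cReM z w : complex.Re (z * w) =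
  complex.Re z * complex.Re w - complex.Im z * complex.Im w.
Proof. by case: z; case: w. Qed.

Lemma cImM z w : complex.Im (z * w) =
  complex.Re z * complex.Im w + complex.Im z * complex.Re w.
Proof. by case: z; case: w. Qed.

Lemma cReD z w : complex.Re (z + w) = complex.Re z + complex.Re w.
Proof. by case: z; case: w. Qed.

Lemma cImD z w : complex.Im (z + w) = complex.Im z + complex.Im w.
Proof. by case: z; case: w. Qed.

Lemma cplx_eq z w : complex.Re z = complex.Re w -> complex.Im z = complex.Im w -> z = w.
Proof. by case: z => ? ?; case: w => ? ? /= -> ->. Qed.

Lemma normc_sum n (F : 'I_n -> R[i]) : normc (\sum_i F i) <= \sum_i normc (F i).
Proof.
elim/big_ind2: _ => [|x1 x2 y1 y2 h1 h2|//]; first by rewrite Normc.normc0.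
by apply: le_trans (le_normcD _ _) _; exact: lerD.
Qed.

End complex_norm.

Section expi.
Context {R : realType}.

Lemma normc_expi (a : R) : Normc.normc (expi a) = 1.
Proof. by rewrite /= cos2Dsin2 sqrtr1. Qed.

Lemma expiD (a b : R) : expi (a + b) = expi a * expi b.
Proof.
apply/eqP; rewrite eq_complex /= cosD sinD eqxx/=; apply/eqP; ring.
Qed.

Lemma expi0 : expi (0 : R) = 1.
Proof. by rewrite /expi cos0 sin0. Qed.

Lemma expiN (a : R) : expi (- a) = (expi a)^*%C.
Proof. by rewrite /expi cosN sinN. Qed.

Lemma cos_lip (a b : R) : `|cos a - cos b| <= `|a - b|.
Proof.
wlog ab : a b / b < a.
  move=> H; have [ab|ba|->] := ltgtP a b; last by rewrite !subrr normr0.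
    by rewrite distrC [leRHS]distrC; exact: H.
  exact: H.
have [c _ ->] := @MVT R cos (fun x => - sin x) b a ab
  (fun x _ => is_derive_cos x) (continuous_subspaceT (@continuous_cos R)).
rewrite normrM ler_piMl// normrN ler_norml.
by rewrite sin_geN1 sin_le1.
Qed.

Lemma sin_lip (a b : R) : `|sin a - sin b| <= `|a - b|.
Proof.
wlog ab : a b / b < a.
  move=> H; have [ab|ba|->] := ltgtP a b; last by rewrite !subrr normr0.
    by rewrite distrC [leRHS]distrC; exact: H.
  exact: H.
have [c _ ->] := @MVT R sin cos b a ab
  (fun x _ => is_derive_sin x) (continuous_subspaceT (@continuous_sin R)).
by rewrite normrM ler_piMl// ler_norml cos_geN1 cos_le1.
Qed.

Lemma expi_lip (a b : R) : Normc.normc (expi a - expi b) <= 2 * `|a - b|.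
Proof.
apply: le_trans (normc_le _) _ => /=.
by rewrite mulr_natl mulr2n lerD ?cos_lip ?sin_lip.
Qed.

End expi.

(** * Measurability of complex functions *)

Section cmeasurable.
Context {R : realType} d (X : measurableType d).
Implicit Types f g : X -> R[i].
Local Notation cmeas := (@cmeasurable R d X setT).

Lemma cmeas_cst (c : R[i]) : cmeas (fun=> c).
Proof. by split; exact: measurable_cst. Qed.

Lemma cmeasD f g : cmeas f -> cmeas g -> cmeas (fun x => f x + g x).
Proof.
move=> [f1 f2] [g1 g2]; split.
  rewrite (_ : (fun _ => _) = (fun x => complex.Re (f x) + complex.Re (g x))); last first.
    by apply/funext => x; rewrite cReD.
  exact: measurable_funD.
rewrite (_ : (fun _ => _) = (fun x => complex.Im (f x) + complex.Im (g x))); last first.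
  by apply/funext => x; rewrite cImD.
exact: measurable_funD.
Qed.

Lemma cmeasM f g : cmeas f -> cmeas g -> cmeas (fun x => f x * g x).
Proof.
move=> [f1 f2] [g1 g2]; split.
  rewrite (_ : (fun _ => _) = (fun x => complex.Re (f x) * complex.Re (g x)
     - complex.Im (f x) * complex.Im (g x))); last first.
    by apply/funext => x; rewrite cReM.
  by apply: measurable_funB; exact: measurable_funM.
rewrite (_ : (fun _ => _) = (fun x => complex.Re (f x) * complex.Im (g x)
     + complex.Im (f x) * complex.Re (g x))); last first.
  by apply/funext => x; rewrite cImM.
by apply: measurable_funD; exact: measurable_funM.
Qed.

Lemma cmeasN f : cmeas f -> cmeas (fun x => - f x).
Proof.
move=> mf; under eq_fun do rewrite -mulN1r.
by apply: cmeasM => //; exact: cmeas_cst.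
Qed.

Lemma cmeasB f g : cmeas f -> cmeas g -> cmeas (fun x => f x - g x).
Proof. by move=> mf mg; apply: cmeasD => //; exact: cmeasN. Qed.

Lemma cmeas_conj f : cmeas f -> cmeas (fun x => (f x)^*%C).
Proof.
move=> [f1 f2]; split.
  by rewrite (_ : (fun _ => _) = (fun x => complex.Re (f x)))//;
    apply/funext => x; case: (f x).
rewrite (_ : (fun _ => _) = (fun x => - complex.Im (f x))).
  exact: measurable_funN.
by apply/funext => x; case: (f x).
Qed.

Lemma cmeas_real (h : X -> R) : measurable_fun setT h -> cmeas (fun x => (h x)%:C).
Proof. by move=> mh; split => //; exact: measurable_cst. Qed.

Lemma cmeas_sum n (F : 'I_n -> X -> R[i]) : (forall i, cmeas (F i)) ->
  cmeas (fun x => \sum_i F i x).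
Proof.
elim: n F => [|n IH] F mF.
  by under eq_fun do rewrite big_ord0; exact: cmeas_cst.
by under eq_fun do rewrite big_ord_recl; apply: cmeasD; [exact: mF|apply: IH].
Qed.

Lemma cmeas_expi (h : X -> R) : measurable_fun setT h -> cmeas (fun x => expi (h x)).
Proof.
move=> mh; split => /=.
- exact: (measurableT_comp (continuous_measurable_fun (@continuous_cos R)) mh).
- exact: (measurableT_comp (continuous_measurable_fun (@continuous_sin R)) mh).
Qed.

Lemma measurable_sqrt (h : X -> R) : measurable_fun setT h ->
  measurable_fun setT (fun x => Num.sqrt (h x)).
Proof.
move=> mh; have ms : measurable_fun setT (Num.sqrt : R -> R).
  apply: nondecreasing_measurable => // x y xy.
  have [x0|x0] := leP 0 x; first by rewrite ler_sqrt// (le_trans x0).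
  by rewrite (ler0_sqrtr (ltW x0)) sqrtr_ge0.
exact: (measurableT_comp ms mh).
Qed.

Lemma measurable_normc f : cmeas f -> measurable_fun setT (fun x => Normc.normc (f x)).
Proof.
move=> [f1 f2].
rewrite (_ : (fun _ => _) = (fun x =>
  Num.sqrt (complex.Re (f x) ^+ 2 + complex.Im (f x) ^+ 2))); last first.
  by apply/funext => x; case: (f x).
by apply: measurable_sqrt; apply: measurable_funD; exact: measurable_funX.
Qed.

Lemma measurable_inv (h : X -> R) : measurable_fun setT h -> (forall x, 0 <= h x) ->
  measurable_fun setT (fun x => (h x)^-1).
Proof.
move=> mh h0; rewrite (_ : (fun _ => _) = (fun x => h x `^ (-1))); last first.
  by apply/funext => x; rewrite powRN powRr1.
exact: (measurableT_comp (measurable_powR _) mh).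
Qed.

End cmeasurable.

Lemma cmeas_comp {R : realType} d d' (X : measurableType d) (Y : measurableType d')
  (phi : X -> Y) (f : Y -> R[i]) :
  cmeasurable setT f -> measurable_fun setT phi -> cmeasurable setT (f \o phi).
Proof.
move=> [f1 f2] mphi; split.
- exact: (measurableT_comp f1 mphi).
- exact: (measurableT_comp f2 mphi).
Qed.

Section complex_integral.
Context {R : realType}.
Implicit Types (f g : wave R) (h : R3 R -> R).
Local Notation mu := (@leb3 R).
Local Notation rint h := (mu.-integrable setT (EFin \o h)).
Local Notation cmeas := (@cmeasurable R _ (R3 R) setT).
Local Notation L1 := (@Lpow R 1).

Lemma Rintegral_ae (h k : R3 R -> R) : measurable_fun setT h -> measurable_fun setT k ->
  h = k %[ae mu] -> \int[mu]_x h x = \int[mu]_x k x.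
Proof.
move=> mh mk hk; rewrite /Rintegral; congr fine.
apply: ae_eq_integral => //; [exact/measurable_EFinP|exact/measurable_EFinP|].
by apply: filterS hk => x /= /(_ I) ->.
Qed.

Lemma cint_ae f g : cmeas f -> cmeas g -> f = g %[ae mu] ->
  cint setT f = cint setT g.
Proof.
move=> [f1 f2] [g1 g2] fg; rewrite /cint; congr (_ +i* _); apply: Rintegral_ae => //.
- by apply: filterS fg => x /= H _; rewrite H.
- by apply: filterS fg => x /= H _; rewrite H.
Qed.

Lemma cint_mkcond (D : set (R3 R)) f :
  cint D f = cint setT (fun x => (\1_D x)%:C * f x).
Proof.
rewrite /cint; congr (_ +i* _); rewrite Rintegral_mkcond; apply: eq_Rintegral => x _.
  rewrite patchE cReM /= mul0r subr0 indicE.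
  by case: ifPn => ?; rewrite ?mul1r ?mul0r.
rewrite patchE cImM /= mul0r addr0 indicE.
by case: ifPn => ?; rewrite ?mul1r ?mul0r.
Qed.

Lemma L1P f : L1 f <-> [/\ cmeas f, rint (@complex.Re R \o f) & rint (@complex.Im R \o f)].
Proof.
have absE (h : R3 R -> R) : rint h <-> measurable_fun setT h /\
    (\int[mu]_x (`|h x|)%:E < +oo)%E.
  split=> [/integrableP[/measurable_EFinP mh oo]|[/measurable_EFinP mh oo]].
    by split.
  exact/integrableP.
split=> [[mf oo]|[mf /absE[_ i1] /absE[_ i2]]].
  have [f1 f2] := mf.
  have H (h : R3 R -> R) : measurable_fun setT h -> (forall x, `|h x| <= Normc.normc (f x)) -> rint h.
    move=> mh hf; apply/absE; split=> //; apply: le_lt_trans oo.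
    apply: ge0_le_integral => //.
    - by apply/measurable_EFinP; exact: measurableT_comp.
    - by apply/measurable_EFinP; apply: measurable_funX; exact: measurable_normc.
    - by move=> x _; rewrite lee_fin expr1.
  by split=> //; apply: H => // x; [exact: normc_Re|exact: normc_Im].
split=> //; have [f1 f2] := mf.
have m1 : measurable_fun setT (fun x => (`|complex.Re (f x)|)%:E).
  by apply/measurable_EFinP; exact: measurableT_comp.
have m2 : measurable_fun setT (fun x => (`|complex.Im (f x)|)%:E).
  by apply/measurable_EFinP; exact: measurableT_comp.
apply: (@le_lt_trans _ _ (\int[mu]_x ((`|complex.Re (f x)|)%:E + (`|complex.Im (f x)|)%:E)))%E.
  apply: ge0_le_integral => //.
  - by move=> x _; rewrite lee_fin exprn_ge0// normc_ge0.
  - by apply/measurable_EFinP; apply: measurable_funX; exact: measurable_normc.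
  - exact: emeasurable_funD.
  - by move=> x _; rewrite -EFinD lee_fin expr1 normc_le.
by rewrite ge0_integralD//= lte_add_pinfty.
Qed.

Lemma L1_meas f : L1 f -> cmeas f. Proof. by case. Qed.

Lemma rintD h k : rint h -> rint k -> rint (fun x => h x + k x).
Proof.
move=> ih ik; have := integrableD measurableT ih ik.
by apply: eq_integrable => // x _ /=; rewrite EFinD.
Qed.

Lemma rintZ (c : R) h : rint h -> rint (fun x => c * h x).
Proof.
move=> ih; have := integrableZl measurableT c ih.
by apply: eq_integrable => // x _ /=; rewrite EFinM.
Qed.

Lemma rint_le h k : measurable_fun setT h -> rint k -> (forall x, `|h x| <= k x) -> rint h.
Proof.
move=> mh ik hk; apply: (le_integrable measurableT) ik; first exact/measurable_EFinP.
by move=> x _ /=; rewrite lee_fin (le_trans (hk x))// ler_norm.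
Qed.

Lemma rint_meas h : rint h -> measurable_fun setT h.
Proof. by move=> /measurable_int/measurable_EFinP. Qed.

Lemma rint_abs h : rint h -> rint (fun x => `|h x|).
Proof. exact: integrable_norm. Qed.

Lemma L1_le f h : cmeas f -> rint h -> (forall x, Normc.normc (f x) <= h x) -> L1 f.
Proof.
move=> mf ih fh; apply/L1P; split=> //; case: (mf) => f1 f2; apply: (rint_le _ ih) => // x.
- by apply: le_trans (fh x); exact: normc_Re.
- by apply: le_trans (fh x); exact: normc_Im.
Qed.

Lemma L1_normc f : L1 f -> rint (fun x => Normc.normc (f x)).
Proof.
move=> [mf oo]; apply/integrableP; split.
  by apply/measurable_EFinP; exact: measurable_normc.
apply: le_lt_trans oo; apply: ge0_le_integral => //.
- apply/measurable_EFinP; apply: measurableT_comp => //; exact: measurable_normc.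
- by apply/measurable_EFinP; apply: measurable_funX; exact: measurable_normc.
- by move=> x _ /=; rewrite lee_fin ger0_norm ?normc_ge0.
Qed.

Lemma L1D f g : L1 f -> L1 g -> L1 (fun x => f x + g x).
Proof.
move=> f1 g1; apply: (L1_le _ (rintD (L1_normc f1) (L1_normc g1))).
  by apply: cmeasD; exact: L1_meas.
by move=> x; exact: le_normcD.
Qed.

Lemma L1_bmul (M : R) f g : L1 f -> cmeas g -> (forall x, Normc.normc (g x) <= M) ->
  L1 (fun x => g x * f x).
Proof.
move=> f1 mg gM; apply: (L1_le _ (rintZ M (L1_normc f1))).
  by apply: cmeasM => //; exact: L1_meas.
by move=> x; rewrite Normc.normcM ler_wpM2r ?normc_ge0.
Qed.

Lemma L1Z (c : R[i]) f : L1 f -> L1 (fun x => c * f x).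
Proof.
by move=> f1; apply: (@L1_bmul (Normc.normc c)) => //; exact: cmeas_cst.
Qed.

Lemma L1_conj f : L1 f -> L1 (fun x => (f x)^*%C).
Proof.
move=> f1; apply: (L1_le _ (L1_normc f1)); first exact/cmeas_conj/L1_meas.
by move=> x; rewrite normc_conj.
Qed.

Lemma L1_0 : L1 (fun=> 0).
Proof.
split; first exact: cmeas_cst.
by under eq_integral do rewrite Normc.normc0 expr0n/=; rewrite integral0.
Qed.

Lemma L1_sum n (F : 'I_n -> wave R) : (forall i, L1 (F i)) -> L1 (fun x => \sum_i F i x).
Proof.
elim: n F => [|n IH] F mF.
  by under eq_fun do rewrite big_ord0; exact: L1_0.
by under eq_fun do rewrite big_ord_recl; apply: L1D; [exact: mF|apply: IH].
Qed.

Lemma L1_real h : rint h -> L1 (fun x => (h x)%:C).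
Proof.
move=> ih; apply: (L1_le _ (rint_abs ih)); first by apply: cmeas_real; exact: rint_meas.
by move=> x; rewrite normc_real.
Qed.

Lemma cintD f g : L1 f -> L1 g ->
  cint setT (fun x => f x + g x) = cint setT f + cint setT g.
Proof.
move=> /L1P[_ f1 f2] /L1P[_ g1 g2]; apply: cplx_eq; rewrite ?cReD ?cImD /=.
  by rewrite -RintegralD//; apply: eq_Rintegral => x _; rewrite cReD.
by rewrite -RintegralD//; apply: eq_Rintegral => x _; rewrite cImD.
Qed.

Lemma cint_conj f : L1 f -> cint setT (fun x => (f x)^*%C) = (cint setT f)^*%C.
Proof.
move=> /L1P[_ f1 f2]; apply: cplx_eq => /=.
  by apply: eq_Rintegral => x _; case: (f x).
rewrite -[RHS]mulN1r -RintegralZl//; apply: eq_Rintegral => x _.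
by rewrite mulN1r; case: (f x).
Qed.

Lemma cintZ (c : R[i]) f : L1 f -> cint setT (fun x => c * f x) = c * cint setT f.
Proof.
move=> /L1P[_ f1 f2]; apply: cplx_eq; rewrite ?cReM ?cImM /=.
  rewrite -!RintegralZl// -RintegralB//; [|exact: rintZ|exact: rintZ].
  by apply: eq_Rintegral => x _; rewrite cReM.
rewrite -!RintegralZl// -RintegralD//; [|exact: rintZ|exact: rintZ].
by apply: eq_Rintegral => x _; rewrite cImM.
Qed.

Lemma cintZr (c : R[i]) f : L1 f -> cint setT (fun x => f x * c) = cint setT f * c.
Proof. by move=> f1; under eq_fun do rewrite mulrC; rewrite cintZ// mulrC. Qed.

Lemma cintN f : L1 f -> cint setT (fun x => - f x) = - cint setT f.
Proof.
by move=> f1; under eq_fun do rewrite -mulN1r; rewrite cintZ// mulN1r.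
Qed.

Lemma L1N f : L1 f -> L1 (fun x => - f x).
Proof. by move=> f1; under eq_fun do rewrite -mulN1r; exact: L1Z. Qed.

Lemma L1B f g : L1 f -> L1 g -> L1 (fun x => f x - g x).
Proof. by move=> f1 g1; apply: L1D => //; exact: L1N. Qed.

Lemma cintB f g : L1 f -> L1 g ->
  cint setT (fun x => f x - g x) = cint setT f - cint setT g.
Proof. by move=> f1 g1; rewrite cintD ?cintN//; exact: L1N. Qed.

Lemma cint0 : cint setT (fun=> 0 : R[i]) = 0.
Proof.
apply: cplx_eq => /=; rewrite /Rintegral.
  by under eq_integral do rewrite /=; rewrite integral0.
by under eq_integral do rewrite /=; rewrite integral0.
Qed.

Lemma cint_sum n (F : 'I_n -> wave R) : (forall i, L1 (F i)) ->
  cint setT (fun x => \sum_i F i x) = \sum_i cint setT (F i).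
Proof.
elim: n F => [|n IH] F mF.
  by under eq_fun do rewrite big_ord0; rewrite cint0 big_ord0.
under eq_fun do rewrite big_ord_recl; rewrite cintD ?IH ?big_ord_recl//.
by apply: L1_sum => i; exact: mF.
Qed.

(** The factor 2 comes from bounding real and imaginary part separately; it reappears in all
    constants below. *)
Lemma normc_cint f h : cmeas f -> rint h -> (forall x, Normc.normc (f x) <= h x) ->
  Normc.normc (cint setT f) <= 2 * \int[mu]_x h x.
Proof.
move=> mf ih fh; apply: le_trans (normc_le _) _ => /=.
have /L1P[_ f1 f2] := L1_le mf ih fh.
rewrite mulr_natl mulr2n lerD//.
- apply: le_trans (le_normr_Rintegral measurableT f1) _; apply: le_Rintegral => //;
    [exact: rint_abs|move=> x _; apply: le_trans (fh x); exact: normc_Re].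
- by apply: le_trans (le_normr_Rintegral measurableT f2) _; apply: le_Rintegral => //;
    [exact: rint_abs|move=> x _; apply: le_trans (fh x); exact: normc_Im].
Qed.

Lemma cint_real h : cint setT (fun x => (h x)%:C) = (\int[mu]_x h x)%:C.
Proof.
apply: cplx_eq => //=; rewrite /Rintegral; under eq_integral do rewrite /=.
by rewrite integral0.
Qed.

Lemma rint0_ae h : rint h -> (forall x, 0 <= h x) -> \int[mu]_x h x = 0 -> h = (fun=> 0) %[ae mu].
Proof.
move=> ih h0 E.
have mh : measurable_fun setT (EFin \o h) by exact: measurable_int ih.
have := (ae_eq_integral_abs mu measurableT mh).1; move=> H.
have {H} : ae_eq mu setT (EFin \o h) (cst 0%E).
  apply: H; under eq_integral do rewrite /= ger0_norm//.
  have := integrable_fin_num measurableT ih => /fineK <-.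
  by rewrite -[fine _]/(Rintegral mu setT h) E.
by apply: filterS => x /= /(_ I) [].
Qed.

End complex_integral.

(** * Integrals depending on a parameter and the theorem of Fubini *)

Section parametric_integrals.
Context {R : realType}.

(** Tonelli applies to the positive and the negative part separately, and [fine] is measurable. The
    statement therefore covers every measurable [f], also at points where the integral is
    infinite. *)
Lemma measurable_paramint d1 d2 (T1 : measurableType d1) (T2 : measurableType d2)
    (m2 : {sigma_finite_measure set T2 -> \bar R}) (f : T1 * T2 -> R) :
  measurable_fun setT f -> measurable_fun setT (fun x => \int[m2]_y f (x, y)).
Proof.
move=> mf; have mF : measurable_fun setT (EFin \o f) by exact/measurable_EFinP.
apply: (measurableT_comp (fine_measurable measurableT)).
rewrite (_ : (fun _ => _) = (fun x => fubini_F m2 (EFin \o f)^\+%E x -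
    fubini_F m2 (EFin \o f)^\-%E x)%E).
  apply: emeasurable_funB.
  - by apply: measurable_fun_fubini_tonelli_F => //; exact: measurable_funepos.
  - by apply: measurable_fun_fubini_tonelli_F => //; exact: measurable_funeneg.
apply/funext => x; rewrite [LHS]integralE.
by congr (_ - _)%E; apply: eq_integral => y _; rewrite !(funeposE, funenegE).
Qed.

Lemma cmeas_cint d1 (T1 : measurableType d1) (F : T1 * R3 R -> R[i]) :
  cmeasurable setT F -> cmeasurable setT (fun x => cint setT (fun y => F (x, y))).
Proof.
move=> [F1 F2]; split => /=.
- exact: (@measurable_paramint _ _ _ _ (@leb3 R) _ F1).
- exact: (@measurable_paramint _ _ _ _ (@leb3 R) _ F2).
Qed.

Lemma integrable_prod d1 d2 (T1 : measurableType d1) (T2 : measurableType d2)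
    (m1 : {sigma_finite_measure set T1 -> \bar R})
    (m2 : {sigma_finite_measure set T2 -> \bar R}) (h : T1 -> R) (k : T2 -> R) :
  m1.-integrable setT (EFin \o h) -> m2.-integrable setT (EFin \o k) ->
  (m1 \x m2)%E.-integrable setT (EFin \o (fun p => h p.1 * k p.2)).
Proof.
move=> ih ik.
have mh : measurable_fun setT h by apply/measurable_EFinP; exact: measurable_int ih.
have mk : measurable_fun setT k by apply/measurable_EFinP; exact: measurable_int ik.
apply/integrable12ltyP.
  apply/measurable_EFinP; apply: measurable_funM.
    exact: (measurableT_comp mh measurable_fst).
  exact: (measurableT_comp mk measurable_snd).
have /integrableP[_ hoo] := ih; have /integrableP[_ koo] := ik.
have kfin : (\int[m2]_y `|(EFin \o k) y|)%E \is a fin_num.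
  by rewrite ge0_fin_numE// integral_ge0.
under eq_integral => x _.
  under eq_integral => y _ do rewrite /= normrM EFinM.
  rewrite ge0_integralZl_EFin//=; last first.
    by apply/measurable_EFinP; exact: measurableT_comp.
  over.
rewrite ge0_integralZr//=.
- by rewrite muleC lte_mul_pinfty//; apply: integral_ge0.
- by apply/measurable_EFinP; exact: measurableT_comp.
- exact: integral_ge0.
Qed.

End parametric_integrals.

Section fubini.
Context {R : realType}.
Local Notation mu := (@leb3 R).
Local Notation rint h := (mu.-integrable setT (EFin \o h)).
Local Notation L1 := (@Lpow R 1).
Variables (a b : R3 R -> R).
Hypotheses (ia : rint a) (ib : rint b).

Let Rfubini (f : R3 R * R3 R -> R) : measurable_fun setT f ->
  (forall x y, `|f (x, y)| <= a x * b y) ->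
  \int[mu]_x (\int[mu]_y f (x, y)) = \int[mu]_y (\int[mu]_x f (x, y)).
Proof.
move=> mf fab.
have fi : (mu \x mu)%E.-integrable setT (EFin \o f).
  apply: (le_integrable measurableT) (integrable_prod ia ib).
    exact/measurable_EFinP.
  by move=> [x y] _ /=; rewrite lee_fin (le_trans (fab x y))// ler_norm.
have fx x : rint (fun y => f (x, y)).
  apply: (rint_le _ (rintZ (a x) ib)) => //.
  exact: (measurableT_comp mf (measurable_pair1 x)).
have fy y : rint (fun x => f (x, y)).
  have i := rintZ (b y) ia.
  apply: (rint_le _ i) => //.
    exact: (measurableT_comp mf (measurable_pair2 y)).
  by move=> x; rewrite mulrC.
rewrite /Rintegral; congr fine.
under eq_integral => x _ do rewrite fineK ?(integrable_fin_num measurableT (fx x))//.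
under [RHS]eq_integral => y _ do rewrite fineK ?(integrable_fin_num measurableT (fy y))//.
exact: (Fubini fi).
Qed.

Lemma cint_fubini (F : R3 R * R3 R -> R[i]) : cmeasurable setT F ->
  (forall x y, Normc.normc (F (x, y)) <= a x * b y) ->
  cint setT (fun x => cint setT (fun y => F (x, y))) =
  cint setT (fun y => cint setT (fun x => F (x, y))).
Proof.
move=> [F1 F2] Fab; apply: cplx_eq => /=.
- apply: (@Rfubini (fun p => complex.Re (F p))) => // x y.
  by apply: le_trans (Fab x y); exact: normc_Re.
- apply: (@Rfubini (fun p => complex.Im (F p))) => // x y.
  by apply: le_trans (Fab x y); exact: normc_Im.
Qed.

Lemma L1_cint (F : R3 R * R3 R -> R[i]) : cmeasurable setT F ->
  (forall x y, Normc.normc (F (x, y)) <= a x * b y) ->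
  L1 (fun x => cint setT (fun y => F (x, y))).
Proof.
move=> mF Fab; have i := rintZ (2 * \int[mu]_x b x) ia.
apply: (L1_le _ i); first exact: cmeas_cint.
move=> x; have i2 := rintZ (a x) ib.
apply: le_trans (normc_cint _ i2 _) _ => //.
  exact: (cmeas_comp mF (measurable_pair1 x)).
by rewrite RintegralZl// mulrA [leLHS]mulrAC.
Qed.

End fubini.

(** * Rotation invariance of integrals and null sets *)

Section rotation_of_integrals.
Context {R : realType}.
Local Notation mu := (@leb3 R).
Variable B : 'M[R[i]]_2.
Hypothesis SB : SU2 B.
Let mB := (mpres_su2_rot SB).1.

Let ge0_rot (h : R3 R -> \bar R) : measurable_fun setT h -> (forall x, 0 <= h x)%E ->
  (\int[mu]_x h (su2_rot B x) = \int[mu]_x h x)%E.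
Proof.
move=> mh h0.
have := @ge0_integral_pushforward _ _ _ _ R (su2_rot B) mB mu setT h measurableT mh (fun x _ => h0 x).
rewrite preimage_setT => <-.
apply: (@eq_measure_integral _ _ _ setT mu (pushforward mu (su2_rot B))) => A mA _.
exact: ((mpres_su2_rot SB).2 A mA).
Qed.

Lemma Rintegral_rot (h : R3 R -> R) : measurable_fun setT h ->
  \int[mu]_x h (su2_rot B x) = \int[mu]_x h x.
Proof.
move=> mh; have mH : measurable_fun setT (EFin \o h) by exact/measurable_EFinP.
rewrite /Rintegral; congr fine.
rewrite integralE [RHS]integralE; congr (_ - _)%E.
- rewrite -(ge0_rot (measurable_funepos mH))//.
  by apply: eq_integral => y _; rewrite !funeposE.
- rewrite -(ge0_rot (measurable_funeneg mH))//.
  by apply: eq_integral => y _; rewrite !funenegE.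
Qed.

Lemma cint_rot (f : wave R) : cmeasurable setT f ->
  cint setT (fun x => f (su2_rot B x)) = cint setT f.
Proof.
move=> [f1 f2]; apply: cplx_eq => /=.
- exact: (@Rintegral_rot (fun x => complex.Re (f x))).
- exact: (@Rintegral_rot (fun x => complex.Im (f x))).
Qed.

Lemma cmeas_rot (f : wave R) : cmeasurable setT f ->
  cmeasurable setT (fun x => f (su2_rot B x)).
Proof. by move=> mf; exact: (cmeas_comp mf mB). Qed.

Lemma ae_rot (P : R3 R -> Prop) : (\forall p \ae mu, P p) ->
  \forall p \ae mu, P (su2_rot B p).
Proof.
move=> [N [mN N0 PN]]; exists (su2_rot B @^-1` N); split.
- by rewrite -[X in measurable X]setTI; exact: mB.
- by rewrite (mpres_su2_rot SB).2.
- by move=> p /= Pp; exact: PN.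
Qed.

End rotation_of_integrals.

(** * Square integrable functions *)

Section L2_space.
Context {R : realType}.
Implicit Types f g : wave R.
Local Notation mu := (@leb3 R).
Local Notation rint h := (mu.-integrable setT (EFin \o h)).
Local Notation cmeas := (@cmeasurable R _ (R3 R) setT).
Local Notation L1 := (@Lpow R 1).

(** Equality almost everywhere of functions unfolds to a statement guarded by [setT x]; this removes
    the guard or restores it. *)
Lemma aeE (P : R3 R -> Prop) : (\forall x \ae mu, setT x -> P x) <-> \forall x \ae mu, P x.
Proof. by split; apply: filterS => x; [move=> /(_ I)|]. Qed.

Lemma L2P f : L2 f <-> cmeas f /\ rint (fun x => Normc.normc (f x) ^+ 2).
Proof.
split=> [[mf oo]|[mf /integrableP[_ oo]]]; split=> //.
  apply/integrableP; split.
    by apply/measurable_EFinP; apply: measurable_funX; exact: measurable_normc.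
  apply: le_lt_trans oo; under eq_integral do rewrite /= ger0_norm ?sqr_ge0//.
  by [].
apply: le_lt_trans oo; under [leRHS]eq_integral do rewrite /= ger0_norm ?sqr_ge0//.
by [].
Qed.

Lemma L2_meas f : L2 f -> cmeas f. Proof. by case. Qed.

Lemma L2_le f h : cmeas f -> rint h -> (forall x, Normc.normc (f x) ^+ 2 <= h x) -> L2 f.
Proof.
move=> mf ih fh; apply/L2P; split=> //; apply: (rint_le _ ih).
  by apply: measurable_funX; exact: measurable_normc.
by move=> x; rewrite ger0_norm ?sqr_ge0.
Qed.

Lemma L2_sqr f : L2 f -> rint (fun x => Normc.normc (f x) ^+ 2).
Proof. by move=> /L2P[]. Qed.

Lemma L2_mul f g : L2 f -> L2 g -> L1 (fun x => (f x)^*%C * g x).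
Proof.
move=> f2 g2; apply: (L1_le _ (rintD (L2_sqr f2) (L2_sqr g2))).
  by apply: cmeasM; [apply: cmeas_conj|]; exact: L2_meas.
move=> x; rewrite Normc.normcM normc_conj.
have := normc_ge0 (f x); have := normc_ge0 (g x).
set u := Normc.normc (f x); set v := Normc.normc (g x) => v0 u0.
have : 0 <= (u - v) ^+ 2 by apply: sqr_ge0.
have := mulr_ge0 u0 v0; nra.
Qed.

Lemma L2D f g : L2 f -> L2 g -> L2 (fun x => f x + g x).
Proof.
move=> f2 g2; apply: (L2_le _ (rintD (rintZ 2 (L2_sqr f2)) (rintZ 2 (L2_sqr g2)))).
  by apply: cmeasD; exact: L2_meas.
move=> x; apply: (@le_trans _ _ ((Normc.normc (f x) + Normc.normc (g x)) ^+ 2)).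
  by rewrite ler_sqr ?nnegrE ?addr_ge0 ?normc_ge0//; exact: le_normcD.
have : 0 <= (Normc.normc (f x) - Normc.normc (g x)) ^+ 2 by apply: sqr_ge0.
lra.
Qed.

Lemma L2_bmul (M : R) f g : L2 f -> cmeas g -> (forall x, Normc.normc (g x) <= M) ->
  L2 (fun x => g x * f x).
Proof.
move=> f2 mg gM; apply: (L2_le _ (rintZ (M ^+ 2) (L2_sqr f2))).
  by apply: cmeasM => //; exact: L2_meas.
move=> x; rewrite Normc.normcM exprMn ler_wpM2r ?sqr_ge0//.
by rewrite lerXn2r ?nnegrE ?normc_ge0// (le_trans (normc_ge0 (g x))).
Qed.

Lemma L2Z (c : R[i]) f : L2 f -> L2 (fun x => c * f x).
Proof.
by move=> f2; apply: (@L2_bmul (Normc.normc c)) => //; exact: cmeas_cst.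
Qed.

Lemma L2N f : L2 f -> L2 (fun x => - f x).
Proof. by move=> f2; under eq_fun do rewrite -mulN1r; exact: L2Z. Qed.

Lemma L2B f g : L2 f -> L2 g -> L2 (fun x => f x - g x).
Proof. by move=> f2 g2; apply: L2D => //; exact: L2N. Qed.

Lemma L2_0 : L2 (fun=> 0 : R[i]).
Proof.
apply/L2P; split; first exact: cmeas_cst.
apply: (rint_le _ (@integrable0 _ _ _ mu setT)) => //.
by move=> x; rewrite Normc.normc0 expr0n/= normr0.
Qed.

Lemma L2_sum n (F : 'I_n -> wave R) : (forall i, L2 (F i)) -> L2 (fun x => \sum_i F i x).
Proof.
elim: n F => [|n IH] F mF.
  by under eq_fun do rewrite big_ord0; exact: L2_0.
by under eq_fun do rewrite big_ord_recl; apply: L2D; [exact: mF|apply: IH].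
Qed.

Lemma ip_conj f g : L2 f -> L2 g -> ip g f = (ip f g)^*%C.
Proof.
move=> f2 g2; rewrite /ip -cint_conj; last exact: L2_mul.
by congr cint; apply/funext => x; rewrite rmorphM/= conjcK mulrC.
Qed.

Lemma ipDr f g h : L2 f -> L2 g -> L2 h -> ip f (fun x => g x + h x) = ip f g + ip f h.
Proof.
move=> f2 g2 h2; rewrite /ip -cintD; [|exact: L2_mul|exact: L2_mul].
by congr cint; apply/funext => x; rewrite mulrDr.
Qed.

Lemma ipZr (c : R[i]) f g : L2 f -> L2 g -> ip f (fun x => c * g x) = c * ip f g.
Proof.
move=> f2 g2; rewrite /ip -cintZ; last exact: L2_mul.
by congr cint; apply/funext => x; rewrite mulrCA.
Qed.

Lemma ip_sumr n f (F : 'I_n -> wave R) : L2 f -> (forall i, L2 (F i)) ->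
  ip f (fun x => \sum_i F i x) = \sum_i ip f (F i).
Proof.
move=> f2 F2; rewrite /ip -cint_sum; last by move=> i; exact: L2_mul.
by congr cint; apply/funext => x; rewrite mulr_sumr.
Qed.

Lemma ipDl f g h : L2 f -> L2 g -> L2 h -> ip (fun x => f x + g x) h = ip f h + ip g h.
Proof.
move=> f2 g2 h2; rewrite [LHS]ip_conj//; last exact: L2D.
by rewrite ipDr// rmorphD; congr (_ + _); symmetry; exact: ip_conj.
Qed.

Lemma ipZl (c : R[i]) f g : L2 f -> L2 g -> ip (fun x => c * f x) g = c^*%C * ip f g.
Proof.
move=> f2 g2; rewrite [LHS]ip_conj//; last exact: L2Z.
by rewrite ipZr// rmorphM; congr (_ * _); symmetry; exact: ip_conj.
Qed.

Lemma ipBr f g h : L2 f -> L2 g -> L2 h -> ip f (fun x => g x - h x) = ip f g - ip f h.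
Proof.
move=> f2 g2 h2; rewrite ipDr//; last exact: L2N.
by under [X in _ + ip _ X]eq_fun do rewrite -mulN1r; rewrite ipZr// mulN1r.
Qed.

Lemma ip_aer f g h : cmeas f -> cmeas g -> cmeas h -> g = h %[ae mu] -> ip f g = ip f h.
Proof.
move=> mf mg mh gh; apply: cint_ae.
- by apply: cmeasM => //; exact: cmeas_conj.
- by apply: cmeasM => //; exact: cmeas_conj.
- by apply: filterS gh => x /= H _; rewrite H.
Qed.

Lemma ip_ael f g h : cmeas f -> cmeas g -> cmeas h -> f = g %[ae mu] -> ip f h = ip g h.
Proof.
move=> mf mg mh fg; apply: cint_ae.
- by apply: cmeasM => //; exact: cmeas_conj.
- by apply: cmeasM => //; exact: cmeas_conj.
- by apply: filterS fg => x /= H _; rewrite H.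
Qed.

Lemma ip_self f : ip f f = (\int[mu]_x (Normc.normc (f x) ^+ 2))%:C.
Proof.
by rewrite -cint_real; congr cint; apply/funext => x; rewrite mulJc.
Qed.

Lemma ip0_ae f : L2 f -> ip f f = 0 -> f = (fun=> 0) %[ae mu].
Proof.
move=> f2; rewrite ip_self => /complexI E.
have := rint0_ae (L2_sqr f2) (fun x => sqr_ge0 _) E.
by apply: filterS => x /= H _; move: (H I) => /eqP; rewrite sqrf_eq0 normc_eq0 => /eqP.
Qed.

End L2_space.

Section conjc_morphism.
Context {R : realType}.
Implicit Types x y : R[i].

Lemma conjcM x y : (x * y)^*%C = x^*%C * y^*%C.
Proof. exact: rmorphM. Qed.

Lemma conjcD x y : (x + y)^*%C = x^*%C + y^*%C.
Proof. exact: rmorphD. Qed.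

Lemma conjc_sum n (F : 'I_n -> R[i]) : (\sum_i F i)^*%C = \sum_i (F i)^*%C.
Proof. exact: rmorph_sum. Qed.

Lemma realCM (a b : R) : (a * b)%:C = a%:C * b%:C :> R[i].
Proof. exact: rmorphM. Qed.

End conjc_morphism.

(** * Gaussian weights and test functions *)

Section gaussian.
Context {R : realType}.
Local Notation mu := (@leb3 R).
Local Notation rint h := (mu.-integrable setT (EFin \o h)).
Local Notation cmeas := (@cmeasurable R _ (R3 R) setT).
Local Notation L1 := (@Lpow R 1).
Implicit Types p q b : R3 R.

Definition nrm p : R := Num.sqrt (dot3 p p).
(** The square of [gauw]: one factor [gauw] gives integrability, the other absorbs a factor |p|, see
    [nrm_gau]. *)
Definition gau p : R := expR (- (2 * dot3 p p)).
Definition gauw p : R := expR (- dot3 p p).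

Lemma dot3_ge0 p : 0 <= dot3 p p.
Proof. by rewrite /dot3 -!expr2 !addr_ge0 ?sqr_ge0. Qed.

Lemma dot3C p q : dot3 p q = dot3 q p.
Proof. by rewrite /dot3; ring. Qed.

Lemma dot3Dl p q x : dot3 (p + q) x = dot3 p x + dot3 q x.
Proof. by case: p => [[? ?] ?]; case: q => [[? ?] ?]; rewrite /dot3 /=; ring. Qed.

Lemma dot3Nl p x : dot3 (- p) x = - dot3 p x.
Proof. by case: p => [[? ?] ?]; rewrite /dot3 /=; ring. Qed.

Lemma dot3Bl p q x : dot3 (p - q) x = dot3 p x - dot3 q x.
Proof. by rewrite dot3Dl dot3Nl. Qed.

Lemma dot30l x : dot3 (0 : R3 R) x = 0.
Proof. by rewrite /dot3 /= !mul0r !addr0. Qed.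

Lemma nrm_ge0 p : 0 <= nrm p. Proof. exact: sqrtr_ge0. Qed.

Lemma nrm_sqr p : nrm p ^+ 2 = dot3 p p.
Proof. by rewrite sqr_sqrtr ?dot3_ge0. Qed.

Lemma dot3_CS p q : `|dot3 p q| <= nrm p * nrm q.
Proof.
rewrite -ler_sqr ?nnegrE ?mulr_ge0 ?nrm_ge0// real_normK ?num_real//.
rewrite exprMn !nrm_sqr; case: p => [[a b] c]; case: q => [[u v] w]; rewrite /dot3 /=.
rewrite -subr_ge0.
rewrite (_ : _ - _ = (a * v - b * u) ^+ 2 + (a * w - c * u) ^+ 2 + (b * w - c * v) ^+ 2).
  by rewrite !addr_ge0 ?sqr_ge0.
by ring.
Qed.

Lemma nrm_rot B p : SU2 B -> nrm (su2_rot B p) = nrm p.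
Proof. by move=> SB; rewrite /nrm su2_rot_dot. Qed.

Lemma gau_rot B p : SU2 B -> gau (su2_rot B p) = gau p.
Proof. by move=> SB; rewrite /gau su2_rot_dot. Qed.

Lemma gau_gt0 p : 0 < gau p. Proof. exact: expR_gt0. Qed.
Lemma gau_ge0 p : 0 <= gau p. Proof. exact: expR_ge0. Qed.
Lemma gauw_ge0 p : 0 <= gauw p. Proof. exact: expR_ge0. Qed.

Lemma gau_le1 p : gau p <= 1.
Proof. by rewrite -expR0 ler_expR oppr_le0 mulr_ge0// dot3_ge0. Qed.

Lemma gau_gauw p : gau p = expR (- dot3 p p) * gauw p.
Proof. by rewrite /gau /gauw -expRD; congr expR; ring. Qed.

Lemma gau_le p : gau p <= gauw p.
Proof.
rewrite gau_gauw ler_piMl ?gauw_ge0// -expR0 ler_expR oppr_le0; exact: dot3_ge0.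
Qed.

Lemma nrm_gau p : nrm p * gau p <= gauw p.
Proof.
rewrite gau_gauw mulrA ler_piMl ?gauw_ge0// expRN ler_pdivrMr ?expR_gt0// mul1r.
apply: le_trans (expR_ge1Dx _); rewrite -nrm_sqr.
by have := sqr_ge0 (nrm p - 1); have := nrm_ge0 p; nra.
Qed.

Lemma measurable_dot3 d (T : measurableType d) (f g : T -> R3 R) :
  measurable_fun setT f -> measurable_fun setT g ->
  measurable_fun setT (fun x => dot3 (f x) (g x)).
Proof.
move=> mf mg; apply: measurable_funD; [apply: measurable_funD|]; apply: measurable_funM.
- exact: (measurableT_comp measurable_coord1 mf).
- exact: (measurableT_comp measurable_coord1 mg).
- exact: (measurableT_comp measurable_coord2 mf).
- exact: (measurableT_comp measurable_coord2 mg).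
- exact: (measurableT_comp measurable_coord3 mf).
- exact: (measurableT_comp measurable_coord3 mg).
Qed.

Lemma measurable_gau : measurable_fun setT gau.
Proof.
apply: (measurableT_comp (@measurable_expR R)); apply: measurable_funN.
by apply: measurable_funM => //; apply: measurable_dot3; exact: measurable_id.
Qed.

Lemma rint_gauw : rint gauw.
Proof.
have i1 := @integrableT_gauss R.
have i2 := integrable_prod (m1 := lebesgue_measure) (m2 := lebesgue_measure) i1 i1.
have i3 := integrable_prod (m1 := @leb2 R) (m2 := lebesgue_measure) i2 i1.
move: i3; apply: eq_integrable => //= -[[x y] z] _ /=; congr EFin.
rewrite /gauw /gauss_fun -!expRD /dot3 /=; congr expR; ring.
Qed.

Lemma rint_gau : rint gau.
Proof.
apply: (rint_le measurable_gau rint_gauw) => p.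
by rewrite ger0_norm ?gau_ge0// gau_le.
Qed.

(** The test functions. They lie in L^1 and L^2, so the integral formulas for the kernel and for the
    Fourier transformation apply to them; they form a linear space, and they separate the points of
    L^2. *)
Definition dominated (f : wave R) :=
  cmeas f /\ exists2 C : R, 0 <= C & forall p, Normc.normc (f p) <= C * gau p.

Lemma dom_L1 f : dominated f -> L1 f.
Proof.
by move=> [mf [C C0 fC]]; have i := rintZ C rint_gau; apply: (L1_le mf i).
Qed.

Lemma dom_L2 f : dominated f -> L2 f.
Proof.
move=> [mf [C C0 fC]]; have i := rintZ (C ^+ 2) rint_gau; apply: (L2_le mf i) => p.
apply: (@le_trans _ _ ((C * gau p) ^+ 2)).
  by rewrite ler_sqr ?nnegrE ?normc_ge0// mulr_ge0// gau_ge0.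
by rewrite exprMn ler_wpM2l ?sqr_ge0// expr2 ler_piMl ?gau_ge0// gau_le1.
Qed.

Lemma dom_gau : dominated (fun p => (gau p)%:C).
Proof.
split; first by apply: cmeas_real; exact: measurable_gau.
by exists 1 => // p; rewrite normc_real ger0_norm ?gau_ge0// mul1r.
Qed.

Lemma domD f g : dominated f -> dominated g -> dominated (fun p => f p + g p).
Proof.
move=> [mf [C C0 fC]] [mg [D D0 gD]]; split; first exact: cmeasD.
exists (C + D); first exact: addr_ge0.
by move=> p; rewrite mulrDl (le_trans (le_normcD _ _))// lerD.
Qed.

Lemma dom_bmul (M : R) f g : dominated f -> cmeas g ->
  (forall p, Normc.normc (g p) <= M) -> dominated (fun p => g p * f p).
Proof.
move=> [mf [C C0 fC]] mg gM; have M0 : 0 <= M by apply: le_trans (normc_ge0 _) (gM 0).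
split; first exact: cmeasM.
exists (M * C); first exact: mulr_ge0.
by move=> p; rewrite Normc.normcM -mulrA ler_pM ?normc_ge0.
Qed.

Lemma domZ (c : R[i]) f : dominated f -> dominated (fun p => c * f p).
Proof.
by move=> df; apply: (@dom_bmul (Normc.normc c)) => //; exact: cmeas_cst.
Qed.

Lemma dom_conj f : dominated f -> dominated (fun p => (f p)^*%C).
Proof.
move=> [mf [C C0 fC]]; split; first exact: cmeas_conj.
by exists C => // p; rewrite normc_conj.
Qed.

Lemma dom_gaum (M : R) f : cmeas f -> (forall p, Normc.normc (f p) <= M) ->
  dominated (fun p => f p * (gau p)%:C).
Proof. by move=> mf fM; apply: (dom_bmul dom_gau mf fM). Qed.

(* Testing against [eta = gau * h / (1 + |h|)]. *)
Lemma test_ae0 (h : wave R) : cmeas h -> L1 (fun p => (gau p)%:C * h p) ->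
  (forall eta, dominated eta -> cint setT (fun p => (eta p)^*%C * h p) = 0) ->
  h = (fun=> 0) %[ae mu].
Proof.
move=> mh ih H.
pose n p := Normc.normc (h p).
have n0 p : 0 <= n p by apply: normc_ge0.
have np p : 0 < 1 + n p by rewrite ltr_pwDl.
have mn : measurable_fun setT n by exact: measurable_normc.
have mi : measurable_fun setT (fun p => (1 + n p)^-1).
  by apply: measurable_inv => [|p]; [exact: measurable_funD|exact/ltW].
pose eta p := ((1 + n p)^-1)%:C * h p * (gau p)%:C.
have deta : dominated eta.
  apply: (@dom_gaum 1); first by apply: cmeasM => //; exact: cmeas_real.
  move=> p; rewrite Normc.normcM normc_real ger0_norm ?invr_ge0 ?(ltW (np _))//.
  by rewrite mulrC ler_pdivrMr// mul1r lerDr.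
have E p : (eta p)^*%C * h p = (gau p * n p ^+ 2 / (1 + n p))%:C.
  rewrite /eta !conjcM !conjc_real.
  transitivity (((1 + n p)^-1)%:C * (gau p)%:C * ((h p)^*%C * h p)); first by ring.
  by rewrite mulJc -/(n p) -!realCM; congr _%:C; ring.
have := H _ deta; under eq_fun do rewrite E.
rewrite cint_real => /complexI E0.
have q0 p : 0 <= gau p * n p ^+ 2 / (1 + n p).
  by rewrite divr_ge0 ?mulr_ge0 ?gau_ge0 ?sqr_ge0 ?(ltW (np _)).
have i : rint (fun p => gau p * n p ^+ 2 / (1 + n p)).
  apply: (rint_le _ (L1_normc ih)).
    apply: measurable_funM => //; apply: measurable_funM; first exact: measurable_gau.
    exact: measurable_funX.
  move=> p; rewrite Normc.normcM normc_real -/(n p) ger0_norm ?q0// ger0_norm ?gau_ge0//.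
  rewrite -mulrA ler_wpM2l ?gau_ge0// ler_pdivrMr// mulrDr mulr1 -expr2.
  by rewrite lerDr.
have /aeE[] := rint0_ae i q0 E0.
move=> N [mN N0 sN]; exists N; split => // p /= hp; apply: sN => /= E1; apply: hp => _.
move/eqP: E1; rewrite !mulf_eq0 invr_eq0 (gt_eqF (np p)) orbF gt_eqF ?gau_gt0//= orbb.
by rewrite normc_eq0 => /eqP.
Qed.

Lemma L1_gau_L2 (f : wave R) : L2 f -> L1 (fun p => (gau p)%:C * f p).
Proof.
move=> f2; have := L2_mul (dom_L2 dom_gau) f2.
by under eq_fun do rewrite conjc_real.
Qed.

Lemma test_L2_ae0 (h : wave R) : L2 h ->
  (forall eta, dominated eta -> ip eta h = 0) -> h = (fun=> 0) %[ae mu].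
Proof. by move=> h2 H; apply: test_ae0 => //; [exact: L2_meas|exact: L1_gau_L2]. Qed.

Lemma test_L2_ae (f g : wave R) : L2 f -> L2 g ->
  (forall eta, dominated eta -> ip eta f = ip eta g) -> f = g %[ae mu].
Proof.
move=> f2 g2 H; have := @test_L2_ae0 (fun p => f p - g p) (L2B f2 g2).
have H' eta : dominated eta -> ip eta (fun p => f p - g p) = 0.
  by move=> de; rewrite ipBr ?H ?subrr//; exact: dom_L2.
by move=> /(_ H'); apply: filterS => p /= /(_ I) /eqP; rewrite subr_eq0 => /eqP.
Qed.

End gaussian.

(** * Polarization of sesquilinear forms *)

Section polarization.
Context {R : realType} (V : Type) (S : set V) (add : V -> V -> V) (scale : R[i] -> V -> V)
  (form : V -> V -> R[i]).
Hypotheses (S_add : forall u v, S u -> S v -> S (add u v))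
  (S_scale : forall c u, S u -> S (scale c u))
  (form_Dl : forall u v w, S u -> S v -> S w -> form (add u v) w = form u w + form v w)
  (form_Dr : forall u v w, S u -> S v -> S w -> form u (add v w) = form u v + form u w)
  (form_Zl : forall c u v, S u -> S v -> form (scale c u) v = c^*%C * form u v)
  (form_Zr : forall c u v, S u -> S v -> form u (scale c v) = c * form u v).

Let form_expand c u v : S u -> S v ->
  form (add u (scale c v)) (add u (scale c v)) =
  form u u + c * form u v + c^*%C * form v u + c * c^*%C * form v v.
Proof.
move=> Su Sv; have Scv := S_scale c Sv.
by rewrite form_Dl ?form_Dr ?form_Zl ?form_Zr//; [ring|exact: S_add].
Qed.

(** Expanding at u + v gives form v u = - form u v, at u + i v it gives form v u = form u v. The
    domain [S] and the operations are parameters because the forms in question are sesquilinear only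
    on L^2 or on dominated functions. *)
Lemma polar0 : (forall u, S u -> form u u = 0) -> forall u v, S u -> S v -> form u v = 0.
Proof.
move=> H u v Su Sv.
have E c := form_expand c Su Sv.
have := E 1; rewrite !H ?S_add ?S_scale//; try exact/S_add/S_scale.
rewrite rmorph1 !mul1r add0r addr0 => E1.
have := E 'i%C; rewrite !H; try exact/S_add/S_scale; rewrite ?mulr0 ?addr0 ?add0r//.
move=> E2.
have vu : form v u = - form u v by apply/eqP; rewrite -addr_eq0 addrC -E1.
have i0 : 'i%C != 0 :> R[i] by rewrite eq_complex /= oner_eq0 andbF.
have ci : 'i%C^*%C = - 'i%C :> R[i] by apply/eqP; rewrite eq_complex /= !oppr0 !eqxx.
move: E2; rewrite vu ci mulrNN -mulrDr => /esym/eqP.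
rewrite mulf_eq0 (negbTE i0)/= -mulr2n mulrn_eq0/= => /eqP//.
Qed.

(** The diagonal values are real; the imaginary parts of the expansions at u + v and u + i v give
    the imaginary and the real part of the claim. *)
Lemma polar_herm : (forall u, S u -> 0 <= form u u) ->
  forall u v, S u -> S v -> form v u = (form u v)^*%C.
Proof.
move=> H u v Su Sv.
have Im0 w : S w -> complex.Im (form w w) = 0.
  by move=> Sw; move: (H w Sw); rewrite lecE /= => /andP[/eqP].
have E c := congr1 (@complex.Im R) (form_expand c Su Sv).
have := E 1; have := E 'i%C.
have S1 c : S (add u (scale c v)) by apply: S_add => //; exact: S_scale.
rewrite !cImD (Im0 _ (S1 _)) (Im0 _ (S1 _)) (Im0 _ Su).
rewrite !cImM !(Im0 v)//=.
case: (form u v) => a b; case: (form v u) => c d /=.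
move=> E1 E2; apply: cplx_eq => /=; lra.
Qed.

End polarization.

Lemma ipE (R : realType) (f g : wave R) :
  ip f g = cint setT (fun p => (f p)^*%C * g p).
Proof. by []. Qed.

(** * Fourier transformation *)

Section fourier.
Context {R : realType} (F F' : wave R -> wave R).
Hypothesis hF : is_fourier F F'.
Local Notation mu := (@leb3 R).
Local Notation cmeas := (@cmeasurable R _ (R3 R) setT).
Local Notation L1 := (@Lpow R 1).
Implicit Types f g : wave R.
Local Notation cF := ((2 * pi) `^ (- (3 / 2)) : R).

Lemma cF_sqr : cF ^+ 2 = (2 * pi) ^- 3.
Proof.
have p0 : 0 <= 2 * pi :> R by rewrite mulr_ge0// pi_ge0.
rewrite -powR_mulrn ?powR_ge0// -powRrM (_ : - (3 / 2) * 2%:R = - 3%:R :> R); last by field.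
by rewrite powRN powR_mulrn.
Qed.

Lemma cF_gt0 : 0 < cF.
Proof. by rewrite powR_gt0// mulr_gt0// pi_gt0. Qed.

Lemma F_L2 f : L2 f -> L2 (F f).
Proof. by move=> f2; exact: (bop_L2 (fourier_bop hF)). Qed.

Lemma F'_L2 f : L2 f -> L2 (F' f).
Proof. by case: (fourier_inv hF) => H _ _; exact: H. Qed.

Lemma FK' f : L2 f -> F (F' f) = f %[ae mu].
Proof. by case: (fourier_inv hF) => _ H _; exact: H. Qed.

Lemma FB f g : L2 f -> L2 g -> F (fun p => f p - g p) = (fun p => F f p - F g p) %[ae mu].
Proof.
move=> f2 g2; have H := bop_lin (fourier_bop hF) (-1) g2 f2.
have -> : (fun p => f p - g p) = (fun p => -1 * g p + f p).
  by apply/funext => p; rewrite mulN1r addrC.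
by apply: filterS H => p /= H _; rewrite H// mulN1r addrC.
Qed.

Lemma F_inj f g : L2 f -> L2 g -> F f = F g %[ae mu] -> f = g %[ae mu].
Proof.
move=> f2 g2 fg; have d2 := L2B f2 g2.
have Z : F (fun p => f p - g p) = (fun=> 0) %[ae mu].
  by apply: filterS2 (FB f2 g2) fg => p /= H1 H2 _; rewrite H1// H2// subrr.
have : ip (fun p => f p - g p) (fun p => f p - g p) = 0.
  rewrite -(fourier_isom hF)// (ip_aer _ _ _ Z); try exact/L2_meas/F_L2.
    by rewrite /ip; under eq_fun do rewrite mulr0; rewrite cint0.
  exact: cmeas_cst.
move=> /(ip0_ae d2); apply: filterS => p /= /(_ I)/eqP.
by rewrite subr_eq0 => /eqP.
Qed.

(** The operator F' is given merely as an inverse on L^2. Its compatibility with null sets and its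
    linearity are inherited from F through [F_inj]. *)
Lemma F'_ae f g : L2 f -> L2 g -> f = g %[ae mu] -> F' f = F' g %[ae mu].
Proof.
move=> f2 g2 fg; apply: F_inj; try exact: F'_L2.
by apply: filterS3 (FK' f2) (FK' g2) fg => p /= H1 H2 H3 _; rewrite H1// H2// H3.
Qed.

Lemma F_ae f g : L2 f -> L2 g -> f = g %[ae mu] -> F f = F g %[ae mu].
Proof. exact: (bop_ae (fourier_bop hF)). Qed.

Lemma F'_lin (c : R[i]) f g : L2 f -> L2 g ->
  F' (fun p => c * f p + g p) = (fun p => c * F' f p + F' g p) %[ae mu].
Proof.
move=> f2 g2; have cf2 := L2D (L2Z c f2) g2.
have f'2 := F'_L2 f2; have g'2 := F'_L2 g2.
have c'2 := L2D (L2Z c f'2) g'2.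
apply: F_inj => //; first exact: F'_L2.
have H := bop_lin (fourier_bop hF) c f'2 g'2.
apply: filterS3 (FK' cf2) (filterI (FK' f2) (FK' g2)) H => p /= H1 [H2 H3] H4 _.
by rewrite H1// H4// H2// H3.
Qed.

Lemma measurable_phase (b : R3 R) : measurable_fun setT (fun p : R3 R => dot3 b p).
Proof. by apply: measurable_dot3 => //; exact: measurable_cst. Qed.

Definition invft f (x : R3 R) : R[i] := cint setT (fun p => expi (dot3 x p) * f p).

Lemma cmeas_phase_mul f (s : R) : cmeas f ->
  cmeasurable setT (fun q : R3 R * R3 R => expi (s * dot3 q.1 q.2) * f q.2).
Proof.
move=> mf; apply: cmeasM.
  apply: cmeas_expi; apply: measurable_funM => //.
  by apply: measurable_dot3; [exact: measurable_fst|exact: measurable_snd].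
exact: (cmeas_comp mf measurable_snd).
Qed.

Lemma cmeas_invft f : cmeas f -> cmeas (invft f).
Proof.
move=> mf; apply: (cmeas_cint (F := fun q => expi (dot3 q.1 q.2) * f q.2)).
have := cmeas_phase_mul 1 mf.
by under eq_fun do rewrite mul1r.
Qed.

Lemma invft_bounded f : L1 f -> exists M : R, forall x, Normc.normc (invft f x) <= M.
Proof.
move=> f1; exists (2 * \int[mu]_x (Normc.normc (f x))) => x.
apply: normc_cint; [|exact: L1_normc|].
  by apply: cmeasM; [apply: cmeas_expi; exact: measurable_phase|exact: L1_meas].
by move=> p; rewrite Normc.normcM normc_expi mul1r.
Qed.

Definition ft f (x : R3 R) : R[i] := cint setT (fun p => expi (- dot3 x p) * f p).

Lemma cmeas_ft f : cmeas f -> cmeas (ft f).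
Proof.
move=> mf; apply: (cmeas_cint (F := fun q => expi (- dot3 q.1 q.2) * f q.2)).
have := cmeas_phase_mul (-1) mf.
by under eq_fun do rewrite mulN1r.
Qed.

Lemma L1_phase (h : R3 R -> R) f : measurable_fun setT h -> L1 f ->
  L1 (fun p => expi (h p) * f p).
Proof.
move=> mh f1; apply: (@L1_bmul _ 1) => //; first exact: cmeas_expi.
by move=> p; rewrite normc_expi.
Qed.

Lemma ft_conj f x : L1 f -> (ft f x)^*%C = invft (fun p => (f p)^*%C) x.
Proof.
move=> f1; rewrite /ft -cint_conj; last first.
  by apply: L1_phase => //; apply: measurable_funN; exact: measurable_phase.
by congr cint; apply/funext => p; rewrite conjcM expiN conjcK.
Qed.

Lemma L1_invft_mul u v : L1 u -> L1 v -> L1 (fun x => invft u x * v x).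
Proof.
move=> u1 v1; have [M iM] := invft_bounded u1.
by apply: (@L1_bmul _ M) => //; exact/cmeas_invft/L1_meas.
Qed.

(** The multiplication formula: Fubini and the symmetry of exp(i x.y) in x and y. *)
Lemma invft_dual u v : L1 u -> L1 v ->
  cint setT (fun x => invft u x * v x) = cint setT (fun x => u x * invft v x).
Proof.
move=> u1 v1; pose G (q : R3 R * R3 R) := expi (1 * dot3 q.1 q.2) * u q.2 * v q.1.
transitivity (cint setT (fun x => cint setT (fun y => G (x, y)))).
  congr cint; apply/funext => x; rewrite /invft -cintZr; last first.
    by apply: L1_phase => //; exact: measurable_phase.
  by congr cint; apply/funext => y; rewrite /G /= mul1r.
rewrite (cint_fubini (L1_normc v1) (L1_normc u1)).
- congr cint; apply/funext => y; rewrite /invft -cintZ; last first.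
    by apply: L1_phase => //; exact: measurable_phase.
  by congr cint; apply/funext => x; rewrite /G /= mul1r dot3C; ring.
- apply: cmeasM; first exact/cmeas_phase_mul/L1_meas.
  exact: (cmeas_comp (L1_meas v1) measurable_fst).
- by move=> x y; rewrite /G /= !Normc.normcM normc_expi mul1r mulrC.
Qed.

(** Only F is assumed to be given by an integral. For a test function eta one has <eta, F' f> = <F
    eta, f>; here F eta is an integral, and [invft_dual] moves the exponential from eta to f. *)
Lemma F'_ker f : L1 f -> L2 f -> F' f = (fun x => cF%:C * invft f x) %[ae mu].
Proof.
move=> f1 f2; have mf := L1_meas f1.
have mi : cmeas (fun x => cF%:C * invft f x).
  by apply: cmeasM; [exact: cmeas_cst|exact: cmeas_invft].
have [M iM] := invft_bounded f1.
have f'2 := F'_L2 f2.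
have gi : L1 (fun p => (gau p)%:C * (cF%:C * invft f p)).
  have := @L1_bmul _ (cF * M) _ _ (dom_L1 (@dom_gau R)) mi.
  under eq_fun do rewrite mulrC; apply => p.
  by rewrite Normc.normcM normc_real ger0_norm ?(ltW cF_gt0)// ler_wpM2l// (ltW cF_gt0).
have := @test_ae0 _ (fun x => F' f x - cF%:C * invft f x).
have m1 : cmeas (fun x => F' f x - cF%:C * invft f x).
  by apply: cmeasB => //; exact: L2_meas.
move=> /(_ m1).
have i1 : L1 (fun p => (gau p)%:C * (F' f p - cF%:C * invft f p)).
  under eq_fun do rewrite mulrBr.
  by apply: L1B => //; exact: L1_gau_L2.
move=> /(_ i1).
have H eta : dominated eta ->
    cint setT (fun p => (eta p)^*%C * (F' f p - cF%:C * invft f p)) = 0.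
  move=> de; have [me [C C0 eC]] := de; have e2 := dom_L2 de; have e1 := dom_L1 de.
  under eq_fun do rewrite mulrBr.
  rewrite cintB; last 2 first.
  - exact: L2_mul.
  - have := @L1_bmul _ (cF * M) _ _ (L1_conj e1) mi.
    under eq_fun do rewrite mulrC; apply => p.
    by rewrite Normc.normcM normc_real ger0_norm ?(ltW cF_gt0)// ler_wpM2l// (ltW cF_gt0).
  apply/eqP; rewrite subr_eq0; apply/eqP.
  rewrite -[LHS]/(ip eta (F' f)) -(fourier_isom hF)//.
  rewrite (ip_aer _ _ _ (FK' f2)) ?(ip_ael _ _ _ (fourier_ker hF e1 e2))//.
  - transitivity (cint setT (fun p => cF%:C * (invft (fun q => (eta q)^*%C) p * f p))).
      rewrite ipE; congr cint; apply/funext => p.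
      by rewrite conjcM conjc_real -[cint _ _]/(ft eta p) ft_conj// mulrA.
    rewrite cintZ; last by apply: (@L1_invft_mul _ _ (L1_conj e1) f1).
    rewrite invft_dual//; last exact: L1_conj.
    rewrite -cintZ; last first.
      have := L1_invft_mul f1 (L1_conj e1).
      by congr Lpow; apply/funext => x; rewrite mulrC.
    by congr cint; apply/funext => x; rewrite mulrCA.
  - by apply: L2_meas; exact: F_L2.
  - by apply: cmeasM; [exact: cmeas_cst|exact: cmeas_ft].
  - by apply: L2_meas; exact: F_L2.
  - by apply: L2_meas; exact: F_L2.
move=> /(_ H); apply: filterS => p /= /(_ I)/eqP.
by rewrite subr_eq0 => /eqP.
Qed.

End fourier.

(** * Quadratic forms of kernels and of deformations *)

Section almost_everywhere.
Context {R : realType}.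
Local Notation mu := (@leb3 R).

Lemma ae_prod1 (P : R3 R * R3 R -> Prop) :
  (\forall q \ae (mu \x mu)%E, P q) -> \forall x \ae mu, \forall y \ae mu, P (x, y).
Proof.
move=> [N [mN N0 PN]].
have E : (\int[mu]_x mu (xsection N x) = 0)%E by exact: N0.
have m1 : measurable_fun setT (fun x => mu (xsection N x)).
  exact: (@measurable_fun_xsection _ _ _ _ _ mu N mN).
have /(ae_eq_integral_abs mu measurableT m1).1 : (\int[mu]_x `|mu (xsection N x)| = 0)%E.
  by rewrite -[RHS]E; apply: eq_integral => x _; rewrite gee0_abs.
apply: filterS => x /= /(_ I) Nx; exists (xsection N x); split=> //.
- exact: measurable_xsection.
- by move=> y /= Py; rewrite /xsection /= inE; exact: PN.
Qed.

Lemma ae_prod2 (P : R3 R * R3 R -> Prop) :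
  (\forall q \ae (mu \x mu)%E, P q) -> \forall y \ae mu, \forall x \ae mu, P (x, y).
Proof.
move=> [N [mN N0 PN]].
have E : (\int[mu]_y mu (ysection N y) = 0)%E.
  have E2 : (mu \x mu)%E N = (mu \x^ mu)%E N.
    by apply: product_measure_unique => // B C mB mC; rewrite /= product_measure2E.
  exact: etrans (esym E2) N0.
have m1 : measurable_fun setT (fun y => mu (ysection N y)).
  exact: (@measurable_fun_ysection _ _ _ _ _ mu N mN).
have /(ae_eq_integral_abs mu measurableT m1).1 : (\int[mu]_x `|mu (ysection N x)| = 0)%E.
  by rewrite -[RHS]E; apply: eq_integral => x _; rewrite gee0_abs.
apply: filterS => y /= /(_ I) Ny; exists (ysection N y); split=> //.
- exact: measurable_ysection.
- by move=> x /= Px; rewrite /ysection /= inE; exact: PN.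
Qed.

Lemma measurable_neq0 : measurable [set p : R3 R | p != 0].
Proof.
have -> : [set p : R3 R | p != 0] = (fun p => dot3 p p) @^-1` [set~ 0].
  apply/seteqP; split => p /=; first by move=> p0; apply/eqP; rewrite dot3_eq0.
  by move=> /eqP; rewrite dot3_eq0.
rewrite -[X in measurable X]setTI.
have : measurable_fun setT (fun p : R3 R => dot3 p p).
  by apply: measurable_dot3; exact: measurable_id.
by apply => //; exact: measurableC.
Qed.

Lemma leb2X (A B : set (measurableTypeR R)) : measurable A -> measurable B ->
  leb2 (A `*` B) = (lebesgue_measure A * lebesgue_measure B)%E.
Proof. exact: product_measure1E. Qed.

Lemma leb3X (A : set (R2 R)) (B : set (measurableTypeR R)) : measurable A -> measurable B ->
  leb3 (A `*` B) = (leb2 A * lebesgue_measure B)%E.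
Proof. exact: product_measure1E. Qed.

Lemma leb33X (A B : set (R3 R)) : measurable A -> measurable B ->
  (mu \x mu)%E (A `*` B) = (mu A * mu B)%E.
Proof. exact: product_measure1E. Qed.

Lemma ae_neq0 : \forall p \ae mu, (p : R3 R) != 0.
Proof.
exists (([set 0] `*` setT) `*` setT); split.
- by apply: measurableX => //; exact: measurableX.
- rewrite leb3X//; last exact: measurableX.
  by rewrite leb2X// lebesgue_measure_set1 mul0e mul0e.
- move=> [[x y] z] /= /negP; rewrite negbK => /eqP [-> _ _].
  by [].
Qed.

(** The function [f] is measurable too, since it differs from [g] at most at the origin. *)
Lemma cint_off0 (f g : wave R) : cmeasurable setT g -> (forall p : R3 R, p != 0 -> f p = g p) ->
  cint setT f = cint setT g.
Proof.
move=> mg fg; apply: cint_ae => //; last first.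
  by apply: filterS ae_neq0 => p p0 _; exact: fg.
have -> : f = (fun p => if p != 0 then g p else f 0).
  by apply/funext => p; case: ifPn => [/fg//|]; rewrite negbK => /eqP ->.
have mb : measurable_fun setT (fun p : R3 R => p != 0).
  by apply: (@measurable_fun_bool _ _ _ _ true); rewrite setTI; exact: measurable_neq0.
case: mg => g1 g2; split.
- under eq_fun do rewrite (fun_if (@complex.Re R)).
  by apply: measurable_fun_ifT => //; exact: measurable_cst.
- under eq_fun do rewrite (fun_if (@complex.Im R)).
  by apply: measurable_fun_ifT => //; exact: measurable_cst.
Qed.

End almost_everywhere.

(** * Position densities attached to kernels *)

Section kernel_form.
Context {R : realType}.
Local Notation mu := (@leb3 R).
Local Notation cmeas := (@cmeasurable R _ (R3 R) setT).
Local Notation L1 := (@Lpow R 1).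
Implicit Types (phi psi : wave R) (K : R3 R -> R3 R -> R[i]).

(** For the kernel K of T and phi = psi this is, up to (2 pi)^-3, the density at position x of the
    quadratic form of T. The second function serves polarization. *)
Definition kform K phi psi (x : R3 R) : R[i] :=
  cint setT (fun p => cint setT (fun k =>
    K k p * expi (dot3 (p - k) x) * (phi k)^*%C * psi p)).

Definition jmeas K := cmeasurable setT (fun kp : R3 R * R3 R => K kp.1 kp.2).

Lemma jmeas_comp K d (T : measurableType d) (f g : T -> R3 R) : jmeas K ->
  measurable_fun setT f -> measurable_fun setT g ->
  cmeasurable setT (fun x => K (f x) (g x)).
Proof.
move=> mK mf mg; have mfg : measurable_fun setT (fun x => (f x, g x)).
  exact: measurable_fun_pair.
exact: (cmeas_comp mK mfg).
Qed.

Lemma measurable_sub d (T : measurableType d) (f g : T -> R3 R) :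
  measurable_fun setT f -> measurable_fun setT g ->
  measurable_fun setT (fun x => f x - g x).
Proof.
move=> mf mg.
have -> : (fun x => f x - g x) = (fun x => ((f x).1.1 - (g x).1.1, (f x).1.2 - (g x).1.2, (f x).2 - (g x).2)).
  by apply/funext => x; case: (f x) => [[? ?] ?]; case: (g x) => [[? ?] ?].
apply: measurable_R3; apply: measurable_funB.
- exact: (measurableT_comp measurable_coord1 mf).
- exact: (measurableT_comp measurable_coord1 mg).
- exact: (measurableT_comp measurable_coord2 mf).
- exact: (measurableT_comp measurable_coord2 mg).
- exact: (measurableT_comp measurable_coord3 mf).
- exact: (measurableT_comp measurable_coord3 mg).
Qed.

Lemma kform_integrand_meas K phi psi d (T : measurableType d) (fx fp fk : T -> R3 R) :
  jmeas K -> cmeas phi -> cmeas psi -> measurable_fun setT fx ->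
  measurable_fun setT fp -> measurable_fun setT fk ->
  cmeasurable setT (fun s => K (fk s) (fp s) * expi (dot3 (fp s - fk s) (fx s)) *
     (phi (fk s))^*%C * psi (fp s)).
Proof.
move=> mK mphi mpsi mx mp mk; apply: cmeasM; [apply: cmeasM; [apply: cmeasM|]|].
- exact: jmeas_comp.
- apply: cmeas_expi; apply: measurable_dot3 => //; exact: measurable_sub.
- by apply: cmeas_conj; exact: (cmeas_comp mphi mk).
- exact: (cmeas_comp mpsi mp).
Qed.

Lemma cmeas_kform_inner K phi psi x : jmeas K -> cmeas phi -> cmeas psi ->
  cmeas (fun p => cint setT (fun k =>
    K k p * expi (dot3 (p - k) x) * (phi k)^*%C * psi p)).
Proof.
move=> mK mphi mpsi; apply: (cmeas_cint (F := fun q =>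
  K q.2 q.1 * expi (dot3 (q.1 - q.2) x) * (phi q.2)^*%C * psi q.1)).
by apply: kform_integrand_meas => //; exact: measurable_cst.
Qed.

Lemma cmeas_kform K phi psi : jmeas K -> cmeas phi -> cmeas psi -> cmeas (kform K phi psi).
Proof.
move=> mK mphi mpsi.
pose F2 (s : (R3 R * R3 R) * R3 R) :=
  K s.2 s.1.2 * expi (dot3 (s.1.2 - s.2) s.1.1) * (phi s.2)^*%C * psi s.1.2.
apply: (cmeas_cint (F := fun q => cint setT (fun k => F2 (q, k)))).
apply: (cmeas_cint (F := F2)); apply: kform_integrand_meas => //.
- exact: (measurableT_comp measurable_fst measurable_fst).
- exact: (measurableT_comp measurable_snd measurable_fst).
Qed.

Lemma kform_ae K K' phi psi x : jmeas K -> jmeas K' -> cmeas phi -> cmeas psi ->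
  (\forall kp \ae (mu \x mu)%E, K kp.1 kp.2 = K' kp.1 kp.2) ->
  kform K phi psi x = kform K' phi psi x.
Proof.
move=> mK mK' mphi mpsi /ae_prod2 E; apply: cint_ae; try exact: cmeas_kform_inner.
apply: filterS E => p Ep _; apply: cint_ae.
- by apply: kform_integrand_meas => //; exact: measurable_cst.
- by apply: kform_integrand_meas => //; exact: measurable_cst.
- by apply: filterS Ep => k /= -> _.
Qed.

Definition gramk n (w : 'I_n -> wave R) (k p : R3 R) : R[i] :=
  \sum_l (w l k)^*%C * w l p.

Lemma jmeas_gramk n (w : 'I_n -> wave R) : (forall l, cmeas (w l)) -> jmeas (gramk w).
Proof.
move=> mw; apply: cmeas_sum => l; apply: cmeasM.
  by apply: cmeas_conj; exact: (cmeas_comp (mw l) measurable_fst).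
exact: (cmeas_comp (mw l) measurable_snd).
Qed.

Definition bmeas (w : wave R) := cmeas w /\ exists M : R, forall p, Normc.normc (w p) <= M.

Lemma bmeas_L1 w f : bmeas w -> L1 f -> L1 (mulop w f).
Proof. by move=> [mw [M wM]] f1; exact: (L1_bmul f1 mw wM). Qed.

Lemma bmeas_L2 w f : bmeas w -> L2 f -> L2 (mulop w f).
Proof. by move=> [mw [M wM]] f2; exact: (L2_bmul f2 mw wM). Qed.

Lemma bmeas_conj w : bmeas w -> bmeas (fun p => (w p)^*%C).
Proof.
move=> [mw [M wM]]; split; first exact: cmeas_conj.
by exists M => p; rewrite normc_conj.
Qed.

(** For a kernel of finite rank the phase exp(i(p - k)x) splits, and each summand is a product of
    two Fourier integrals. *)
Lemma kform_gramk n (w : 'I_n -> wave R) phi psi x : (forall l, bmeas (w l)) ->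
  L1 phi -> L1 psi ->
  kform (gramk w) phi psi x =
  \sum_l (invft (mulop (w l) phi) x)^*%C * invft (mulop (w l) psi) x.
Proof.
move=> bw phi1 psi1.
have i1 l : L1 (fun p => expi (dot3 x p) * mulop (w l) psi p).
  by apply: L1_phase; [exact: measurable_phase|exact: bmeas_L1].
have i2 l : L1 (fun p => expi (dot3 x p) * mulop (w l) phi p).
  by apply: L1_phase; [exact: measurable_phase|exact: bmeas_L1].
rewrite /kform.
transitivity (cint setT (fun p => \sum_l (invft (mulop (w l) phi) x)^*%C *
    (expi (dot3 x p) * mulop (w l) psi p))).
  congr cint; apply/funext => p.
  transitivity (cint setT (fun k => \sum_l (expi (dot3 x p) * mulop (w l) psi p) *
      (expi (dot3 x k) * mulop (w l) phi k)^*%C)).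
    congr cint; apply/funext => k; rewrite /gramk !mulr_suml; apply: eq_bigr => l _.
    rewrite dot3Bl expiD expiN !conjcM /mulop (dot3C p x) (dot3C k x).
    by ring.
  rewrite cint_sum; last by move=> l; apply: L1Z; apply: L1_conj.
  apply: eq_bigr => l _; rewrite cintZ; last exact: L1_conj.
  by rewrite mulrC cint_conj.
rewrite cint_sum; last by move=> l; exact: L1Z.
by apply: eq_bigr => l _; rewrite cintZ.
Qed.

End kernel_form.

(** * Elementary properties of the kernel of a localization *)

Section kernel_of_POL.
Context {R : realType} (T : set (R3 R) -> wave R -> wave R) (t : R3 R -> R3 R -> R[i]).
Hypothesis ht : is_kernel T t.
Local Notation mu := (@leb3 R).
Local Notation L1 := (@Lpow R 1).

(* The values of a kernel at the origin are arbitrary, hence replaced by zero. *)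
Definition off0 (K : R3 R -> R3 R -> R[i]) (k p : R3 R) : R[i] :=
  if (k != 0) && (p != 0) then K k p else 0.

Lemma jmeas_off0 : jmeas (off0 t).
Proof.
have [t1 t2] := ker_meas ht.
set D := [set kp : R3 R * R3 R | kp.1 != 0 /\ kp.2 != 0] in t1 t2.
have mD : measurable D.
  have -> : D = [set p | p != 0] `*` [set p | p != 0] by apply/seteqP; split => -[? ?].
  by apply: measurableX; exact: measurable_neq0.
have inD (kp : R3 R * R3 R) : ((kp.1 != 0) && (kp.2 != 0)) = (kp \in D).
  by apply/andP/idP => [?|]; rewrite inE.
split.
- rewrite (_ : (fun _ => _) = (fun kp => complex.Re (t kp.1 kp.2)) \_ D).
    by move/(measurable_restrictT _ mD) : t1.
  by apply/funext => kp; rewrite /off0 patchE inD; case: ifP.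
- rewrite (_ : (fun _ => _) = (fun kp => complex.Im (t kp.1 kp.2)) \_ D).
    by move/(measurable_restrictT _ mD) : t2.
  by apply/funext => kp; rewrite /off0 patchE inD; case: ifP.
Qed.

Lemma off0_rot B k p : SU2 B -> off0 t (su2_rot B k) (su2_rot B p) = off0 t k p.
Proof.
move=> SB; rewrite /off0 !su2_rot_eq0//; case: ifP => // /andP[k0 p0].
by rewrite (ker_rot ht).
Qed.

(** The Cauchy-Schwarz inequality for a positive definite kernel, from its 2 by 2 matrix at k and p
    with diagonal 1. *)
Lemma kernel_le1 (k p : R3 R) : k != 0 -> p != 0 -> Normc.normc (t k p) <= 1.
Proof.
move=> k0 p0.
pose P (i : 'I_2) := if i == 0 then k else p.
have P0 i : P i != 0 by rewrite /P; case: ifP.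
have H (a b : R[i]) : 0 <= a^*%C * a + a^*%C * b * t k p + (b^*%C * a * t p k + b^*%C * b).
  have := ker_pos ht (fun i : 'I_2 => if i == 0 then a else b) P0.
  rewrite !big_ord_recl !big_ord0 /= !addr0 (ker_diag ht k0) (ker_diag ht p0) !mulr1.
  by [].
have im0 (z : R[i]) : 0 <= z -> complex.Im z = 0 by rewrite lecE /= => /andP[/eqP].
have := im0 _ (H 1 1); have := im0 _ (H 1 'i%C).
have := H 1 (- (t k p)^*%C).
case: (t k p) => x y; case: (t p k) => u v.
rewrite lecE /= => /andP[_ +] E1 E2.
have -> : u = x by lra.
have -> : v = - y by lra.
move=> E3.
have : x ^+ 2 + y ^+ 2 <= 1 by lra.
by move=> xy; rewrite -[leRHS]sqrtr1 ler_sqrt.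
Qed.

Lemma off0_le1 k p : Normc.normc (off0 t k p) <= 1.
Proof.
rewrite /off0; case: ifP => [/andP[k0 p0]|_]; first exact: kernel_le1.
by rewrite Normc.normc0.
Qed.

Lemma off0_formula f Delta : L1 f -> L2 f -> measurable Delta ->
  ip f (T Delta f) = ((2 * pi) ^- 3)%:C * cint Delta (kform (off0 t) f f).
Proof.
move=> f1 f2 mD; have mf := L1_meas f1; have mt := jmeas_off0.
rewrite (_ : kform (off0 t) f f = fun x => cint setT (fun p => cint setT (fun k =>
  t k p * expi (dot3 (p - k) x) * (f k)^*%C * f p))); first exact: (ker_formula ht).
apply/funext => x; apply/esym/cint_off0; first exact: cmeas_kform_inner.
move=> p p0; apply: cint_off0.
  by apply: kform_integrand_meas => //; exact: measurable_cst.
by move=> k k0; rewrite /off0 k0 p0.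
Qed.

Lemma off0_ae : \forall kp \ae (mu \x mu)%E, off0 t kp.1 kp.2 = t kp.1 kp.2.
Proof.
have [N [mN N0 sN]] := @ae_neq0 R.
exists ((N `*` setT) `|` (setT `*` N)); split.
- by apply: measurableU; exact: measurableX.
- apply/eqP; rewrite -measure_le0.
  rewrite (le_trans (measureU2 _ _ _))//; try exact: measurableX.
  have eqle (x y : \bar R) : x = y -> (x <= y)%E by move=> ->.
  have h1 : (mu \x mu)%E (N `*` setT) = 0%E by rewrite leb33X// N0 mul0e.
  have h2 : (mu \x mu)%E (setT `*` N) = 0%E by rewrite leb33X// N0 mule0.
  rewrite -[leRHS]adde0; apply: leeD; [exact: (eqle _ _ h1)|exact: (eqle _ _ h2)].
- move=> [k p] /=; rewrite /off0; have [k0|k0] := boolP (k == 0).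
    by move=> _; left; split => //; apply: sN => /=; rewrite k0.
  have [p0|p0] := boolP (p == 0); last by [].
  by move=> _; right; split => //; apply: sN => /=; rewrite p0.
Qed.

End kernel_of_POL.

Lemma L2_ae (R : realType) (f g : wave R) : cmeasurable setT f -> L2 g ->
  g = f %[ae leb3] -> L2 f.
Proof.
move=> mf [mg oo] gf; split=> //; rewrite (_ : integral _ _ _ =
  (\int[leb3]_x ((Normc.normc (g x)) ^+ 2)%:E)%E)//.
apply: ae_eq_integral => //.
- by apply/measurable_EFinP; apply: measurable_funX; exact: measurable_normc.
- by apply/measurable_EFinP; apply: measurable_funX; exact: measurable_normc.
- by apply: filterS gf => x /= E _; rewrite E.
Qed.

(** * Kinematic deformations as explicit operators *)

Section kinematic_operator.
Context {R : realType} (F F' : wave R -> wave R).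
Hypothesis hF : is_fourier F F'.
Local Notation mu := (@leb3 R).
Local Notation cmeas := (@cmeasurable R _ (R3 R) setT).
Local Notation L1 := (@Lpow R 1).
Local Notation cF := ((2 * pi) `^ (- (3 / 2)) : R).
Implicit Types (f g phi psi : wave R) (Delta : set (R3 R)).

Lemma bmeas_indic Delta : measurable Delta -> bmeas (fun p : R3 R => (\1_Delta p)%:C : R[i]).
Proof.
move=> mD; split; first by apply: cmeas_real; exact: measurable_indic.
by exists 1 => p; rewrite normc_real indicE; case: (_ \in _); rewrite ?normr1 ?normr0.
Qed.

Lemma Ecan_L2 Delta f : measurable Delta -> L2 f -> L2 (Ecan Delta f).
Proof. by move=> mD f2; apply: bmeas_L2 => //; exact: bmeas_indic. Qed.

Lemma ENW_L2 Delta f : measurable Delta -> L2 f -> L2 (ENW F F' Delta f).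
Proof. by move=> mD f2; apply: (F_L2 hF); apply: Ecan_L2 => //; exact: (F'_L2 hF). Qed.

Lemma ENW_ae Delta f g : measurable Delta -> L2 f -> L2 g -> f = g %[ae mu] ->
  ENW F F' Delta f = ENW F F' Delta g %[ae mu].
Proof.
move=> mD f2 g2 fg; have f'2 := F'_L2 hF f2; have g'2 := F'_L2 hF g2.
apply: (F_ae hF); try exact: Ecan_L2.
by apply: filterS (F'_ae hF f2 g2 fg) => p /= E _; rewrite /Ecan /mulop E.
Qed.

Lemma ENW_setT f : L2 f -> ENW F F' setT f = f %[ae mu].
Proof.
move=> f2; have f'2 := F'_L2 hF f2.
have E : Ecan setT (F' f) = F' f.
  by apply/funext => p; rewrite /Ecan /mulop indicT mul1r.
by rewrite /ENW /= E; exact: (FK' hF).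
Qed.

Lemma ip_ENW Delta f g : measurable Delta -> L2 f -> L2 g ->
  ip f (ENW F F' Delta g) = ip (F' f) (Ecan Delta (F' g)).
Proof.
move=> mD f2 g2; have f'2 := F'_L2 hF f2; have g'2 := F'_L2 hF g2.
have e2 := Ecan_L2 mD g'2.
rewrite -[RHS](fourier_isom hF)// (ip_ael _ _ _ (FK' hF f2))//.
- by apply: L2_meas; exact: (F_L2 hF).
- exact: L2_meas.
- by apply: L2_meas; exact: (F_L2 hF).
Qed.

Lemma ip_Ecan_conj Delta f g : measurable Delta -> L2 f -> L2 g ->
  ip g (Ecan Delta f) = (ip f (Ecan Delta g))^*%C.
Proof.
move=> mD f2 g2; rewrite [in RHS]ipE -cint_conj; last exact: (L2_mul f2 (Ecan_L2 mD g2)).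
rewrite ipE; congr cint; apply/funext => p.
by rewrite /Ecan /mulop !conjcM conjcK conjc_real; ring.
Qed.

Lemma ip_mulop w f g : ip (mulop w f) g = ip f (mulop (fun p => (w p)^*%C) g).
Proof.
by rewrite !ipE; congr cint; apply/funext => p; rewrite /mulop conjcM; ring.
Qed.

Definition eform Delta phi psi := ip (F' phi) (Ecan Delta (F' psi)).

Section eform.
Variable Delta : set (R3 R).
Hypothesis mD : measurable Delta.

Lemma eform_conj phi psi : L2 phi -> L2 psi ->
  eform Delta psi phi = (eform Delta phi psi)^*%C.
Proof. by move=> ? ?; apply: ip_Ecan_conj => //; exact: (F'_L2 hF). Qed.

Lemma eform_lin (c : R[i]) phi f g : L2 phi -> L2 f -> L2 g ->
  eform Delta phi (fun p => c * f p + g p) = c * eform Delta phi f + eform Delta phi g.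
Proof.
move=> phi2 f2 g2; have f'2 := F'_L2 hF f2; have g'2 := F'_L2 hF g2.
have p'2 := F'_L2 hF phi2; have cfg2 := L2D (L2Z c f2) g2.
have fg'2 := F'_L2 hF cfg2.
rewrite /eform; transitivity (ip (F' phi) (fun p => c * Ecan Delta (F' f) p + Ecan Delta (F' g) p)).
  apply: ip_aer; try exact: L2_meas.
  - by apply: L2_meas; exact: Ecan_L2.
  - by apply: L2_meas; apply: L2D; [apply: L2Z|]; exact: Ecan_L2.
  - apply: filterS (F'_lin hF c f2 g2) => p /= E _.
    by rewrite /Ecan /mulop E//; ring.
rewrite ipDr//; [|by apply: L2Z; exact: Ecan_L2|exact: Ecan_L2].
by rewrite ipZr//; exact: Ecan_L2.
Qed.

End eform.

Section finite_sum.
Variables (n : nat) (w : 'I_n -> wave R).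
Hypothesis bw : forall l, bmeas (w l).

(** The deformation of the Newton-Wigner localization by the functions w_l, with the adjoint of
    w_l(P) taken to be multiplication by the conjugate function. *)
Definition kinS Delta phi : wave R :=
  fun p => \sum_l mulop (fun q => (w l q)^*%C) (ENW F F' Delta (mulop (w l) phi)) p.

Variable Delta : set (R3 R).
Hypothesis mD : measurable Delta.

Let term_L2 l phi : L2 phi ->
  L2 (mulop (fun q => (w l q)^*%C) (ENW F F' Delta (mulop (w l) phi))).
Proof.
move=> phi2; apply: bmeas_L2; first exact: bmeas_conj.
by apply: ENW_L2 => //; exact: bmeas_L2.
Qed.

Lemma kinS_L2 phi : L2 phi -> L2 (kinS Delta phi).
Proof. by move=> phi2; apply: L2_sum => l; exact: term_L2. Qed.

Lemma ip_kinS phi psi : L2 phi -> L2 psi ->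
  ip phi (kinS Delta psi) = \sum_l eform Delta (mulop (w l) phi) (mulop (w l) psi).
Proof.
move=> phi2 psi2; rewrite ip_sumr//; last by move=> l; exact: term_L2.
by apply: eq_bigr => l _; rewrite -ip_mulop ip_ENW//; exact: bmeas_L2.
Qed.

Lemma kinS_conj phi psi : L2 phi -> L2 psi ->
  ip psi (kinS Delta phi) = (ip phi (kinS Delta psi))^*%C.
Proof.
move=> phi2 psi2; rewrite !ip_kinS// conjc_sum; apply: eq_bigr => l _.
by apply: eform_conj => //; exact: bmeas_L2.
Qed.

Lemma kinS_lin (c : R[i]) phi f g : L2 phi -> L2 f -> L2 g ->
  ip phi (kinS Delta (fun p => c * f p + g p)) =
  c * ip phi (kinS Delta f) + ip phi (kinS Delta g).
Proof.
move=> phi2 f2 g2; rewrite !ip_kinS//; last by apply: L2D => //; exact: L2Z.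
rewrite mulr_sumr -big_split /=; apply: eq_bigr => l _.
rewrite -eform_lin//; try exact: bmeas_L2.
by congr eform; apply/funext => p; rewrite /mulop mulrDr mulrCA.
Qed.

Lemma kinS_formula phi : L1 phi -> L2 phi ->
  ip phi (kinS Delta phi) = ((2 * pi) ^- 3)%:C * cint Delta (kform (gramk w) phi phi).
Proof.
move=> phi1 phi2; rewrite ip_kinS// -cF_sqr.
(* The Fourier integrals are square integrable because they represent F'. Each summand of the
   density is thus integrable over any Delta, also of infinite measure, and the sum may be
   integrated termwise. *)
have L2i l : L2 (fun x => cF%:C * invft (mulop (w l) phi) x).
  have w1 := bmeas_L1 (bw l) phi1; have w2 := bmeas_L2 (bw l) phi2.
  have E := F'_ker hF w1 w2; have w'2 := F'_L2 hF w2.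
  have mi : cmeas (fun x => cF%:C * invft (mulop (w l) phi) x).
    by apply: cmeasM; [exact: cmeas_cst|apply: cmeas_invft; exact: L1_meas].
  exact: (L2_ae mi w'2 E).
have iT l : L1 (fun x => (\1_Delta x)%:C *
    ((invft (mulop (w l) phi) x)^*%C * invft (mulop (w l) phi) x)).
  have [mi [M iM]] := bmeas_indic mD.
  apply: (L1_bmul _ mi iM); have := L1Z (cF^-1 ^+ 2)%:C (L2_mul (L2i l) (L2i l)).
  congr Lpow; apply/funext => x; rewrite !conjcM conjc_real.
  transitivity ((cF^-1 ^+ 2)%:C * (cF%:C * cF%:C) *
    ((invft (mulop (w l) phi) x)^*%C * invft (mulop (w l) phi) x)); first by ring.
  rewrite -!realCM -expr2 -exprMn mulVf ?expr1n ?rmorph1 ?mul1r//.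
  by rewrite gt_eqF// cF_gt0.
rewrite cint_mkcond.
under [X in _ = _ * cint _ X]eq_fun => x.
  rewrite kform_gramk// mulr_sumr; over.
rewrite cint_sum// mulr_sumr; apply: eq_bigr => l _.
rewrite -cintZ//; have w1 := bmeas_L1 (bw l) phi1; have w2 := bmeas_L2 (bw l) phi2.
have w'2 := F'_L2 hF w2; have E := F'_ker hF w1 w2.
rewrite /eform ipE; apply: cint_ae.
- by apply: L1_meas; apply: L2_mul => //; exact: Ecan_L2.
- by apply: L1_meas; apply: L1Z.
- apply: filterS E => x /(_ I) Ex _; rewrite -[Ecan _ _ x]/((\1_Delta x)%:C * _).
  by rewrite Ex conjcM conjc_real expr2 realCM; ring.
Qed.

(** This turns the normalization of T into a statement about the values of [gramk w] on the
    diagonal. *)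
Lemma kinS_setT phi : Delta = setT -> L2 phi ->
  kinS Delta phi = (fun p => (\sum_l (w l p)^*%C * w l p) * phi p) %[ae mu].
Proof.
move=> -> phi2.
have : \forall p \ae mu, forall l, ENW F F' setT (mulop (w l) phi) p = mulop (w l) phi p.
  apply: filter_forall => l.
  by apply/aeE/ENW_setT; exact: bmeas_L2.
apply: filterS => p E _; rewrite /kinS mulr_suml; apply: eq_bigr => l _.
by rewrite /mulop E /mulop mulrA.
Qed.

End finite_sum.
End kinematic_operator.

(** * Operators with a kernel of finite rank *)

Section operator_of_kernel.
Context {R : realType} (F F' : wave R -> wave R)
  (T : set (R3 R) -> wave R -> wave R) (t : R3 R -> R3 R -> R[i]).
Hypotheses (hF : is_fourier F F') (hT : is_POL T) (ht : is_kernel T t).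
Local Notation mu := (@leb3 R).
Implicit Types (f g phi psi : wave R) (Delta : set (R3 R)).

Let addw f g : wave R := fun p => f p + g p.
Let scalew (c : R[i]) f : wave R := fun p => c * f p.

Section fixed_Delta.
Variable Delta : set (R3 R).
Hypothesis mD : measurable Delta.

Lemma T_L2 f : L2 f -> L2 (T Delta f).
Proof. exact: (bop_L2 (pol_bop hT mD)). Qed.

Lemma ip_T_lin (c : R[i]) phi f g : L2 phi -> L2 f -> L2 g ->
  ip phi (T Delta (fun p => c * f p + g p)) = c * ip phi (T Delta f) + ip phi (T Delta g).
Proof.
move=> phi2 f2 g2; have cfg2 := L2D (L2Z c f2) g2.
have Tf2 := T_L2 f2; have Tg2 := T_L2 g2.
rewrite (ip_aer _ _ _ (bop_lin (pol_bop hT mD) c f2 g2)).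
- by rewrite ipDr ?ipZr//; exact: L2Z.
- exact: L2_meas.
- by apply: L2_meas; exact: T_L2.
- by apply: L2_meas; apply: L2D => //; exact: L2Z.
Qed.

Lemma ip_T_add phi f g : L2 phi -> L2 f -> L2 g ->
  ip phi (T Delta (addw f g)) = ip phi (T Delta f) + ip phi (T Delta g).
Proof.
move=> phi2 f2 g2; rewrite -[X in X + _]mul1r -ip_T_lin//; congr (ip _ (T _ _)).
by apply/funext => p; rewrite mul1r.
Qed.

Lemma ip_T_scale (c : R[i]) phi f : L2 phi -> L2 f ->
  ip phi (T Delta (scalew c f)) = c * ip phi (T Delta f).
Proof.
move=> phi2 f2.
have Z : ip phi (T Delta (fun=> 0)) = 0.
  have := ip_T_add phi2 (@L2_0 R) (@L2_0 R).
  rewrite /addw; under eq_fun do rewrite addr0.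
  by move/eqP; rewrite -subr_eq subrr => /eqP <-.
rewrite -[RHS]addr0 -[in RHS]Z -ip_T_lin//; last exact: L2_0.
by congr (ip _ (T _ _)); apply/funext => p; rewrite addr0.
Qed.

(** Symmetry of T(Delta) is a consequence of positivity by polarization. *)
Lemma T_herm phi psi : L2 phi -> L2 psi ->
  ip psi (T Delta phi) = (ip phi (T Delta psi))^*%C.
Proof.
apply: (@polar_herm R (wave R) (@L2 R) addw scalew (fun f g => ip f (T Delta g))).
- by move=> f g f2 g2; exact: L2D.
- by move=> c f f2; exact: L2Z.
- by move=> f g h f2 g2 h2; apply: ipDl => //; exact: T_L2.
- by move=> f g h f2 g2 h2; exact: ip_T_add.
- by move=> c f g f2 g2; apply: ipZl => //; exact: T_L2.
- by move=> c f g f2 g2; exact: ip_T_scale.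
- by move=> f f2; exact: (pol_pos hT mD).
Qed.

Variables (n : nat) (w : 'I_n -> wave R).
Hypothesis bw : forall l, bmeas (w l).

(* The two operators are symmetric and have the same quadratic form on
   dominated functions. *)
Lemma POL_eq_kinS :
  (\forall kp \ae (mu \x mu)%E, off0 t kp.1 kp.2 = gramk w kp.1 kp.2) ->
  forall phi, L2 phi -> T Delta phi = kinS F F' w Delta phi %[ae mu].
Proof.
move=> FR.
have quad phi : dominated phi -> ip phi (T Delta phi) = ip phi (kinS F F' w Delta phi).
  move=> dp; have p1 := dom_L1 dp; have p2 := dom_L2 dp; have mp := L1_meas p1.
  rewrite (off0_formula ht p1 p2 mD) (kinS_formula hF bw mD p1 p2).
  suff -> : kform (off0 t) phi phi = kform (gramk w) phi phi by exact: erefl.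
  apply/funext => x; apply: kform_ae => //; first exact: (jmeas_off0 ht).
  by apply: jmeas_gramk => l; case: (bw l).
have kl phi : L2 phi -> L2 (kinS F F' w Delta phi) by exact: (kinS_L2 hF bw mD).
have pol phi psi : dominated phi -> dominated psi ->
    ip phi (T Delta psi) = ip phi (kinS F F' w Delta psi).
  move=> dp dq; apply/eqP; rewrite -subr_eq0; apply/eqP; move: phi psi dp dq.
  apply: (@polar0 R (wave R) (@dominated R) addw scalew
    (fun f g => ip f (T Delta g) - ip f (kinS F F' w Delta g))).
  - by move=> f g f2 g2; exact: domD.
  - by move=> c f f2; exact: domZ.
  - move=> f g h /dom_L2 f2 /dom_L2 g2 /dom_L2 h2.
    by rewrite /addw !ipDl//; [ring|exact: kl|exact: T_L2].
  - move=> f g h /dom_L2 f2 /dom_L2 g2 /dom_L2 h2.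
    rewrite ip_T_add//; have := kinS_lin hF bw mD 1 f2 g2 h2.
    under [X in ip _ (kinS _ _ _ _ X)]eq_fun do rewrite mul1r.
    by move=> ->; ring.
  - move=> c f g /dom_L2 f2 /dom_L2 g2.
    by rewrite /scalew !ipZl//; [ring|exact: kl|exact: T_L2].
  - move=> c f g /dom_L2 f2 /dom_L2 g2.
    rewrite ip_T_scale//; have := kinS_lin hF bw mD c f2 g2 (@L2_0 R).
    have Z : ip f (kinS F F' w Delta (fun=> 0)) = 0.
      have := kinS_lin hF bw mD 1 f2 (@L2_0 R) (@L2_0 R).
      under [X in ip _ (kinS _ _ _ _ X)]eq_fun do rewrite mulr0 addr0.
      by rewrite mul1r => /eqP; rewrite -subr_eq subrr => /eqP <-.
    rewrite Z addr0; under [X in ip _ (kinS _ _ _ _ X)]eq_fun do rewrite addr0.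
    by move=> ->; ring.
  - by move=> f df; rewrite quad// subrr.
have dom_eq phi : dominated phi -> T Delta phi = kinS F F' w Delta phi %[ae mu].
  move=> dp; have p2 := dom_L2 dp; apply: test_L2_ae; [exact: T_L2|exact: kl|].
  by move=> eta de; exact: pol.
move=> psi psi2; apply: test_L2_ae; [exact: T_L2|exact: kl|].
move=> eta de; have e2 := dom_L2 de.
rewrite T_herm// (kinS_conj hF bw)//; congr (_^*%C).
apply: ip_aer; try (apply: L2_meas).
- exact: psi2.
- exact: T_L2.
- exact: kl.
- exact: dom_eq.
Qed.

End fixed_Delta.
End operator_of_kernel.

(** * A localization determines its kernel *)

Section kernel_uniqueness.
Context {R : realType}.
Local Notation mu := (@leb3 R).
Local Notation rint h := (mu.-integrable setT (EFin \o h)).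
Local Notation cmeas := (@cmeasurable R _ (R3 R) setT).
Local Notation L1 := (@Lpow R 1).
Implicit Types (phi psi : wave R).

(** Rectangles are stable under intersection and generate the product sigma-algebra, and the sets
    over which [h] has integral 0 form a Dynkin class. *)
Lemma integral_rect_eq0 (h : R3 R * R3 R -> R) :
  (mu \x mu)%E.-integrable setT (EFin \o h) ->
  (forall A B : set (R3 R), measurable A -> measurable B ->
    (\int[mu \x mu]_(q in A `*` B) (h q)%:E = 0)%E) ->
  h = (fun=> 0) %[ae (mu \x mu)%E].
Proof.
move=> ih H.
pose C : set (set (R3 R * R3 R)) :=
  [set C | exists A, measurable A /\ exists B, measurable B /\ C = A `*` B].
have CI : setI_closed C.
  move=> /= _ _ [X1 [mX1 [X2 [mX2 ->]]]] [Y1 [mY1 [Y2 [mY2 ->]]]].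
  rewrite -setXI; exists (X1 `&` Y1); split; first exact: measurableI.
  by exists (X2 `&` Y2); split => //; exact: measurableI.
have CE : @measurable _ (R3 R * R3 R)%type = <<s C >>.
  rewrite measurable_prod_measurableType //; congr (<<s _ >>).
  rewrite predeqE; split => [[A mA [B mB <-]]|[A [mA [B [mB ->]]]]].
    by exists A; split => //; exists B.
  by exists A => //; exists B.
have ihS S : measurable S -> (mu \x mu)%E.-integrable S (EFin \o h).
  by move=> mS; apply: integrableS ih.
have mh : measurable_fun setT (EFin \o h) by exact: measurable_int ih.
have all0 S : measurable S -> (\int[mu \x mu]_(q in S) (h q)%:E = 0)%E.
  move=> mS; move: (mS); rewrite {1}CE; apply: (dynkin_induction
    (P := fun S => (\int[mu \x mu]_(q in S) (h q)%:E = 0)%E) CE CI) => {S mS}.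
  - by rewrite -setXTT; exact: H.
  - by move=> _ [A [mA [B [mB ->]]]]; exact: H.
  - move=> S mS S0.
    have : (\int[mu \x mu]_(q in setT) (h q)%:E = 0)%E by rewrite -setXTT; exact: H.
    rewrite -(setUv S) integral_setU//.
    + by rewrite S0 add0e.
    + exact: measurableC.
    + by rewrite setUv.
    + by rewrite disj_set2E; apply/eqP; rewrite setICr.
  - move=> G mG tG G0; rewrite integral_bigcup//.
      by under eq_eseriesr do rewrite G0; rewrite eseries0.
    exact/ihS/bigcup_measurable.
have E : ae_eq (mu \x mu)%E setT (EFin \o h) (EFin \o (fun=> 0)).
  apply: integral_ae_eq => //; first exact: measurable_cst.
  by move=> S _ mS; rewrite all0//= integral0.
by apply: filterS E => q /= /(_ I) [].
Qed.

Let I0 := \int[mu]_x gauw x.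

(** The bound uses [gauw] and not [gau], so that it also covers differences of phases, which carry a
    factor |p| + |k|. *)
Definition gdom (G : R3 R * R3 R -> R[i]) := cmeasurable setT G /\
  exists2 A : R, 0 <= A & forall p k, Normc.normc (G (p, k)) <= A * gauw p * gauw k.

Definition dint (G : R3 R * R3 R -> R[i]) :=
  cint setT (fun p => cint setT (fun k => G (p, k))).

Lemma gdom_in G p : gdom G -> L1 (fun k => G (p, k)).
Proof.
move=> [mG [A A0 GA]]; have i := rintZ (A * gauw p) (@rint_gauw R).
by apply: (L1_le (cmeas_comp mG (measurable_pair1 p)) i) => k; exact: GA.
Qed.

Lemma gdom_out G : gdom G -> L1 (fun p => cint setT (fun k => G (p, k))).
Proof.
move=> [mG [A A0 GA]]; have i := rintZ A (@rint_gauw R).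
exact: (L1_cint i (@rint_gauw R) mG).
Qed.

Lemma gdomZ (c : R[i]) G : gdom G -> gdom (fun q => c * G q).
Proof.
move=> [mG [A A0 GA]]; split; first by apply: cmeasM => //; exact: cmeas_cst.
exists (Normc.normc c * A); first by rewrite mulr_ge0// normc_ge0.
by move=> p k; rewrite Normc.normcM -!mulrA ler_wpM2l ?normc_ge0// mulrA.
Qed.

Lemma dintD G H : gdom G -> gdom H -> dint (fun q => G q + H q) = dint G + dint H.
Proof.
move=> dG dH; rewrite /dint -cintD; [|exact: gdom_out|exact: gdom_out].
by congr cint; apply/funext => p; rewrite cintD//; exact: gdom_in.
Qed.

Lemma dintZ (c : R[i]) G : gdom G -> dint (fun q => c * G q) = c * dint G.
Proof.
move=> dG; rewrite /dint -cintZ; last exact: gdom_out.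
by congr cint; apply/funext => p; rewrite cintZ//; exact: gdom_in.
Qed.

Lemma dintB G H : gdom G -> gdom H -> dint (fun q => G q - H q) = dint G - dint H.
Proof.
move=> dG dH; under [X in dint X]eq_fun do rewrite -mulN1r.
by rewrite dintD ?dintZ ?mulN1r//; exact: gdomZ.
Qed.

Lemma dint_le G (A : R) : cmeasurable setT G -> 0 <= A ->
  (forall p k, Normc.normc (G (p, k)) <= A * gauw p * gauw k) ->
  Normc.normc (dint G) <= 4 * I0 ^+ 2 * A.
Proof.
move=> mG A0 GA; have dG : gdom G by split => //; exists A.
have i := rintZ (2 * I0 * A) (@rint_gauw R).
apply: le_trans (normc_cint (L1_meas (gdom_out dG)) i _) _.
  move=> p; have ip := rintZ (A * gauw p) (@rint_gauw R).
  apply: le_trans (normc_cint (L1_meas (gdom_in p dG)) ip _) _ => //.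
  by rewrite RintegralZl//; [rewrite -/I0 le_eqVlt; apply/orP; left; apply/eqP; ring|exact: rint_gauw].
rewrite RintegralZl//; last exact: rint_gauw.
by rewrite -/I0 le_eqVlt; apply/orP; left; apply/eqP; ring.
Qed.

Definition jbdd (K : R3 R -> R3 R -> R[i]) :=
  jmeas K /\ exists2 M : R, 0 <= M & forall k p, Normc.normc (K k p) <= M.

Definition kint (K : R3 R -> R3 R -> R[i]) phi psi x (q : R3 R * R3 R) : R[i] :=
  K q.2 q.1 * expi (dot3 (q.1 - q.2) x) * (phi q.2)^*%C * psi q.1.

Lemma kformE K phi psi x : kform K phi psi x = dint (kint K phi psi x).
Proof. by []. Qed.

Lemma cmeas_kint K phi psi x : jmeas K -> cmeas phi -> cmeas psi ->
  cmeasurable setT (kint K phi psi x).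
Proof.
by move=> mK mphi mpsi; apply: kform_integrand_meas => //; exact: measurable_cst.
Qed.

Lemma gdom_kint K phi psi x : jbdd K -> dominated phi -> dominated psi ->
  gdom (kint K phi psi x).
Proof.
move=> [mK [M M0 KM]] [mphi [C C0 phiC]] [mpsi [D D0 psiD]].
split; first exact: cmeas_kint.
exists (M * C * D); first by rewrite !mulr_ge0.
move=> p k; rewrite /kint /= !Normc.normcM normc_expi normc_conj mulr1.
apply: (@le_trans _ _ (M * (C * gau k) * (D * gau p))).
  by rewrite !ler_pM ?mulr_ge0 ?normc_ge0.
rewrite (_ : M * (C * gau k) * (D * gau p) = M * C * D * gau p * gau k); last by ring.
by rewrite !ler_pM ?mulr_ge0 ?gau_ge0 ?gau_le.
Qed.

Lemma kformB K1 K2 phi psi x : jbdd K1 -> jbdd K2 -> dominated phi -> dominated psi ->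
  kform (fun k p => K1 k p - K2 k p) phi psi x = kform K1 phi psi x - kform K2 phi psi x.
Proof.
move=> b1 b2 d1 d2; rewrite !kformE -dintB; [|exact: gdom_kint|exact: gdom_kint].
by congr dint; apply/funext => q; rewrite /kint; ring.
Qed.

Lemma kform_bounded K phi psi : jbdd K -> dominated phi -> dominated psi ->
  exists M : R, forall x, Normc.normc (kform K phi psi x) <= M.
Proof.
move=> [mK [M M0 KM]] [mphi [C C0 phiC]] [mpsi [D D0 psiD]].
exists (4 * I0 ^+ 2 * (M * C * D)) => x; rewrite kformE; apply: dint_le.
- exact: cmeas_kint.
- by rewrite !mulr_ge0.
move=> p k; rewrite /kint /= !Normc.normcM normc_expi normc_conj mulr1.
apply: (@le_trans _ _ (M * (C * gau k) * (D * gau p))).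
  by rewrite !ler_pM ?mulr_ge0 ?normc_ge0.
rewrite (_ : M * (C * gau k) * (D * gau p) = M * C * D * gau p * gau k); last by ring.
by rewrite !ler_pM ?mulr_ge0 ?gau_ge0 ?gau_le.
Qed.

(** The phases at x and at 0 differ by at most 2 (|p| + |k|) |x|, and the Gaussian decay of the test
    functions absorbs |p| + |k|. *)
Lemma kform_lip K phi psi : jbdd K -> dominated phi -> dominated psi ->
  exists2 L : R, 0 <= L &
  forall x, Normc.normc (kform K phi psi x - kform K phi psi 0) <= L * nrm x.
Proof.
move=> bK dphi dpsi; have [mK [M M0 KM]] := bK.
have [mphi [C C0 phiC]] := dphi; have [mpsi [D D0 psiD]] := dpsi.
exists (4 * I0 ^+ 2 * (4 * M * C * D)); first by apply: mulr_ge0; [apply: mulr_ge0 => //; exact: sqr_ge0|rewrite !mulr_ge0].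
move=> x; rewrite !kformE -dintB; [|exact: gdom_kint|exact: gdom_kint].
rewrite -[leRHS]mulrA; apply: dint_le.
- by apply: cmeasB; exact: cmeas_kint.
- by rewrite !mulr_ge0// nrm_ge0.
move=> p k; rewrite /kint /=.
rewrite (_ : _ - _ = K k p * (expi (dot3 (p - k) x) - expi (dot3 (p - k) 0)) *
  (phi k)^*%C * psi p); last by ring.
rewrite !Normc.normcM normc_conj.
have e : Normc.normc (expi (dot3 (p - k) x) - expi (dot3 (p - k) 0)) <=
    2 * ((nrm p + nrm k) * nrm x).
  apply: le_trans (expi_lip _ _) _; rewrite ler_wpM2l//.
  rewrite [dot3 _ 0]dot3C dot30l subr0 dot3Bl (le_trans (ler_normB _ _))// mulrDl.
  by rewrite lerD// dot3_CS.
apply: (@le_trans _ _ (M * (2 * ((nrm p + nrm k) * nrm x)) * (C * gau k) * (D * gau p))).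
  by rewrite !ler_pM ?mulr_ge0 ?normc_ge0.
have -> : M * (2 * ((nrm p + nrm k) * nrm x)) * (C * gau k) * (D * gau p) =
  2 * M * C * D * nrm x * ((nrm p * gau p) * gau k + gau p * (nrm k * gau k)) by ring.
have -> : 4 * M * C * D * nrm x * gauw p * gauw k =
  2 * M * C * D * nrm x * (gauw p * gauw k + gauw p * gauw k) by ring.
rewrite ler_wpM2l ?mulr_ge0 ?nrm_ge0//.
by rewrite lerD// ler_pM ?mulr_ge0 ?nrm_ge0 ?gau_ge0 ?gau_le ?nrm_gau.
Qed.

Let rint_indic (A : set (R3 R)) : measurable A -> (mu A < +oo)%E ->
  rint (\1_A : R3 R -> R).
Proof.
move=> mA oo; apply/integrableP; split; first exact/measurable_EFinP/measurable_indic.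
rewrite (_ : integral _ _ _ = mu A)//.
transitivity (\int[mu]_x (\1_A x)%:E)%E; last by rewrite integral_indic// setIT.
by apply: eq_integral => x _; rewrite /= ger0_norm// indicE.
Qed.

Let cube (e : R) : set (R3 R) := ((`[- e, e]%classic `*` `[- e, e]%classic) `*` `[- e, e]%classic).

Let mcube e : measurable (cube e).
Proof. by apply: measurableX => //; exact: measurableX. Qed.

Let cube_measure e : 0 < e -> mu (cube e) = ((2 * e) ^+ 3)%:E.
Proof.
move=> e0; rewrite /cube leb3X//; last exact: measurableX.
rewrite leb2X//= lebesgue_measure_itv/= lte_fin gtrN// -!EFinB -!EFinM.
by congr EFin; ring.
Qed.

Let cube_nrm e x : 0 <= e -> cube e x -> nrm x <= 2 * e.
Proof.
case: x => [[a b] c] e0 [[/= + +] +]; rewrite !in_itv/= => /andP[a1 a2] /andP[b1 b2] /andP[c1 c2].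
rewrite -ler_sqr ?nnegrE ?mulr_ge0 ?nrm_ge0// nrm_sqr /dot3 /=.
nra.
Qed.

(** If h(0) were nonzero, the real part of h(0)^* h would be bounded below on a small cube around 0
    by a positive constant. *)
Lemma cint_cube_eq0 (h : wave R) : cmeas h -> (exists M : R, forall x, Normc.normc (h x) <= M) ->
  (exists2 L : R, 0 <= L & forall x, Normc.normc (h x - h 0) <= L * nrm x) ->
  (forall Delta, measurable Delta -> (mu Delta < +oo)%E -> cint Delta h = 0) -> h 0 = 0.
Proof.
move=> mh [M hM] [L L0 hL] H; apply/eqP/negPn/negP => h0.
have n0 : 0 < Normc.normc (h 0) by rewrite lt_neqAle normc_ge0 andbT eq_sym normc_eq0.
(* Points of the cube have norm at most 2 e, so h varies there by at most 2 e (L + 1) = |h(0)| / 2.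
   The summand 1 covers L = 0. *)
pose e := Normc.normc (h 0) / (4 * (L + 1)).
have e0 : 0 < e by rewrite divr_gt0// mulr_gt0// ltr_wpDl.
have small x : cube e x -> Normc.normc (h x - h 0) <= Normc.normc (h 0) / 2.
  move=> /(cube_nrm (ltW e0)) xe; apply: le_trans (hL x) _.
  apply: (@le_trans _ _ ((L + 1) * (2 * e))).
    by rewrite ler_pM ?nrm_ge0// lerDl.
  rewrite /e le_eqVlt; apply/orP; left; apply/eqP; field.
  by rewrite gt_eqF// ltr_wpDl.
have iu : rint (\1_(cube e) : R3 R -> R).
  by apply: rint_indic => //; rewrite cube_measure// ltry.
have i1 : L1 (fun x => (\1_(cube e) x)%:C * h x).
  have := L1_bmul (L1_real iu) mh hM.
  by congr Lpow; apply/funext => x; rewrite mulrC.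
have := H _ (mcube e); rewrite cube_measure// ltry => /(_ isT).
rewrite cint_mkcond => E.
have : cint setT (fun x => (h 0)^*%C * ((\1_(cube e) x)%:C * h x)) = 0.
  by rewrite cintZ// E mulr0.
move/(congr1 (@complex.Re R)) => /=.
set u := fun x => complex.Re ((h 0)^*%C * ((\1_(cube e) x)%:C * h x)).
have iu2 : rint u.
  by have /L1P[_ + _] := L1Z (h 0)^*%C i1.
have uE x : cube e x -> Normc.normc (h 0) ^+ 2 / 2 <= u x.
  move=> cx; rewrite /u indicE mem_set// mul1r.
  have -> : h x = h 0 + (h x - h 0) by ring.
  rewrite mulrDr cReD mulJc /=.
  have := normc_Re ((h 0)^*%C * (h x - h 0)).
  rewrite Normc.normcM normc_conj.
  have := small _ cx; set a := Normc.normc (h x - h 0); set b := Normc.normc (h 0).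
  move=> ab; rewrite ler_norml => /andP[lo _].
  have : b * a <= b * (b / 2) by rewrite ler_wpM2l// normc_ge0.
  by move: lo; set r := complex.Re _; lra.
have u0 x : 0 <= u x.
  have [cx|ncx] := pselect (cube e x).
    by apply: le_trans (uE _ cx); rewrite divr_ge0// sqr_ge0.
  by rewrite /u indicE memNset//= mul0r mulr0.
move=> /(rint0_ae iu2 u0)/aeE[N [mN N0 sN]].
have : (mu (cube e) <= mu N)%E.
  apply: le_measure; rewrite ?inE//.
  move=> x cx; apply: sN => /= ux; have := uE _ cx.
  by rewrite ux leNgt divr_gt0// exprn_gt0.
by rewrite cube_measure// N0 lee_fin leNgt exprn_gt0// mulr_gt0.
Qed.

(** At x = 0 the phase is 1, so K1 - K2 integrates to 0 against phi(k)^* psi(p) for all dominated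
    phi and psi. Indicator functions times [gau] then give the integrals over all rectangles, and
    [integral_rect_eq0] applies. *)
Lemma kernel_unique K1 K2 : jbdd K1 -> jbdd K2 ->
  (forall phi, dominated phi -> forall Delta, measurable Delta ->
    cint Delta (kform K1 phi phi) = cint Delta (kform K2 phi phi)) ->
  \forall kp \ae (mu \x mu)%E, K1 kp.1 kp.2 = K2 kp.1 kp.2.
Proof.
move=> b1 b2 H.
pose d k p := K1 k p - K2 k p.
have bd : jbdd d.
  have [m1 [M1 M10 k1]] := b1; have [m2 [M2 M20 k2]] := b2.
  split; first exact: cmeasB.
  exists (M1 + M2); first exact: addr_ge0.
  by move=> k p; rewrite (le_trans (le_normcD _ _))// normcN lerD.
have quad phi : dominated phi -> kform d phi phi 0 = 0.
  move=> dp; have [mp _] := dp.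
  apply: cint_cube_eq0.
  - by apply: cmeas_kform => //; case: bd.
  - exact: kform_bounded.
  - exact: kform_lip.
  move=> Delta mD oo.
  apply: etrans (cint_mkcond Delta _) _.
  have iu : rint (\1_Delta : R3 R -> R) by exact: rint_indic.
  (* The densities are bounded, hence integrable over the set Delta of finite measure, and their
     difference may be integrated termwise. *)
  have i1 K : jbdd K -> L1 (fun x => (\1_Delta x)%:C * kform K phi phi x).
    move=> bK; have [M kM] := kform_bounded bK dp dp.
    have mk : cmeas (kform K phi phi) := cmeas_kform (proj1 bK) mp mp.
    have := L1_bmul (L1_real iu) mk kM.
    by congr Lpow; apply/funext => x; rewrite mulrC.
  transitivity (cint setT (fun x => (\1_Delta x)%:C * kform K1 phi phi x -
      (\1_Delta x)%:C * kform K2 phi phi x)).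
    by congr cint; apply/funext => x; rewrite (kformB x b1 b2 dp dp) mulrBr.
  rewrite (cintB (i1 _ b1) (i1 _ b2)); apply/eqP; rewrite subr_eq0; apply/eqP.
  exact: etrans (esym (cint_mkcond Delta (kform K1 phi phi)))
    (etrans (H _ dp _ mD) (cint_mkcond Delta (kform K2 phi phi))).
have bil phi psi : dominated phi -> dominated psi -> kform d phi psi 0 = 0.
  apply: (@polar0 R (wave R) (@dominated R) (fun f g p => f p + g p)
    (fun c f p => c * f p) (fun f g => kform d f g 0)) => //.
  - by move=> f g; exact: domD.
  - by move=> c f; exact: domZ.
  - move=> f g h df dg dh; rewrite !kformE -dintD; [|exact: gdom_kint|exact: gdom_kint].
    by congr dint; apply/funext => q; rewrite /kint conjcD; ring.
  - move=> f g h df dg dh; rewrite !kformE -dintD; [|exact: gdom_kint|exact: gdom_kint].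
    by congr dint; apply/funext => q; rewrite /kint; ring.
  - move=> c f g df dg; rewrite !kformE -dintZ; last exact: gdom_kint.
    by congr dint; apply/funext => q; rewrite /kint conjcM; ring.
  - move=> c f g df dg; rewrite !kformE -dintZ; last exact: gdom_kint.
    by congr dint; apply/funext => q; rewrite /kint; ring.
have [md [M M0 dM]] := bd.
(* Stated for both the real and the imaginary part, in whose place [r] stands. *)
have part (r : R[i] -> R) : measurable_fun setT (fun kp : R3 R * R3 R => r (d kp.1 kp.2)) ->
    (forall z, `|r z| <= Normc.normc z) ->
    (forall (c : R) z, r (c%:C * z) = c * r z) ->
    (forall G, dint G = 0 -> \int[mu]_p (\int[mu]_k r (G (p, k))) = 0) ->
    \forall kp \ae (mu \x mu)%E, r (d kp.1 kp.2) = 0.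
  move=> mr rn rZ rint0.
  pose h (q : R3 R * R3 R) := r (d q.1 q.2) * (gau q.1 * gau q.2).
  have mgg : measurable_fun setT (fun q : R3 R * R3 R => gau q.1 * gau q.2).
    apply: measurable_funM.
      exact: (measurableT_comp (@measurable_gau R) measurable_fst).
    exact: (measurableT_comp (@measurable_gau R) measurable_snd).
  have mh : measurable_fun setT h by exact: measurable_funM.
  have hle q : `|h q| <= M * gau q.1 * gau q.2.
    rewrite /h normrM -mulrA ler_pM//; last by rewrite ger0_norm ?mulr_ge0 ?gau_ge0.
    by apply: le_trans (rn _) (dM _ _).
  have ih : (mu \x mu)%E.-integrable setT (EFin \o h).
    have i := integrable_prod (m1 := mu) (m2 := mu) (rintZ M (@rint_gau R)) (@rint_gau R).
    apply: (le_integrable measurableT) i; first exact/measurable_EFinP.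
    by move=> q _ /=; rewrite lee_fin (le_trans (hle q))// ler_norm.
  have : h = (fun=> 0) %[ae (mu \x mu)%E].
    apply: integral_rect_eq0 => // A B mA mB.
    have iA : (mu \x mu)%E.-integrable setT (EFin \o (fun q => h q * \1_(A `*` B) q)).
      apply: (le_integrable measurableT) ih.
        apply/measurable_EFinP; apply: measurable_funM => //.
        by apply: measurable_indic; exact: measurableX.
      move=> q _ /=; rewrite lee_fin normrM ler_piMr// indicE.
      by case: (_ \in _); rewrite ?normr1 ?normr0.
    rewrite integral_mkcond.
    transitivity (\int[mu \x mu]_q (h q * \1_(A `*` B) q)%:E)%E.
      apply: eq_integral => q _; rewrite patchE indicE; case: ifP => _.
        by rewrite mulr1.
      by rewrite mulr0.
    rewrite -[LHS](fineK (integrable_fin_num measurableT iA)).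
    have fin p : (\int[mu]_k (h (k, p) * \1_(A `*` B) (k, p))%:E)%E \is a fin_num.
      have i := rintZ (M * gau p) (@rint_gau R).
      have : rint (fun k => h (k, p) * \1_(A `*` B) (k, p)).
        apply: (rint_le _ i).
          have := measurable_int _ iA => /measurable_EFinP m.
          exact: (measurableT_comp m (measurable_pair2 p)).
        move=> k; rewrite normrM (le_trans (ler_piMr _ _))//.
          by rewrite indicE; case: (_ \in _); rewrite ?normr1 ?normr0.
        by rewrite (le_trans (hle _))//= mulrAC.
      exact: integrable_fin_num.
    have bA : dominated (fun k : R3 R => (\1_A k)%:C * (gau k)%:C).
      by have [mi [N iN]] := bmeas_indic mA; exact: (dom_gaum mi iN).
    have bB : dominated (fun k : R3 R => (\1_B k)%:C * (gau k)%:C).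
      by have [mi [N iN]] := bmeas_indic mB; exact: (dom_gaum mi iN).
    have inner p k : r (kint d (fun k => (\1_A k)%:C * (gau k)%:C)
        (fun k => (\1_B k)%:C * (gau k)%:C) 0 (p, k)) = h (k, p) * \1_(A `*` B) (k, p).
      rewrite -[kint _ _ _ _ _]/(d k p * expi (dot3 (p - k) 0) *
        ((\1_A k)%:C * (gau k)%:C)^*%C * ((\1_B p)%:C * (gau p)%:C)).
      rewrite dot3C dot30l expi0 mulr1 conjcM !conjc_real.
      transitivity (r (((\1_A k * gau k) * (\1_B p * gau p))%:C * d k p)).
        by congr r; rewrite !realCM; ring.
      rewrite rZ /h /= !indicE in_setX/=.
      by case: (k \in A); case: (p \in B); rewrite /= ?mul1r ?mul0r ?mulr0 ?mulr1//; ring.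
    (* The function [h] takes its arguments in the order (k, p), while [kform] integrates over k
       inside and over p outside; hence the iterated integral with the second variable outside. *)
    congr EFin; rewrite -(integral21_prod_meas1 iA) /fubini_G.
    have := rint0 (kint d (fun k => (\1_A k)%:C * (gau k)%:C)
      (fun k => (\1_B k)%:C * (gau k)%:C) 0) (bil _ _ bA bB).
    move=> E1; apply: etrans E1; rewrite /Rintegral; congr fine.
    apply: eq_integral => p _; rewrite -[LHS]fineK; last exact: fin.
    by congr EFin; congr fine; apply: eq_integral => k _; rewrite inner.
  apply: filterS => q /= /(_ I) /eqP.
  by rewrite mulf_eq0 => /orP[/eqP//|]; rewrite gt_eqF// mulr_gt0 ?gau_gt0.
have [m1 m2] := md.
have h1 : \forall kp \ae (mu \x mu)%E, complex.Re (d kp.1 kp.2) = 0.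
  apply: (part (@complex.Re R)) => //; first exact: normc_Re.
    by move=> c z; rewrite cReM /= mul0r subr0.
  by move=> G /(congr1 (@complex.Re R)).
have h2 : \forall kp \ae (mu \x mu)%E, complex.Im (d kp.1 kp.2) = 0.
  apply: (part (@complex.Im R)) => //; first exact: normc_Im.
    by move=> c z; rewrite cImM /= mul0r addr0.
  by move=> G /(congr1 (@complex.Im R)).
apply: filterS2 h1 h2 => q r1 r2; apply/eqP; rewrite -subr_eq0; apply/eqP.
exact: cplx_eq.
Qed.

End kernel_uniqueness.

(** * Linearly independent components *)

Section matrix_integral.
Context {R : realType}.
Local Notation mu := (@leb3 R).
Local Notation rint h := (mu.-integrable setT (EFin \o h)).
Local Notation cmeas := (@cmeasurable R _ (R3 R) setT).
Local Notation L1 := (@Lpow R 1).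

Definition mint m n (A : R3 R -> 'M[R[i]]_(m, n)) : 'M[R[i]]_(m, n) :=
  \matrix_(i, j) cint setT (fun q => A q i j).

Definition L1m m n (A : R3 R -> 'M[R[i]]_(m, n)) := forall i j, L1 (fun q => A q i j).

Definition cmeasm m n (A : R3 R -> 'M[R[i]]_(m, n)) := forall i j, cmeas (fun q => A q i j).

Lemma mint_mull m n k (X : 'M[R[i]]_(k, m)) (A : R3 R -> 'M[R[i]]_(m, n)) : L1m A ->
  mint (fun q => X *m A q) = X *m mint A.
Proof.
move=> iA; apply/matrixP => i j; rewrite !mxE.
under [in LHS]eq_fun do rewrite mxE.
rewrite cint_sum; last by move=> l; exact: L1Z.
by apply: eq_bigr => l _; rewrite cintZ// mxE.
Qed.

Lemma mint_mulr m n k (X : 'M[R[i]]_(n, k)) (A : R3 R -> 'M[R[i]]_(m, n)) : L1m A ->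
  mint (fun q => A q *m X) = mint A *m X.
Proof.
move=> iA; apply/matrixP => i j; rewrite !mxE.
under [in LHS]eq_fun do rewrite mxE.
rewrite cint_sum; last by move=> l; under eq_fun do rewrite mulrC; exact: L1Z.
by apply: eq_bigr => l _; rewrite cintZr// mxE.
Qed.

Lemma L1m_mull m n k (X : 'M[R[i]]_(k, m)) (A : R3 R -> 'M[R[i]]_(m, n)) : L1m A ->
  L1m (fun q => X *m A q).
Proof.
move=> iA i j; under eq_fun do rewrite mxE.
by apply: L1_sum => l; exact: L1Z.
Qed.

Lemma mint_ae m n (A B : R3 R -> 'M[R[i]]_(m, n)) : cmeasm A -> cmeasm B ->
  (\forall q \ae mu, A q = B q) -> mint A = mint B.
Proof.
move=> mA mB AB; apply/matrixP => i j; rewrite !mxE; apply: cint_ae => //.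
by apply: filterS AB => q -> _.
Qed.

Lemma mint_rot m n (A : R3 R -> 'M[R[i]]_(m, n)) B : SU2 B -> cmeasm A ->
  mint (fun q => A (su2_rot B q)) = mint A.
Proof.
by move=> SB mA; apply/matrixP => i j; rewrite !mxE (cint_rot SB (mA i j)).
Qed.

Definition colw n (w : 'I_n -> wave R) (p : R3 R) : 'cV[R[i]]_n := \col_i w i p.

Definition indep n (w : 'I_n -> wave R) := forall c : 'rV[R[i]]_n,
  (\forall p \ae mu, c *m colw w p = 0) -> c = 0.

Lemma indep_mx n (w : 'I_n -> wave R) m (X Y : 'M[R[i]]_(m, n)) : indep w ->
  (\forall p \ae mu, X *m colw w p = Y *m colw w p) -> X = Y.
Proof.
move=> iw XY; apply/row_matrixP => i; apply/eqP; rewrite -subr_eq0; apply/eqP.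
apply: iw; apply: filterS XY => p E.
by rewrite mulmxBl -!row_mul E subrr.
Qed.

Lemma mul_colwE n (w : 'I_n -> wave R) m (X : 'M[R[i]]_(m, n)) p i :
  (X *m colw w p) i 0 = \sum_l X i l * w l p.
Proof. by rewrite mxE; apply: eq_bigr => l _; rewrite mxE. Qed.

Lemma gramkE n (w : 'I_n -> wave R) k p :
  gramk w k p = ((colw w k) ^t* *m colw w p) 0 0.
Proof. by rewrite mul_colwE; apply: eq_bigr => l _; rewrite !mxE. Qed.

Lemma gramk_mx n (w : 'I_n -> wave R) k p :
  (colw w k) ^t* *m colw w p = (gramk w k p)%:M.
Proof. by rewrite gramkE -mx11_scalar. Qed.

Lemma L1_gau (f : wave R) : bmeas f -> L1 (fun q => (gau q)%:C * f q).
Proof.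
move=> [mf [M fM]]; have := dom_L1 (dom_gaum mf fM).
by congr Lpow; apply/funext => q; rewrite mulrC.
Qed.

Lemma bmeasM (f g : wave R) : bmeas f -> bmeas g -> bmeas (fun q => f q * g q).
Proof.
move=> [mf [M fM]] [mg [N gN]]; split; first exact: cmeasM.
exists (M * N) => q; rewrite Normc.normcM ler_pM ?normc_ge0//.
Qed.

Lemma bmeasZ (c : R[i]) (f : wave R) : bmeas f -> bmeas (fun q => c * f q).
Proof.
move=> bf; apply: (@bmeasM (fun=> c)) => //; split; first exact: cmeas_cst.
by exists (Normc.normc c).
Qed.

Lemma bmeas_sum n (F : 'I_n -> wave R) : (forall l, bmeas (F l)) ->
  bmeas (fun q => \sum_l F l q).
Proof.
move=> bF; split; first by apply: cmeas_sum => l; case: (bF l).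
have /choice[M FM] : forall l, exists M : R, forall p, Normc.normc (F l p) <= M.
  by move=> l; case: (bF l).
exists (\sum_l M l) => p; apply: le_trans (normc_sum _) _.
by apply: ler_sum => l _; exact: FM.
Qed.

Lemma bmeas_rot (f : wave R) B : SU2 B -> bmeas f -> bmeas (fun q => f (su2_rot B q)).
Proof. by move=> SB [mf [M fM]]; split; [exact: cmeas_rot|exists M => q]. Qed.

(** The matrix of Gaussian weighted inner products of the components. It exists for bounded
    components, and for w = v it is a Gram matrix. *)
Definition gmx n (w v : 'I_n -> wave R) : 'M[R[i]]_n :=
  mint (fun q => (gau q)%:C *: (colw w q *m (colw v q) ^t*)).

Lemma outer_entry n (w v : 'I_n -> wave R) q i j :
  (colw w q *m (colw v q) ^t*) i j = w i q * (v j q)^*%C.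
Proof. by rewrite mxE big_ord1 !mxE. Qed.

Lemma L1m_gmx n (w v : 'I_n -> wave R) : (forall l, bmeas (w l)) -> (forall l, bmeas (v l)) ->
  L1m (fun q => (gau q)%:C *: (colw w q *m (colw v q) ^t*)).
Proof.
move=> bw bv i j; under eq_fun do rewrite mxE outer_entry.
by apply: L1_gau; apply: bmeasM => //; exact: bmeas_conj.
Qed.

Lemma gmx_sesqui n m (w : 'I_n -> wave R) (X : 'M[R[i]]_(m, n)) : (forall l, bmeas (w l)) ->
  X *m gmx w w *m X ^t* =
  mint (fun q => (gau q)%:C *: ((X *m colw w q) *m (X *m colw w q) ^t*)).
Proof.
move=> bw; have i := L1m_gmx bw bw.
rewrite /gmx -mint_mull// -mint_mulr; last exact: L1m_mull.
congr mint; apply/funext => q.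
by rewrite -scalemxAr -scalemxAl trmx_mul map_mxM !mulmxA.
Qed.

(** For a row u in the kernel, u G u^* is the integral of the Gaussian times |u w|^2, so u w = 0
    almost everywhere and u = 0. *)
Lemma gmx_unit n (w : 'I_n -> wave R) : (forall l, bmeas (w l)) -> indep w ->
  gmx w w \in unitmx.
Proof.
move=> bw iw; rewrite -row_free_unit -kermx_eq0; apply/rowV0P => u /sub_kermxP u0.
have := gmx_sesqui u bw; rewrite u0 mul0mx => /(congr1 (fun M : 'M[R[i]]_1 => M 0 0)).
rewrite !mxE => E; apply: iw.
have bu : bmeas (fun q => (u *m colw w q) 0 0).
  by under eq_fun do rewrite mul_colwE; apply: bmeas_sum => l; exact: bmeasZ.
pose h q := gau q * Normc.normc ((u *m colw w q) 0 0) ^+ 2.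
have E2 : \int[mu]_q h q = 0.
  apply: (@complexI R); rewrite -cint_real [RHS]E; congr cint; apply/funext => q.
  by rewrite /h realCM -mulJc !mxE big_ord1 !mxE [_ * _^*%C]mulrC.
have ih : rint h.
  have /L1P[_ + _] := L1_gau (bmeasM (bmeas_conj bu) bu).
  apply: eq_integrable => // q _ /=; congr EFin.
  by rewrite mulJc -realCM.
have h0 q : 0 <= h q by rewrite mulr_ge0 ?gau_ge0 ?sqr_ge0.
have := rint0_ae ih h0 E2; apply: filterS => q /(_ I) /eqP.
rewrite mulf_eq0 gt_eqF ?gau_gt0//= sqrf_eq0 normc_eq0 => /eqP z.
by apply/matrixP => i j; rewrite !ord1 z mxE.
Qed.

Lemma gmx_herm n (w : 'I_n -> wave R) : (forall l, bmeas (w l)) ->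
  (gmx w w) ^t* = gmx w w.
Proof.
move=> bw; apply/matrixP => i j; rewrite !mxE conjCE -cint_conj; last exact: L1m_gmx.
congr cint; apply/funext => q; rewrite !mxE !big_ord1 !mxE.
by rewrite !conjcM conjc_real !conjCE conjcK [X in _ * X]mulrC.
Qed.

End matrix_integral.

(** * Passage to independent components *)

Section reduction.
Context {R : realType}.
Local Notation mu := (@leb3 R).

Lemma ae_both (P : R3 R -> Prop) : (\forall p \ae mu, P p) ->
  \forall kp \ae (mu \x mu)%E, P kp.1 /\ P kp.2.
Proof.
move=> [N [mN N0 sN]].
exists ((N `*` setT) `|` (setT `*` N)); split.
- by apply: measurableU; exact: measurableX.
- apply/eqP; rewrite -measure_le0.
  rewrite (le_trans (measureU2 _ _ _))//; try exact: measurableX.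
  have eqle (x y : \bar R) : x = y -> (x <= y)%E by move=> ->.
  have h1 : (mu \x mu)%E (N `*` setT) = 0%E by rewrite leb33X// N0 mul0e.
  have h2 : (mu \x mu)%E (setT `*` N) = 0%E by rewrite leb33X// N0 mule0.
  rewrite -[leRHS]adde0; apply: leeD; [exact: (eqle _ _ h1)|exact: (eqle _ _ h2)].
- move=> [k p] /= /not_andP[nk|np]; [left|right]; split => //; exact: sN.
Qed.

(* Diagonalizing the Gram matrix and dropping its kernel makes the components
   linearly independent. *)
Lemma gramk_reduce n (f : 'I_n -> wave R) : (forall l, bmeas (f l)) ->
  exists m (w : 'I_m -> wave R), [/\ forall l, bmeas (w l), indep w &
    \forall kp \ae (mu \x mu)%E, gramk f kp.1 kp.2 = gramk w kp.1 kp.2].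
Proof.
move=> bf; set M := gmx f f.
have nM : M \is normalmx by apply/normalmxP; rewrite gmx_herm.
have /orthomx_spectralP ME := nM.
set P := spectralmx M in ME; set d := spectral_diag M in ME.
have uP : P \is unitarymx by exact: spectral_unitarymx.
have PU : P \in unitmx by exact: unitarymx_unit.
pose g (l : 'I_n) : wave R := fun p => (P *m colw f p) l 0.
have gE p : colw g p = P *m colw f p.
  by apply/matrixP => i j; rewrite ord1 [LHS]mxE.
have bg l : bmeas (g l).
  by rewrite /g; under eq_fun do rewrite mul_colwE; apply: bmeas_sum => k; exact: bmeasZ.
have Gg : gmx g g = diag_mx d.
  rewrite /gmx; under [X in mint X]eq_fun do rewrite gE.
  rewrite -gmx_sesqui// -/M ME -invmx_unitary// !mulmxA mulmxV// mul1mx.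
  by rewrite mulmxK.
have gramg k p : gramk g k p = gramk f k p.
  rewrite !gramkE !gE trmx_mul map_mxM -mulmxA (mulmxA (P ^t*)).
  by rewrite -invmx_unitary// mulVmx// mul1mx.
(* The rotated components are orthogonal for the weight, and the eigenvalue [d 0 i] is the weighted
   squared norm of [g i]. It vanishes exactly for the components that vanish almost everywhere. *)
have diagE i j : cint setT (fun q => (gau q)%:C * (g i q * (g j q)^*%C)) = d 0 i *+ (i == j).
  have := congr1 (fun X : 'M[R[i]]_n => X i j) Gg; rewrite !mxE => <-.
  by congr cint; apply/funext => q; rewrite mxE outer_entry.
pose S := [pred i | d 0 i != 0].
exists #|S|, (fun l => g (enum_val l)); split.
- by move=> l; exact: bg.
- move=> c c0; apply/matrixP => z j; rewrite ord1 [RHS]mxE.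
  have : cint setT (fun q => (gau q)%:C * ((\sum_l c 0 l * g (enum_val l) q) *
      (g (enum_val j) q)^*%C)) = 0.
    rewrite -[RHS](cint0 (R := R)); apply: cint_ae.
    + apply: L1_meas; apply: L1_gau; apply: bmeasM; last exact: bmeas_conj.
      by apply: bmeas_sum => l; exact: bmeasZ.
    + exact: cmeas_cst.
    + apply: filterS c0 => q /(congr1 (fun X : 'M[R[i]]_1 => X 0 0)).
      by rewrite mul_colwE mxE => -> _; rewrite mul0r mulr0.
  under [X in cint _ X]eq_fun do rewrite mulr_suml mulr_sumr.
  rewrite cint_sum; last first.
    move=> l; apply: L1_gau; apply: bmeasM; last exact: bmeas_conj.
    exact: bmeasZ.
  rewrite (bigD1 j)//= big1; last first.
    move=> l lj; under [X in cint _ X]eq_fun do rewrite -mulrA mulrCA.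
    rewrite cintZ; last by apply: L1_gau; apply: bmeasM => //; exact: bmeas_conj.
    by rewrite diagE (inj_eq enum_val_inj) (negbTE lj) mulr0.
  under [X in cint _ X]eq_fun do rewrite -mulrA mulrCA.
  rewrite cintZ; last by apply: L1_gau; apply: bmeasM => //; exact: bmeas_conj.
  rewrite diagE eqxx mulr1n addr0 => /eqP; rewrite mulf_eq0 => /orP[/eqP//|].
  by have := enum_valP j; rewrite inE => /negbTE ->.
have g0 : \forall p \ae mu, forall i, d 0 i == 0 -> g i p = 0.
  apply: filter_forall => i; have [di|di] := eqVneq (d 0 i) 0; last first.
    by apply: nearW.
  have E := diagE i i; rewrite di mul0rn in E.
  pose h q := gau q * Normc.normc (g i q) ^+ 2.
  have E2 : \int[mu]_q h q = 0.
    apply: (@complexI R); rewrite -cint_real -[RHS]E; congr cint; apply/funext => q.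
    by rewrite /h realCM -mulJc [_^*%C * _]mulrC.
  have ih : mu.-integrable setT (EFin \o h).
    have /L1P[_ + _] := L1_gau (bmeasM (bmeas_conj (bg i)) (bg i)).
    by apply: eq_integrable => // q _ /=; congr EFin; rewrite mulJc -realCM.
  have h0 q : 0 <= h q by rewrite mulr_ge0 ?gau_ge0 ?sqr_ge0.
  have := rint0_ae ih h0 E2; apply: filterS => q /(_ I) /eqP.
  by rewrite mulf_eq0 gt_eqF ?gau_gt0//= sqrf_eq0 normc_eq0 => /eqP z _.
apply: filterS (ae_both g0) => -[k p] /= [_ gp].
rewrite -gramg /gramk (bigID S)/= [X in _ + X]big1 ?addr0; last first.
  by move=> i; rewrite /= negbK => /gp ->; rewrite mulr0.
exact: (big_enum_val (A := S) (fun i => (g i k)^*%C * g i p)).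
Qed.

End reduction.

(** * The unitary representation attached to a kernel *)

Section covariance.
Context {R : realType}.
Local Notation mu := (@leb3 R).

Lemma ae_rot2 B (P : R3 R -> R3 R -> Prop) : SU2 B ->
  (\forall q \ae mu, \forall p \ae mu, P q p) ->
  \forall q \ae mu, \forall p \ae mu, P (su2_rot B q) (su2_rot B p).
Proof.
move=> SB H; have := ae_rot SB H; apply: filterS => q Hq.
exact: (ae_rot SB Hq).
Qed.

Lemma indep_sesqui n (w : 'I_n -> wave R) (X : 'M[R[i]]_n) : indep w ->
  (\forall q \ae mu, \forall p \ae mu, (colw w q)^t* *m X *m colw w p = 0) -> X = 0.
Proof.
move=> iw H.
have E : \forall q \ae mu, X ^t* *m colw w q = 0 *m colw w q.
  apply: filterS H => q Hq.
  have /(congr1 (fun Y : 'rV[R[i]]_n => Y ^t*)) : (colw w q)^t* *m X = 0.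
    by apply: (indep_mx iw); apply: filterS Hq => p; rewrite mul0mx.
  by rewrite trmx_mul map_mxM trmxCK trmx0 map_mx0 mul0mx.
have := indep_mx iw E => /(congr1 (fun Y : 'M[R[i]]_n => Y ^t*)).
by rewrite trmxCK trmx0 map_mx0.
Qed.

Lemma indep_ae n (w v : 'I_n -> wave R) :
  (\forall p \ae mu, colw w p = colw v p) -> indep w -> indep v.
Proof.
move=> wv iw c c0; apply: iw; apply: filterS2 wv c0 => p -> //.
Qed.

Lemma mulmx_conj_inv n (G D : 'M[R[i]]_n) (x : 'cV[R[i]]_n) : G \in unitmx ->
  invmx G *m D *m G *m (invmx G *m x) = invmx G *m (D *m x).
Proof. by move=> GU; rewrite -[LHS]mulmxA mulKVmx// mulmxA. Qed.

Section kernel_factor.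
Variables (K : R3 R -> R3 R -> R[i]) (n : nat) (w : 'I_n -> wave R).
Hypotheses (mK : jmeas K) (K1 : forall k p, Normc.normc (K k p) <= 1).
Hypothesis Krot : forall B k p, SU2 B -> K (su2_rot B k) (su2_rot B p) = K k p.
Hypotheses (bw : forall l, bmeas (w l)) (iw : indep w).
Hypothesis FR : \forall kp \ae (mu \x mu)%E, K kp.1 kp.2 = gramk w kp.1 kp.2.

Let bK p : bmeas (fun q => K q p).
Proof.
split; last by exists 1 => q.
by apply: (@jmeas_comp R K _ _ (fun q : R3 R => q) (fun=> p)).
Qed.

(** Its dependence on p is through K, whose invariance holds at every point, so that [W] inherits a
    transformation law without exceptional set. Almost everywhere it is G w. *)
Let W p : 'cV[R[i]]_n := mint (fun q => (gau q)%:C *: (K q p *: colw w q)).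

Let iW p : L1m (fun q => (gau q)%:C *: (K q p *: colw w q)).
Proof.
move=> i j; under eq_fun do rewrite !mxE.
by apply: L1_gau; apply: bmeasM.
Qed.

Let G := gmx w w.
Let wB B l : wave R := fun q => w l (su2_rot B q).
Let Nm B := gmx (wB B) w.

Let W_both B p : SU2 B -> (\forall q \ae mu, K q p = gramk w q p) ->
  mint (fun q => (gau q)%:C *: (K q p *: colw (wB B) q)) = Nm B *m colw w p.
Proof.
move=> SB H; have bB l : bmeas (wB B l) by apply: bmeas_rot.
rewrite /Nm /gmx -mint_mulr; last exact: L1m_gmx.
apply: mint_ae.
- move=> i j; under eq_fun do rewrite !mxE.
  by apply: L1_meas; apply: L1_gau; apply: bmeasM.
- move=> i j; under eq_fun do rewrite -scalemxAl -mulmxA gramk_mx mul_mx_scalar !mxE.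
  apply: L1_meas; apply: L1_gau; apply: bmeasM => //.
  by apply: bmeas_sum => l; under eq_fun do rewrite mulrC; apply: bmeasZ; exact: bmeas_conj.
- apply: filterS H => q ->.
  by rewrite -scalemxAl -mulmxA gramk_mx mul_mx_scalar.
Qed.

Let W_rot B p : SU2 B ->
  W (su2_rot B p) = mint (fun q => (gau q)%:C *: (K q p *: colw (wB B) q)).
Proof.
move=> SB; rewrite /W -[LHS](mint_rot SB); last first.
  by move=> i j; exact: L1_meas (iW _ i j).
by congr mint; apply/funext => q; rewrite gau_rot// Krot.
Qed.

Let FRae : \forall p \ae mu, \forall q \ae mu, K q p = gramk w q p.
Proof. exact: (ae_prod2 FR). Qed.

Let GU : G \in unitmx. Proof. exact: gmx_unit. Qed.

Let W_ae : \forall p \ae mu, W p = G *m colw w p.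
Proof.
apply: filterS FRae => p H; rewrite -[p in LHS]su2_rot1 (W_rot _ SU21).
rewrite (W_both SU21 H).
have -> : Nm 1%:M = G.
  rewrite /Nm /G; suff -> : wB 1%:M = w by [].
  by apply/funext => l; apply/funext => q; rewrite /wB su2_rot1.
by [].
Qed.

Let D B := invmx G *m Nm B.
Let wt l : wave R := fun p => (invmx G *m W p) l 0.

Let colwt p : colw wt p = invmx G *m W p.
Proof. by apply/matrixP => i j; rewrite ord1 mxE. Qed.

Let wt_ae : \forall p \ae mu, colw wt p = colw w p.
Proof. by apply: filterS W_ae => p H; rewrite colwt H mulKmx. Qed.

(** W(B.p) has two values: G w(B.p), and Nm(B) w(p) after the rotation of the integration variable.
    This also explains the choice of [D]. *)
Let w_rot_ae B : SU2 B -> \forall p \ae mu, colw w (su2_rot B p) = D B *m colw w p.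
Proof.
move=> SB; apply: filterS2 (ae_rot SB W_ae) FRae => p H1 H2.
by rewrite -mulmxA -W_both// -W_rot// H1 mulKmx.
Qed.

(** Using [w_rot_ae] under the integral sign gives the law at every p, with the conjugate G^-1 D(B)
    G in place of D(B). By independence the two matrices coincide, since almost everywhere [wt] is
    [w]. *)
Let wt_rot B p : SU2 B -> colw wt (su2_rot B p) = D B *m colw wt p.
Proof.
move=> SB.
have E q : colw wt (su2_rot B q) = invmx G *m D B *m G *m colw wt q.
  have -> : colw wt (su2_rot B q) = invmx G *m (D B *m W q); last first.
    rewrite colwt; move: (D B) (W q) => X x {SB}; exact/esym/mulmx_conj_inv.
  rewrite colwt (W_rot _ SB) -(mint_mull (D B) (iW q)).
  suff -> : mint (fun r => (gau r)%:C *: (K r q *: colw (wB B) r)) =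
            mint (fun r => D B *m ((gau r)%:C *: (K r q *: colw w r))) by [].
  apply: mint_ae.
  - move=> i j; under eq_fun do rewrite !mxE.
    by apply: L1_meas; apply: L1_gau; apply: bmeasM => //; exact: bmeas_rot.
  - by move=> i j; exact/L1_meas/L1m_mull/iW.
  - apply: filterS (w_rot_ae SB) => r Er.
    by rewrite -!scalemxAr -Er.
suff -> : D B = invmx G *m D B *m G by exact: E.
apply: (indep_mx iw); apply: filterS2 (filterI (ae_rot SB wt_ae) wt_ae) (w_rot_ae SB).
move=> q [H1 H2] H3; apply: (etrans (esym H3)); apply: (etrans (esym H1)).
exact: etrans (E q) (congr1 (mulmx _) H2).
Qed.

Let bwt l : bmeas (wt l).
Proof.
rewrite /wt; under eq_fun do rewrite mxE.
apply: bmeas_sum => k; apply: bmeasZ.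
have -> : (fun p => W p k 0) = (fun p => cint setT (fun q => (gau q)%:C * (K q p * w k q))).
  by apply/funext => p; rewrite !mxE; congr cint; apply/funext => q; rewrite !mxE.
have [mw [M wM]] := bw k; have M0 : 0 <= M := le_trans (normc_ge0 _) (wM 0).
have bnd p q : Normc.normc ((gau q)%:C * (K q p * w k q)) <= M * gau q.
  rewrite !Normc.normcM normc_real ger0_norm ?gau_ge0// mulrC ler_wpM2r ?gau_ge0//.
  by rewrite (le_trans _ (wM q))// ler_piMl ?normc_ge0.
split.
  apply: (cmeas_cint (F := fun pq => (gau pq.2)%:C * (K pq.2 pq.1 * w k pq.2))).
  apply: cmeasM; first by apply: cmeas_real; apply: (measurableT_comp measurable_gau).
  apply: cmeasM; last exact: (cmeas_comp mw measurable_snd).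
  by apply: jmeas_comp mK _ _; [exact: measurable_snd|exact: measurable_fst].
exists (2 * \int[mu]_q (M * gau q)) => p; apply: normc_cint.
- by apply: L1_meas; apply: L1_gau; exact: bmeasM.
- by apply: rintZ; exact: rint_gau.
- by move=> q; exact: bnd.
Qed.

(* The linear independence of the components turns the invariance of [K] into
   a unitary representation. *)
Lemma kernel_factor_rot : exists (D : 'M[R[i]]_2 -> 'M[R[i]]_n) (v : 'I_n -> wave R),
  [/\ forall l, bmeas (v l), (\forall p \ae mu, colw v p = colw w p),
      (forall B p, SU2 B -> colw v (su2_rot B p) = D B *m colw v p),
      (forall A B, SU2 A -> SU2 B -> D (A *m B) = D A *m D B) &
      forall B, SU2 B -> D B \is unitarymx].
Proof.
have iwt : indep wt.
  by apply: indep_ae iw; apply: filterS wt_ae => p ->.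
exists D, wt; split=> //.
- move=> A B SA SB; apply: (indep_mx iwt); apply: nearW => p.
  by rewrite -wt_rot ?su2_rotM ?wt_rot ?mulmxA//; exact: SU2M.
- move=> B SB; apply/unitarymxP; apply: mulmx1C.
  apply/eqP; rewrite -subr_eq0; apply/eqP; apply: (indep_sesqui iwt).
  have Kt : \forall q \ae mu, \forall p \ae mu, K q p = gramk wt q p.
    apply: filterS2 (ae_prod1 FR) wt_ae => q H Hq.
    by apply: filterS2 H wt_ae => p /= -> Hp; rewrite !gramkE Hq Hp.
  apply: filterS2 Kt (ae_rot2 SB Kt) => q H1 H2.
  apply: filterS2 H1 H2 => p E1 E2.
  rewrite mulmxBr mulmxBl mulmx1 gramk_mx -E1.
  have -> : (colw wt q) ^t* *m ((D B) ^t* *m D B) *m colw wt p =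
            (colw wt (su2_rot B q)) ^t* *m colw wt (su2_rot B p).
    rewrite (wt_rot q SB) (wt_rot p SB); move: (D B) (colw wt q) (colw wt p) => X x y.
    by rewrite trmx_mul map_mxM !mulmxA.
  by rewrite gramk_mx -E2 Krot// subrr.
Qed.

End kernel_factor.
End covariance.

(** * Lipschitz dependence of rotations on the matrix *)

Section rotation_estimate.
Context {R : realType}.
Local Notation normc := (@Normc.normc R).

Lemma pauli_le (p : R3 R) i j : normc (pauli p i j) <= nrm p.
Proof.
have H (a b : R) : a ^+ 2 + b ^+ 2 <= dot3 p p -> normc (a +i* b) <= nrm p.
  by move=> ab; rewrite -ler_sqr ?nnegrE ?normc_ge0 ?nrm_ge0// normc_sqr nrm_sqr.
have := sqr_ge0 p.1.1; have := sqr_ge0 p.1.2; have := sqr_ge0 p.2.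
rewrite !mxE /dot3 => h1 h2 h3.
by case: ifP => _; case: ifP => _; apply: H; rewrite /dot3 ?sqrrN ?expr0n/=; lra.
Qed.

Lemma SU2_entry B i j : SU2 B -> normc (B i j) <= 1.
Proof.
move=> /SU2P[a [b [/unitqE ab ->]]].
have H (z : R[i]) : complex.Re z ^+ 2 + complex.Im z ^+ 2 <= 1 -> normc z <= 1.
  by move=> h; rewrite -ler_sqr ?nnegrE ?normc_ge0// normc_sqr expr1n.
have := sqr_ge0 (complex.Re a); have := sqr_ge0 (complex.Im a).
have := sqr_ge0 (complex.Re b); have := sqr_ge0 (complex.Im b).
move=> h1 h2 h3 h4; rewrite mxE; case: ifP => _; case: ifP => _.
- by apply: H; lra.
- by apply: H; case: (b) ab h1 h2 => b1 b2 /= *; rewrite ?sqrrN; lra.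
- by apply: H; lra.
- by rewrite normc_conj; apply: H; lra.
Qed.

Lemma mul3_entry_le (X Y Z : 'M[R[i]]_2) (x y z : R) i j :
  (forall i j, normc (X i j) <= x) -> (forall i j, normc (Y i j) <= y) ->
  (forall i j, normc (Z i j) <= z) -> normc ((X *m Y *m Z) i j) <= 4 * (x * y * z).
Proof.
move=> hX hY hZ; rewrite !mxE.
apply: le_trans (normc_sum _) _.
apply: (@le_trans _ _ (\sum_(k < 2) 2 * (x * y * z))); last first.
  by rewrite sumr_const card_ord; lra.
apply: ler_sum => k _; rewrite Normc.normcM !mxE mulrA.
apply: ler_pM; rewrite ?normc_ge0//.
apply: le_trans (normc_sum _) _.
apply: (@le_trans _ _ (\sum_(l < 2) x * y)); last first.
  by rewrite sumr_const card_ord; lra.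
by apply: ler_sum => l _; rewrite Normc.normcM ler_pM ?normc_ge0.
Qed.

(** The difference of B' X B'^* and B X B^* is a sum of two products with a factor B' - B, each with
    entries at most 4 d |p|. The coordinates are parts of two entries bounded by 8 d |p|, and the
    sum of their squares is at most twice the square of this bound. *)
Lemma su2_rot_lip B B' d (p : R3 R) : SU2 B -> SU2 B' ->
  (forall i j, normc (B' i j - B i j) <= d) ->
  nrm (su2_rot B' p - su2_rot B p) <= 16 * d * nrm p.
Proof.
move=> SB SB' hd.
have d0 : 0 <= d := le_trans (normc_ge0 _) (hd 0 0).
pose X := (B' - B) *m pauli p *m B' ^t* + B *m pauli p *m (B' - B) ^t*.
have XE : B' *m pauli p *m B' ^t* - B *m pauli p *m B ^t* = X.
  rewrite /X !mulmxBl linearB/= map_mxB mulmxBr addrA; congr (_ - _).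
  by rewrite subrK.
have hX i j : normc (X i j) <= 8 * d * nrm p.
  rewrite mxE; apply: le_trans (le_normcD _ _) _.
  have h1 : normc (((B' - B) *m pauli p *m B' ^t*) i j) <= 4 * (d * nrm p * 1).
    apply: mul3_entry_le => k l; first by rewrite !mxE.
      exact: pauli_le.
    by rewrite !mxE conjCE normc_conj SU2_entry.
  have h2 : normc ((B *m pauli p *m (B' - B) ^t*) i j) <= 4 * (1 * nrm p * d).
    apply: mul3_entry_le => k l; first exact: SU2_entry.
      exact: pauli_le.
    by rewrite !mxE conjCE normc_conj.
  by apply: le_trans (lerD h1 h2) _; lra.
have c1 : (su2_rot B' p - su2_rot B p).1.1 = complex.Re (X 1 0).
  by rewrite -XE /su2_rot/= !mxE; case: (\sum_j _) => ? ?; case: (\sum_j _) => ? ?.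
have c2 : (su2_rot B' p - su2_rot B p).1.2 = complex.Im (X 1 0).
  by rewrite -XE /su2_rot/= !mxE; case: (\sum_j _) => ? ?; case: (\sum_j _) => ? ?.
have c3 : (su2_rot B' p - su2_rot B p).2 = complex.Re (X 0 0).
  by rewrite -XE /su2_rot/= !mxE; case: (\sum_j _) => ? ?; case: (\sum_j _) => ? ?.
rewrite -ler_sqr ?nnegrE ?mulr_ge0 ?nrm_ge0// nrm_sqr /dot3 c1 c2 c3.
have e1 : normc (X 1 0) ^+ 2 <= (8 * d * nrm p) ^+ 2.
  by rewrite ler_sqr ?nnegrE ?mulr_ge0 ?nrm_ge0 ?normc_ge0.
have e2 : normc (X 0 0) ^+ 2 <= (8 * d * nrm p) ^+ 2.
  by rewrite ler_sqr ?nnegrE ?mulr_ge0 ?nrm_ge0 ?normc_ge0.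
rewrite !normc_sqr in e1 e2; have := sqr_ge0 (complex.Im (X 0 0)).
have := sqr_ge0 (8 * d * nrm p).
have -> : 16 * d * nrm p = 2 * (8 * d * nrm p) by lra.
rewrite -!expr2 exprMn; lra.
Qed.

End rotation_estimate.

Lemma normc_gmx_integrandB {R : realType} n (a b v : 'I_n -> wave R) q i j :
  Normc.normc (((gau q)%:C *: (colw a q *m (colw v q) ^t*)) i j -
               ((gau q)%:C *: (colw b q *m (colw v q) ^t*)) i j) =
  gau q * (Normc.normc (a i q - b i q) * Normc.normc (v j q)).
Proof.
have E (c : 'I_n -> wave R) : ((gau q)%:C *: (colw c q *m (colw v q) ^t*)) i j =
    (gau q)%:C * (c i q * (v j q)^*%C) by rewrite mxE outer_entry.
by rewrite !E -mulrBr -mulrBl !Normc.normcM normc_real ger0_norm ?gau_ge0// normc_conj.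
Qed.

(** * Continuity of the representation *)

Section fourier_continuity.
Context {R : realType} (F F' : wave R -> wave R).
Hypothesis hF : is_fourier F F'.
Local Notation mu := (@leb3 R).
Local Notation L1 := (@Lpow R 1).
Local Notation normc := (@Normc.normc R).

Lemma ft_eq0 f : L1 f -> L2 f ->
  (\forall b \ae mu, ft f b = 0) -> f = (fun=> 0) %[ae mu].
Proof.
move=> f1 f2 H; apply: ip0_ae => //; rewrite -(fourier_isom hF)//.
have Ff0 : F f = (fun=> 0) %[ae mu].
  by apply: filterS2 (fourier_ker hF f1 f2) H => b E Z _; rewrite E// -/(ft f b) Z mulr0.
rewrite (ip_aer _ _ _ Ff0); try exact/L2_meas/(F_L2 hF); last exact: cmeas_cst.
by rewrite /ip; under eq_fun do rewrite mulr0; rewrite cint0.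
Qed.

Variables (n : nat) (w : 'I_n -> wave R) (D : 'M[R[i]]_2 -> 'M[R[i]]_n).
Hypotheses (bw : forall l, bmeas (w l)) (iw : indep w).
Hypothesis w_rot : forall B p, SU2 B -> colw w (su2_rot B p) = D B *m colw w p.

Let u l : wave R := fun q => w l q * (gau q)%:C.
Let v l : wave R := ft (u l).

Let du l : dominated (u l).
Proof. by have [mw [M wM]] := bw l; exact: dom_gaum mw wM. Qed.

Let iv b : L1m (fun q => expi (- dot3 b q) *: ((gau q)%:C *: colw w q)).
Proof.
move=> i j; under eq_fun do rewrite !mxE.
apply: L1_phase; first by apply: measurable_funN; exact: measurable_phase.
exact: L1_gau.
Qed.

Let vE b : colw v b = mint (fun q => expi (- dot3 b q) *: ((gau q)%:C *: colw w q)).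
Proof.
apply/matrixP => i j; rewrite !mxE; congr cint; apply/funext => q.
by rewrite !mxE [_ * w i q]mulrC.
Qed.

Let v_rot B b : SU2 B -> colw v (su2_rot B b) = D B *m colw v b.
Proof.
move=> SB; rewrite vE -[LHS](mint_rot SB); last first.
  by move=> i j; exact: L1_meas (iv _ i j).
rewrite vE -mint_mull; last exact: iv.
congr mint; apply/funext => q.
by rewrite su2_rot_dot// gau_rot// w_rot// !scalemxAr.
Qed.

Let bv l : bmeas (v l).
Proof.
split; first by apply: cmeas_ft; exact: L1_meas (dom_L1 (du l)).
have u1 := dom_L1 (du l).
exists (2 * \int[mu]_x (normc (u l x))) => x; apply: normc_cint.
- apply: L1_meas; apply: L1_phase => //.
  by apply: measurable_funN; exact: measurable_phase.
- exact: L1_normc.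
- by move=> p; rewrite Normc.normcM normc_expi mul1r.
Qed.

(** A linear relation between the v_l says that the Fourier integral of the same combination of the
    w_l times the Gaussian vanishes; injectivity carries the relation back to [w]. *)
Let indep_v : indep v.
Proof.
move=> c c0; apply: iw.
pose f : wave R := fun q => (c *m colw w q) 0 0 * (gau q)%:C.
have bf : bmeas (fun q => (c *m colw w q) 0 0).
  by under eq_fun do rewrite mul_colwE; apply: bmeas_sum => l; exact: bmeasZ.
have df : dominated f by have [mf [M fM]] := bf; exact: dom_gaum mf fM.
have ftf b : ft f b = (c *m colw v b) 0 0.
  rewrite vE -mint_mull; last exact: iv.
  rewrite mxE; congr cint; apply/funext => q.
  by rewrite /f -!scalemxAr !mxE [_ * (gau q)%:C]mulrC.
have f0 : f = (fun=> 0) %[ae mu].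
  apply: ft_eq0; [exact: dom_L1|exact: dom_L2|].
  by apply: filterS c0 => b E; rewrite ftf E mxE.
apply: filterS f0 => q /(_ I) /eqP; rewrite mulf_eq0 => /orP[/eqP E|].
  by apply/matrixP => i j; rewrite !ord1 E mxE.
by rewrite (inj_eq (@complexI R) _ 0) gt_eqF ?gau_gt0.
Qed.

Let v_lip : exists2 L : R, 0 <= L & forall l b b', normc (v l b' - v l b) <= L * nrm (b' - b).
Proof.
have /choice[C hC] : forall l, exists C : R, 0 <= C /\ forall p, normc (u l p) <= C * gau p.
  by move=> l; have [_ [C C0 uC]] := du l; exists C.
pose C0 := \sum_l C l; have C00 : 0 <= C0 by apply: sumr_ge0 => l _; case: (hC l).
have uC l p : normc (u l p) <= C0 * gau p.
  have [_ /(_ p) h] := hC l; apply: le_trans h _; rewrite ler_wpM2r ?gau_ge0//.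
  rewrite /C0 (bigD1 l)//= lerDl; apply: sumr_ge0 => k _; by case: (hC k).
exists (4 * C0 * \int[mu]_x gauw x).
  by rewrite !mulr_ge0//; apply: Rintegral_ge0 => x _; exact: gauw_ge0.
move=> l b b'; rewrite /v /ft -cintB; last 2 first.
- apply: L1_phase; [|exact/dom_L1/du].
  by apply: measurable_funN; exact: measurable_phase.
- apply: L1_phase; [|exact/dom_L1/du].
  by apply: measurable_funN; exact: measurable_phase.
have -> : 4 * C0 * (\int[mu]_x gauw x) * nrm (b' - b) =
    2 * \int[mu]_x ((2 * C0 * nrm (b' - b)) * gauw x).
  by rewrite RintegralZl//; [lra|exact: rint_gauw].
apply: normc_cint.
- apply: L1_meas; apply: L1B; apply: L1_phase; try exact/dom_L1/du;
  by apply: measurable_funN; exact: measurable_phase.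
- by apply: rintZ; exact: rint_gauw.
- move=> q; rewrite -mulrBl Normc.normcM.
  apply: (@le_trans _ _ ((2 * `|dot3 (b' - b) q|) * (C0 * gau q))).
    apply: ler_pM; rewrite ?normc_ge0 ?uC//.
    apply: le_trans (expi_lip _ _) _; rewrite ler_pM2l//.
    by rewrite dot3Bl -opprB normrN opprK [X in `|X| <= _]addrC.
  apply: (@le_trans _ _ ((2 * (nrm (b' - b) * nrm q)) * (C0 * gau q))).
    by rewrite ler_wpM2r ?mulr_ge0 ?gau_ge0// ler_pM2l// dot3_CS.
  have -> : 2 * (nrm (b' - b) * nrm q) * (C0 * gau q) =
            (2 * C0 * nrm (b' - b)) * (nrm q * gau q) by lra.
  by rewrite ler_wpM2l ?mulr_ge0 ?nrm_ge0// nrm_gau.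
Qed.

Let vB B l : wave R := fun b => v l (su2_rot B b).

(** As [gmx v v] is invertible, this recovers D(B) from the right hand side, where B enters only
    through the Lipschitz functions v_l. *)
Let D_gmx B : SU2 B -> D B *m gmx v v = gmx (vB B) v.
Proof.
move=> SB; rewrite /gmx -mint_mull; last exact: L1m_gmx.
congr mint; apply/funext => b; rewrite -scalemxAr mulmxA; congr (_ *: (_ *m _)).
exact/esym/v_rot.
Qed.

(* The Fourier transform of [gau * w] is a Lipschitz continuous family
   transforming under [D], which can be recovered from it. *)
Lemma covariant_family_cont B : SU2 B -> forall e : R, 0 < e ->
  exists2 d : R, 0 < d & forall B', SU2 B' ->
    (forall i j, normc (B' i j - B i j) < d) ->
    forall i j, normc (D B' i j - D B i j) < e.
Proof.
move=> SB e e0; have [L L0 vL] := v_lip.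
have /choice[Mv hMv] : forall l, exists M : R, forall p, normc (v l p) <= M.
  by move=> l; have [_] := bv l.
have Mv0 l : 0 <= Mv l := le_trans (normc_ge0 _) (hMv l 0).
pose M := \sum_l Mv l; have M0 : 0 <= M by apply: sumr_ge0.
have vM l p : normc (v l p) <= M.
  by apply: le_trans (hMv l p) _; rewrite /M (bigD1 l)//= lerDl; apply: sumr_ge0.
set J := \int[mu]_x gauw x.
have J0 : 0 <= J by apply: Rintegral_ge0 => x _; exact: gauw_ge0.
have GU : gmx v v \in unitmx by exact: gmx_unit.
pose G := gmx v v; rewrite -/G in GU.
pose N := \sum_i \sum_j normc (invmx G i j).
have N0 : 0 <= N by do 2![apply: sumr_ge0 => ? _]; exact: normc_ge0.
(* By [su2_rot_lip] the integrands differ by at most gau(q) L 16 d |q| M, and [gau] absorbs |q|; the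
   factor 2 of [normc_cint] makes it 32. *)
have hG B' d i j : SU2 B' -> (forall i j, normc (B' i j - B i j) <= d) ->
    normc ((D B' *m G - D B *m G) i j) <= 32 * L * M * J * d.
  move=> SB' hd; have d0 : 0 <= d := le_trans (normc_ge0 _) (hd 0 0).
  rewrite /G (D_gmx SB') (D_gmx SB) !mxE -cintB; [|exact: L1m_gmx (fun l => bmeas_rot SB' (bv l)) bv i j
                        |exact: L1m_gmx (fun l => bmeas_rot SB (bv l)) bv i j].
  have -> : 32 * L * M * J * d = 2 * \int[mu]_x ((16 * L * M * d) * gauw x).
    by rewrite RintegralZl//; [rewrite -/J; lra|exact: rint_gauw].
  apply: normc_cint.
  - apply: L1_meas; apply: L1B.
      exact: L1m_gmx (fun l => bmeas_rot SB' (bv l)) bv i j.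
    exact: L1m_gmx (fun l => bmeas_rot SB (bv l)) bv i j.
  - by apply: rintZ; exact: rint_gauw.
  - move=> q.
    rewrite normc_gmx_integrandB.
    apply: (@le_trans _ _ (gau q * ((L * (16 * d * nrm q)) * M))).
      rewrite ler_wpM2l ?gau_ge0//; apply: ler_pM; rewrite ?normc_ge0//.
      apply: le_trans (vL i _ _) _; rewrite ler_wpM2l//; exact: su2_rot_lip.
    have -> : gau q * (L * (16 * d * nrm q) * M) = (16 * L * M * d) * (nrm q * gau q) by lra.
    by rewrite ler_wpM2l ?mulr_ge0// nrm_gau.
pose C := 32 * L * M * J * N.
have C0 : 0 <= C by rewrite !mulr_ge0.
(* The summand 1 keeps the quotient defined for C = 0 and the final inequality strict. *)
exists (e / (C + 1)); first by rewrite divr_gt0// ltr_wpDl.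
move=> B' SB' hd i j; set d := e / (C + 1) in hd.
have hd' k l : normc (B' k l - B k l) <= d by exact: ltW.
have -> : D B' i j - D B i j = ((D B' *m G - D B *m G) *m invmx G) i j.
  by move: G GU (D B') (D B) {hG N N0 C C0 d hd hd'} => X XU Y Z; rewrite -mulmxBl mulmxK// !mxE.
rewrite mxE; apply: le_lt_trans (normc_sum _) _.
apply: (@le_lt_trans _ _ (\sum_k (32 * L * M * J * d) * normc (invmx G k j))).
  apply: ler_sum => k _; rewrite Normc.normcM ler_wpM2r ?normc_ge0//; exact: hG.
rewrite -mulr_sumr.
apply: (@le_lt_trans _ _ (32 * L * M * J * d * N)).
  have d0 : 0 <= d := le_trans (normc_ge0 _) (hd' 0 0).
  have A0 : 0 <= 32 * L * M * J by rewrite !mulr_ge0.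
  apply: ler_wpM2l; first exact: mulr_ge0 A0 d0.
  rewrite /N; apply: ler_sum => k _.
  by rewrite (bigD1 j)//= lerDl; apply: sumr_ge0 => l _; exact: normc_ge0.
have -> : 32 * L * M * J * d * N = C * d by rewrite /C; lra.
by rewrite /d mulrCA gtr_pMr// ltr_pdivrMr ?ltr_wpDl// mul1r ltrDl.
Qed.

End fourier_continuity.

(** * Normalization of a covariant family *)

Section normalization.
Context {R : realType}.
Local Notation mu := (@leb3 R).

Lemma ae_ex (P : R3 R -> Prop) : (\forall p \ae mu, P p) -> exists p, P p.
Proof.
move=> [N [mN N0 PN]]; apply: contrapT => nP.
have {}PN : N = setT by apply/seteqP; split => // p _; apply: PN => Pp; apply: nP; exists p.
pose I : set (measurableTypeR R) := `[0, 1]%classic.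
have mI : measurable I by exact: measurable_itv.
have mI2 : measurable (I `*` I : set (R2 R)) by exact: measurableX.
have mI3 : measurable ((I `*` I) `*` I : set (R3 R)) by exact: measurableX.
have : (mu ((I `*` I) `*` I) <= mu N)%E by apply: le_measure; rewrite ?inE// PN.
rewrite N0 leb3X// leb2X// /I lebesgue_measure_itv/= lte_fin ltr01 -EFinB subr0 -!EFinM.
by rewrite lee_fin !mul1r ler10.
Qed.

Definition scal3 (c : R) (p : R3 R) : R3 R := (c * p.1.1, c * p.1.2, c * p.2).

Lemma dot3_scal3 c p : dot3 (scal3 c p) (scal3 c p) = c ^+ 2 * dot3 p p.
Proof. by rewrite /dot3 /=; ring. Qed.

Lemma bmeas_gramk_diag n (w : 'I_n -> wave R) : (forall l, bmeas (w l)) ->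
  bmeas (fun p => gramk w p p).
Proof.
by move=> bw; apply: bmeas_sum => l; apply: bmeasM => //; exact: bmeas_conj.
Qed.

Lemma normc_gramk n (w : 'I_n -> wave R) p l : gramk w p p = 1 -> Normc.normc (w l p) <= 1.
Proof.
rewrite /gramk => E.
rewrite -ler_sqr ?nnegrE ?normc_ge0// expr1n.
have -> : 1 = \sum_k Normc.normc (w k p) ^+ 2.
  apply: (@complexI R); rewrite -[LHS]E rmorph_sum/=.
  by apply: eq_bigr => k _; rewrite mulJc.
by rewrite (bigD1 l)//= lerDl; apply: sumr_ge0 => k _; exact: sqr_ge0.
Qed.

Section covariant.
Variables (n : nat) (w : 'I_n -> wave R) (D : 'M[R[i]]_2 -> 'M[R[i]]_n).
Hypotheses (bw : forall l, bmeas (w l)).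
Hypothesis D_unitary : forall B, SU2 B -> D B \is unitarymx.
Hypothesis w_rot : forall B p, SU2 B -> colw w (su2_rot B p) = D B *m colw w p.

Lemma gramk_rot B k p : SU2 B -> gramk w (su2_rot B k) (su2_rot B p) = gramk w k p.
Proof.
move=> SB; rewrite !gramkE !w_rot// trmx_mul map_mxM.
have /unitarymxP/mulmx1C U := D_unitary SB.
by rewrite -mulmxA (mulmxA _ (D B)) U mul1mx.
Qed.

Hypothesis w_ae : \forall p \ae mu, gramk w p p = 1.

(* Off the null set where the norm of [w] differs from 1, [w] is replaced by
   its value on a sphere on which the norm is 1. *)
Lemma covariant_normalize : exists v : 'I_n -> wave R,
  [/\ forall l, bmeas (v l),
      (forall B p, SU2 B -> colw v (su2_rot B p) = D B *m colw v p),
      (\forall p \ae mu, colw v p = colw w p) &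
      forall p : R3 R, p != 0 -> gramk v p p = 1].
Proof.
have [p0 [p00 n0]] : exists p : R3 R, p != 0 /\ gramk w p p = 1.
  by apply: ae_ex; apply: filterS2 (@ae_neq0 R) w_ae.
(* Radial projection onto the sphere through [p0]. It commutes with rotations, and so does the case
   distinction in [v], because [gramk w p p] is invariant; hence [v] is again covariant. *)
pose s (p : R3 R) := scal3 (nrm p0 * (nrm p)^-1) p.
have sE (p : R3 R) : p != 0 -> dot3 (s p) (s p) = dot3 p0 p0.
  move=> pn; rewrite dot3_scal3 exprMn exprVn !nrm_sqr mulfVK//.
  by rewrite dot3_eq0.
have s_rot B p : SU2 B -> s (su2_rot B p) = su2_rot B (s p).
  by move=> SB; rewrite /s /scal3 su2_rotZ// nrm_rot.
have s1 (p : R3 R) : p != 0 -> gramk w (s p) (s p) = 1.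
  move=> /sE /esym /su2_rot_trans[B SB <-]; by rewrite gramk_rot.
(* Covariance at the origin demands a value fixed by all D(B), such as 0. *)
pose v l p := if p == 0 then 0 else if gramk w p p == 1 then w l p else w l (s p).
have vE (p : R3 R) : p != 0 ->
    colw v p = if gramk w p p == 1 then colw w p else colw w (s p).
  by move=> pn; apply/matrixP => i j; rewrite !mxE /v (negbTE pn); case: ifP => _; rewrite mxE.
have v1 (p : R3 R) : p != 0 -> gramk v p p = 1.
  move=> pn; rewrite gramkE vE//; case: ifPn => [/eqP E|_]; rewrite -gramkE//.
  exact: s1.
exists v; split=> //.
- move=> l; split; last first.
    exists 1 => p; have [->|pn] := eqVneq p 0; last exact/normc_gramk/v1.
    by rewrite /v eqxx Normc.normc0.
  pose E := [set p | gramk w p p = 1].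
  have mE : measurable E.
    have [[m1 m2] _] := bmeas_gramk_diag bw.
    have -> : E = ((fun p => complex.Re (gramk w p p)) @^-1` [set 1]) `&`
                  ((fun p => complex.Im (gramk w p p)) @^-1` [set 0]).
      apply/seteqP; split => p /=; first by rewrite /E/= => ->.
      by move=> [h1 h2]; apply: cplx_eq.
    apply: measurableI.
      by rewrite -[X in measurable X]setTI; apply: m1.
    by rewrite -[X in measurable X]setTI; apply: m2.
  have mZ : measurable [set p : R3 R | p != 0] by exact: measurable_neq0.
  have -> : v l = fun p => (\1_([set p : R3 R | p != 0] `&` E) p)%:C * w l p +
      (\1_([set p : R3 R | p != 0] `&` ~` E) p)%:C * w l (s p).
    apply/funext => p; rewrite /v !indicE.
    have [->|pn] := eqVneq p 0.
      by rewrite !memNset ?mul0r ?addr0// => -[] /=; rewrite eqxx.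
    have [e|ne] := eqVneq (gramk w p p) 1.
      rewrite mem_set// memNset; last by move=> [_]; apply.
      by rewrite mul1r mul0r addr0.
    rewrite memNset; last by move=> [_ /eqP]; rewrite (negbTE ne).
    rewrite mem_set; first by rewrite mul1r mul0r add0r.
    by split => //; apply/eqP.
  apply: cmeasD; apply: cmeasM.
  + by apply: cmeas_real; apply: measurable_indic; exact: measurableI.
  + by case: (bw l).
  + by apply: cmeas_real; apply: measurable_indic; apply: measurableI => //; exact: measurableC.
  + have [mw _] := bw l; apply: (cmeas_comp mw).
    have mr : measurable_fun setT (fun p : R3 R => nrm p0 * (nrm p)^-1).
      apply: measurable_funM => //; apply: measurable_inv; last exact: nrm_ge0.
      by apply: measurable_sqrt; apply: measurable_dot3.
    by apply: measurable_R3; apply: measurable_funM => //;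
      [exact: measurable_coord1|exact: measurable_coord2].
- move=> B p SB; have [->|pn] := eqVneq p 0.
    have z : colw v 0 = 0 by apply/matrixP => i j; rewrite !mxE /v eqxx.
    have -> : su2_rot B 0 = 0 by apply/eqP; rewrite su2_rot_eq0.
    by rewrite z mulmx0.
  rewrite !vE ?su2_rot_eq0// gramk_rot//; case: ifP => _; first exact: w_rot.
  by rewrite s_rot// w_rot.
- by apply: filterS2 (@ae_neq0 R) w_ae => p pn E; rewrite vE// E eqxx.
Qed.

End covariant.
End normalization.

(** * Covariant factorization of the kernel *)

Section factorization.
Context {R : realType} (F F' : wave R -> wave R)
  (T : set (R3 R) -> wave R -> wave R) (t : R3 R -> R3 R -> R[i]).
Hypotheses (hF : is_fourier F F') (hT : is_POL T) (ht : is_kernel T t).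
Local Notation mu := (@leb3 R).

(** An equality for almost all pairs says nothing about the diagonal, so t(p,p) = 1 cannot be
    transferred. Instead T(R^3) is both the identity and multiplication by [gramk w p p], and the
    Gaussian has no zeros. *)
Lemma gramk_diag_ae n (w : 'I_n -> wave R) : (forall l, bmeas (w l)) ->
  (\forall kp \ae (mu \x mu)%E, off0 t kp.1 kp.2 = gramk w kp.1 kp.2) ->
  \forall p \ae mu, gramk w p p = 1.
Proof.
move=> bw FR; have g2 := dom_L2 (@dom_gau R).
have E1 := pol_norm hT g2.
have E2 := POL_eq_kinS hF hT ht (@measurableT _ (R3 R)) bw FR g2.
have E3 := kinS_setT hF bw (erefl setT) g2.
apply: filterS3 E1 E2 E3 => p /(_ I) E1 /(_ I) E2 /(_ I) E3.
have := etrans (esym E1) (etrans E2 E3); rewrite -[X in X = _]mul1r => /esym.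
by apply: mulIf; rewrite (inj_eq (@complexI R) _ 0) gt_eqF ?gau_gt0.
Qed.

Lemma gramk_covariant n (f : 'I_n -> wave R) : (forall l, bmeas (f l)) ->
  (\forall kp \ae (mu \x mu)%E, off0 t kp.1 kp.2 = gramk f kp.1 kp.2) ->
  exists m (D : 'M[R[i]]_2 -> 'M[R[i]]_m) (v : 'I_m -> wave R),
  [/\ is_unitary_rep D, (forall l, bmeas (v l)) /\ indep v,
      (forall B p, SU2 B -> colw v (su2_rot B p) = D B *m colw v p),
      (forall p : R3 R, p != 0 -> gramk v p p = 1) &
      \forall kp \ae (mu \x mu)%E, off0 t kp.1 kp.2 = gramk v kp.1 kp.2].
Proof.
move=> bf FRf; have [m [w [bw iw FW]]] := gramk_reduce bf.
have FR : \forall kp \ae (mu \x mu)%E, off0 t kp.1 kp.2 = gramk w kp.1 kp.2.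
  by apply: filterS2 FRf FW => kp -> ->.
have [D [u [bu uw u_rot DM DU]]] :=
  kernel_factor_rot (jmeas_off0 ht) (off0_le1 ht) (off0_rot ht) bw iw FR.
have iu : indep u by apply: indep_ae iw; apply: filterS uw => p ->.
have FRu : \forall kp \ae (mu \x mu)%E, off0 t kp.1 kp.2 = gramk u kp.1 kp.2.
  by apply: filterS2 FR (ae_both uw) => -[k p] /= -> [h1 h2]; rewrite !gramkE h1 h2.
have [v [bv v_rot vu v1]] := covariant_normalize bu DU u_rot (gramk_diag_ae bu FRu).
exists m, D, v; split=> //.
- split=> // B SB e e0; exact: (covariant_family_cont hF bu iu u_rot SB e0).
- split=> //; apply: indep_ae iu; by apply: filterS vu => p ->.
- by apply: filterS2 FRu (ae_both vu) => -[k p] /= -> [h1 h2]; rewrite !gramkE h1 h2.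
Qed.

End factorization.

(** * Finite dimensional reproducing kernel Hilbert spaces *)

Section finite_feature_map.
Context {R : realType} (X : Type) (m : nat) (e : X -> 'cV[R[i]]_m).

Definition sqn (c : 'cV[R[i]]_m) : R := \sum_i Normc.normc (c i 0) ^+ 2.

Lemma sqn_ge0 c : 0 <= sqn c.
Proof. by apply: sumr_ge0 => i _; exact: sqr_ge0. Qed.

Lemma mulmx_sqn c : (c ^t* *m c) 0 0 = (sqn c)%:C.
Proof.
rewrite mxE rmorph_sum/=; apply: eq_bigr => i _.
by rewrite !mxE conjCE mulJc.
Qed.

Lemma sqn_eq0 c : sqn c = 0 -> c = 0.
Proof.
move=> c0; apply/matrixP => i j; rewrite ord1 mxE; apply/eqP.
rewrite -normc_eq0 -sqrf_eq0.
have := @psumr_eq0P _ _ predT (fun i => Normc.normc (c i 0) ^+ 2) (fun i _ => sqr_ge0 _) c0.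
by move=> /(_ i isT) ->.
Qed.

Lemma real_cauchy_cvg (u : nat -> R) :
  (forall d, 0 < d -> exists N, forall k l, (N <= k)%N -> (N <= l)%N -> `|u k - u l| < d) ->
  exists l : R, u @ \oo --> l.
Proof.
move=> H; suff : cvg (u @ \oo) by move=> /cvg_ex.
apply/cauchy_cvgP; apply: cauchy_exP => d d0; have [N HN] := H d d0.
exists (u N); suff : \forall k \near \oo, ball (u N) d (u k) by [].
by exists N => // k Nk; exact: HN.
Qed.

Lemma sqn_complete (c : nat -> 'cV[R[i]]_m) :
  (forall d, 0 < d -> exists N, forall k l, (N <= k)%N -> (N <= l)%N -> sqn (c k - c l) < d) ->
  exists c0, sqn (c k - c0) @[k --> \oo] --> (0 : R).
Proof.
move=> H.
have bnd (x : 'cV[R[i]]_m) i d : 0 < d -> sqn x < d ^+ 2 ->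
    `|complex.Re (x i 0)| < d /\ `|complex.Im (x i 0)| < d.
  move=> d0 xd; have h : Normc.normc (x i 0) < d.
    rewrite -ltr_sqr ?nnegrE ?normc_ge0 ?(ltW d0)//; apply: le_lt_trans xd.
    by rewrite /sqn (bigD1 i)//= lerDl; apply: sumr_ge0 => j _; exact: sqr_ge0.
  by split; [exact: le_lt_trans (normc_Re _) h|exact: le_lt_trans (normc_Im _) h].
have /choice[a ca] : forall i, exists l : R, complex.Re (c k i 0) @[k --> \oo] --> l.
  move=> i; apply: real_cauchy_cvg => d d0.
  have [N HN] := H _ (exprn_gt0 2 d0); exists N => k l Nk Nl.
  have [+ _] := bnd _ i _ d0 (HN k l Nk Nl).
  by rewrite !mxE; case: (c k i 0) => ? ?; case: (c l i 0).
have /choice[b cb] : forall i, exists l : R, complex.Im (c k i 0) @[k --> \oo] --> l.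
  move=> i; apply: real_cauchy_cvg => d d0.
  have [N HN] := H _ (exprn_gt0 2 d0); exists N => k l Nk Nl.
  have [_] := bnd _ i _ d0 (HN k l Nk Nl).
  by rewrite !mxE; case: (c k i 0) => ? ?; case: (c l i 0).
exists (\col_i (a i +i* b i)).
have -> : (fun k => sqn (c k - \col_i (a i +i* b i))) = (fun k =>
    \sum_i ((complex.Re (c k i 0) - a i) ^+ 2 + (complex.Im (c k i 0) - b i) ^+ 2)).
  apply/funext => k; apply: eq_bigr => i _; rewrite normc_sqr !mxE.
  by case: (c k i 0).
have E : \sum_(i < m) (((a i - a i) ^+ 2 + (b i - b i) ^+ 2) : R) = 0.
  by rewrite big1// => i _; rewrite !subrr expr0n/= addr0.
rewrite -[X in _ --> X]E.
apply: (cvg_big (op := +%R) (@add_continuous R)) => i _.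
by apply: cvgD; rewrite expr2; apply: cvgM; apply: cvgB => //; exact: cvg_cst.
Qed.

Lemma sqn_dense (c : 'cV[R[i]]_m) (d : R) : 0 < d ->
  exists q : {ffun 'I_m -> rat * rat},
    sqn (c - \col_i (ratr (q i).1 +i* ratr (q i).2)) < d.
Proof.
move=> d0; pose r := Num.min 1 (d / (2 * m%:R + 1)).
have m1 : 0 < 2 * m%:R + 1 :> R by rewrite ltr_wpDl.
have r0 : 0 < r by rewrite lt_min ltr01 divr_gt0.
have near (x : R) : exists q : rat, `|x - ratr q| < r.
  have [q] := @rat_in_itvoo R (x - r) (x + r) ltac:(lra).
  by rewrite in_itv/= => /andP[h1 h2]; exists q; rewrite ltr_norml; apply/andP; split; lra.
have /choice[a ha] : forall i, exists q : rat * rat,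
    `|complex.Re (c i 0) - ratr q.1| < r /\ `|complex.Im (c i 0) - ratr q.2| < r.
  move=> i; have [q1 h1] := near (complex.Re (c i 0)).
  by have [q2 h2] := near (complex.Im (c i 0)); exists (q1, q2).
exists [ffun i => a i].
apply: (@le_lt_trans _ _ (\sum_(i < m) (2 * r))); last first.
  rewrite sumr_const card_ord -[_ *+ m]mulr_natl mulrA.
  have : r <= d / (2 * m%:R + 1) by rewrite ge_min lexx orbT.
  rewrite ler_pdivlMr// => h; have := ltr_pwDr r0 (lexx (r * (2 * m%:R))); lra.
apply: ler_sum => i _; rewrite normc_sqr !mxE ffunE.
have [h1 h2] := ha i.
have r1 : r <= 1 by rewrite ge_min lexx.
have sq (x : R) : `|x| < r -> x ^+ 2 <= r.
  move=> xr; rewrite -real_normK ?num_real// expr2.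
  by apply: le_trans (ler_piMr (normr_ge0 x) (le_trans (ltW xr) r1)) (ltW xr).
by rewrite mulr2n mulrDl mul1r; case: (c i 0) h1 h2 => x y /= /sq ? /sq ?; exact: lerD.
Qed.

Definition feat (c : 'cV[R[i]]_m) (x : X) : R[i] := ((e x) ^t* *m c) 0 0.

Hypothesis e_total : forall c, (forall x, feat c x = 0) -> c = 0.

Let H : set (X -> R[i]) := [set f | exists c, f = feat c].
(** The inner product has to be defined on all functions; outside the space the coefficient vector
    is 0 by default, and inside it is unique by [feat_inj]. *)
Let coef (f : X -> R[i]) := xget 0 [set c | f = feat c].
Let ipH f g : R[i] := ((coef f) ^t* *m coef g) 0 0.

Let featDZ a c d : feat (a *: c + d) = fun x => a * feat c x + feat d x.
Proof. by apply/funext => x; rewrite /feat mulmxDr -scalemxAr !mxE. Qed.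

Let featB c d : feat c \- feat d = feat (c - d).
Proof. by apply/funext => x; rewrite /= /feat mulmxBr [RHS]mxE [X in _ = _ + X]mxE. Qed.

Let feat_inj c d : feat c = feat d -> c = d.
Proof.
move=> cd; apply/eqP; rewrite -subr_eq0; apply/eqP; apply: e_total => x.
by rewrite -featB cd /= subrr.
Qed.

Let coefK c : coef (feat c) = c.
Proof.
rewrite /coef; case: xgetP => [d _ /= /feat_inj ->//|/(_ c) nc].
by exfalso; exact: nc.
Qed.

Let ipHE c d : ipH (feat c) (feat d) = (c ^t* *m d) 0 0.
Proof. by rewrite /ipH !coefK. Qed.

(** The space is C^m with its standard inner product, carried over to functions by [feat]. This map
    is injective because the vectors [e x] are total, and it sends [e x] to the kernel function of
    x. *)
Lemma finite_rkhs : separable_rkhs (fun x y => ((e x) ^t* *m e y) 0 0).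
Proof.
exists H, ipH; split; [split|].
- by exists 0; apply/funext => x; rewrite /feat mulmx0 mxE.
- by move=> a f g [c ->] [d ->]; exists (a *: c + d); rewrite featDZ.
- move=> a h f g [b ->] [c ->] [d ->].
  by rewrite -featDZ !ipHE mulmxDr -scalemxAr !mxE.
- move=> f g [c ->] [d ->]; rewrite !ipHE conjCE !mxE conjc_sum; apply: eq_bigr => i _.
  by rewrite !mxE conjcM !conjCE conjcK mulrC.
- by move=> f [c ->]; rewrite ipHE mulmx_sqn -[0]/(0%:C) lecR sqn_ge0.
- move=> f [c ->]; rewrite ipHE mulmx_sqn => /complexI /sqn_eq0 -> x.
  by rewrite /feat mulmx0 mxE.
- move=> u /choice[c uc] C.
  have uE k l : complex.Re (ipH (u k \- u l) (u k \- u l)) = sqn (c k - c l).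
    by rewrite !uc featB ipHE mulmx_sqn.
  have [|c0 cc0] := @sqn_complete c.
    by move=> d /C[N HN]; exists N => k l Nk Nl; rewrite -uE; exact: HN.
  exists (feat c0); first by exists c0.
  have -> // : (fun k => complex.Re (ipH (u k \- feat c0) (u k \- feat c0))) =
      fun k => sqn (c k - c0).
  by apply/funext => k; rewrite uc featB ipHE mulmx_sqn.
- by move=> x; exists (e x).
- by move=> f [c ->] x; rewrite (ipHE (e x)).
(* The vectors with rational real and imaginary parts, enumerated by their codes; numbers that code
   nothing are sent to 0. *)
- pose dn (k : nat) : 'cV[R[i]]_m :=
    if unpickle k is Some q then \col_i (ratr ((q : {ffun 'I_m -> rat * rat}) i).1 +i* ratr (q i).2)
    else 0.
  exists (fun k => feat (dn k)) => [k|f [c ->] d d0]; first by exists (dn k).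
  have [q cq] := sqn_dense c d0; exists (pickle q).
  by rewrite featB ipHE mulmx_sqn /dn pickleK.
Qed.

End finite_feature_map.

(** * The equivalences *)

Section finite_rank_kernel.
Context {R : realType} (F F' : wave R -> wave R)
  (T : set (R3 R) -> wave R -> wave R) (t : R3 R -> R3 R -> R[i]).
Hypotheses (hF : is_fourier F F') (hT : is_POL T) (ht : is_kernel T t).
Local Notation mu := (@leb3 R).
Local Notation cmeas := (@cmeasurable R _ (R3 R) setT).

Lemma finite_rank_kernel_of_kinS n (f : 'I_n -> wave R) : (forall l, bmeas (f l)) ->
  (forall Delta, measurable Delta -> forall phi, L2 phi ->
    T Delta phi = kinS F F' f Delta phi %[ae mu]) ->
  \forall kp \ae (mu \x mu)%E, off0 t kp.1 kp.2 = gramk f kp.1 kp.2.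
Proof.
move=> bf TE; apply: kernel_unique.
- by split; [exact: (jmeas_off0 ht)|exists 1 => // k p; exact: (off0_le1 ht)].
- split; first by apply: jmeas_gramk => l; case: (bf l).
  have /choice[M hM] : forall l, exists M : R, forall p, Normc.normc (f l p) <= M.
    by move=> l; case: (bf l).
  have M0 l : 0 <= M l := le_trans (normc_ge0 _) (hM l 0).
  exists (\sum_l M l * M l); first by apply: sumr_ge0 => l _; exact: mulr_ge0.
  move=> k p; apply: le_trans (normc_sum _) _; apply: ler_sum => l _.
  by rewrite Normc.normcM normc_conj ler_pM ?normc_ge0.
move=> phi dphi Delta mD; have p1 := dom_L1 dphi; have p2 := dom_L2 dphi.
have E : ip phi (T Delta phi) = ip phi (kinS F F' f Delta phi).
  apply: ip_aer; [exact: L2_meas|exact/L2_meas/(T_L2 hT)|exact/L2_meas/kinS_L2|].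
  exact: TE.
have := etrans (esym (off0_formula ht p1 p2 mD)) (etrans E (kinS_formula hF bf mD p1 p2)).
apply: mulfI; rewrite (inj_eq (@complexI R) _ 0) gt_eqF// invr_gt0 exprn_gt0//.
by rewrite mulr_gt0// pi_gt0.
Qed.

Lemma finite_rank_of_deformation : kinematic_deformation F F' T ->
  exists n (f : 'I_n -> wave R), (forall l, bmeas (f l)) /\
    \forall kp \ae (mu \x mu)%E, off0 t kp.1 kp.2 = gramk f kp.1 kp.2.
Proof.
move=> [n [f [f' [mf fM adj TE]]]].
have bf l : bmeas (f l) by split; [exact: mf|exact: fM].
exists n, f; split=> //; apply: finite_rank_kernel_of_kinS => // Delta mD phi phi2.
(* The [f' l] are arbitrary maps satisfying the adjoint relation, which determines them on L^2 up to
   null sets. *)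
have f'E l y : L2 y -> f' l y = mulop (fun q => (f l q)^*%C) y %[ae mu].
  move=> y2; have [a1 a2] := adj l; apply: test_L2_ae; first exact: a1.
    by apply: bmeas_L2 => //; exact: bmeas_conj.
  by move=> eta /dom_L2 eta2; rewrite a2// ip_mulop.
have H : \forall p \ae mu, forall l, f' l (ENW F F' Delta (mulop (f l) phi)) p =
    mulop (fun q => (f l q)^*%C) (ENW F F' Delta (mulop (f l) phi)) p.
  apply: filter_forall => l; apply/aeE/f'E.
  by apply: (ENW_L2 hF) => //; exact: bmeas_L2.
apply: filterS2 H (TE _ mD _ phi2) => p H /(_ I) E _; rewrite E.
by apply: eq_bigr => l _; exact: H.
Qed.

Lemma finite_rank_of_finite_kernel : is_finite_kernel T t ->
  exists n (f : 'I_n -> wave R), (forall l, bmeas (f l)) /\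
    \forall kp \ae (mu \x mu)%E, off0 t kp.1 kp.2 = gramk f kp.1 kp.2.
Proof.
move=> [t' [kt' t't [n [f [mf tE]]]]].
have n1 (p : R3 R) : p != 0 -> gramk f p p = 1.
  by move=> p0; rewrite -(ker_diag kt' p0) tE.
exists n, f; split.
  (* Away from the origin the diagonal value 1 bounds each component by 1; the second summand takes
     care of the origin, where the kernel gives no information. *)
  move=> l; split=> //; exists (1 + Normc.normc (f l 0)) => p.
  have [->|p0] := eqVneq p 0; first by rewrite lerDr.
  by rewrite (le_trans (normc_gramk l (n1 _ p0)))// lerDl normc_ge0.
apply: filterS3 (off0_ae t) t't (ae_both (@ae_neq0 R)) => -[k p] /= -> <- [k0 p0].
exact: tE.
Qed.

Lemma deformation_of_finite_rank n (f : 'I_n -> wave R) : (forall l, bmeas (f l)) ->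
  (\forall kp \ae (mu \x mu)%E, off0 t kp.1 kp.2 = gramk f kp.1 kp.2) ->
  kinematic_deformation F F' T.
Proof.
move=> bf FR; exists n, f, (fun l => mulop (fun q => (f l q)^*%C)); split.
- by move=> l; case: (bf l).
- by move=> l; case: (bf l).
- move=> l; split=> [y y2|x y _ _]; last by rewrite ip_mulop.
  by apply: bmeas_L2 => //; exact: bmeas_conj.
- by move=> Delta mD phi phi2; exact: (POL_eq_kinS hF hT ht).
Qed.

Section covariant.
Variables (m : nat) (D : 'M[R[i]]_2 -> 'M[R[i]]_m) (v : 'I_m -> wave R).
Hypotheses (D_rep : is_unitary_rep D) (bv : forall l, bmeas (v l)) (iv : indep v).
Hypothesis v_rot : forall B p, SU2 B -> colw v (su2_rot B p) = D B *m colw v p.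
Hypothesis v1 : forall p : R3 R, p != 0 -> gramk v p p = 1.
Hypothesis FR : \forall kp \ae (mu \x mu)%E, off0 t kp.1 kp.2 = gramk v kp.1 kp.2.

Lemma gramk_is_kernel : is_kernel T (gramk v).
Proof.
have mv l : cmeas (v l) by case: (bv l).
split.
- have [m1 m2] := jmeas_gramk mv.
  split; [exact: (measurable_funS measurableT _ m1)|exact: (measurable_funS measurableT _ m2)].
- by move=> B SB k p _ _; rewrite (gramk_rot (rep_unitary D_rep) v_rot).
- move=> n p c _.
  have -> : \sum_i \sum_j (c i)^* * c j * gramk v (p i) (p j) =
      \sum_l ((Normc.normc (\sum_j c j * v l (p j))) ^+ 2)%:C.
    under [RHS]eq_bigr do rewrite -mulJc conjc_sum mulr_suml.
    rewrite [RHS]exchange_big; apply: eq_bigr => i _ /=.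
    under [RHS]eq_bigr do rewrite mulr_sumr.
    rewrite [RHS]exchange_big; apply: eq_bigr => j _ /=.
    by rewrite /gramk mulr_sumr; apply: eq_bigr => l _; rewrite conjcM -!conjCE; ring.
  by apply: sumr_ge0 => l _; rewrite -[0]/(0%:C) lecR sqr_ge0.
- exact: v1.
- have := @finite_rkhs R {p : R3 R | p != 0} m (fun x => colw v (val x)).
  rewrite (_ : (fun x y => _) = fun k p => gramk v (val k) (val p)); last first.
    by apply/funext => k; apply/funext => p; rewrite gramkE.
  (* A vector orthogonal to all values of [v] off the origin is, after conjugation, a linear
     relation between the components. *)
  apply=> c c0; have : c ^t* = 0.
    apply: iv; apply: filterS (@ae_neq0 R) => p p0.
    have := c0 (exist _ p p0); rewrite /feat /= => /(congr1 (fun z : R[i] => z^*%C)).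
    rewrite conjc0 => E; apply/matrixP => i j; rewrite !ord1 [RHS]mxE -E.
    by rewrite !mxE conjc_sum; apply: eq_bigr => l _; rewrite !mxE conjcM !conjCE conjcK mulrC.
  by move=> /(congr1 (fun Y : 'rV[R[i]]_m => Y ^t*)); rewrite trmxCK trmx0 map_mx0.
- move=> f f1 f2 Delta mD; rewrite (off0_formula ht f1 f2 mD).
  have mf := L1_meas f1.
  have -> : kform (off0 t) f f = kform (gramk v) f f.
    apply/funext => x; exact: (kform_ae x (jmeas_off0 ht) (jmeas_gramk mv) mf mf FR).
  exact: erefl.
Qed.

Lemma gramk_is_finite : is_finite_kernel T t.
Proof.
exists (gramk v); split; first exact: gramk_is_kernel.
  by apply: filterS2 FR (off0_ae t) => kp -> ->.
exists m, v; split=> [l|k p _ _]; first by case: (bv l).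
by apply: eq_bigr => l _; rewrite conjCE.
Qed.

Lemma gramk_is_trace : finite_POL F F' T.
Proof.
pose j (phi : wave R) : spinor R m := fun p => \col_l (v l p * phi p).
pose j' (y : spinor R m) : wave R := fun p => \sum_l (v l p)^*%C * y p l 0.
have jE phi l : (fun p => j phi p l 0) = mulop (v l) phi.
  by apply/funext => p; rewrite mxE.
have j2 phi : L2 phi -> L2v (j phi).
  by move=> phi2 l; rewrite jE; exact: bmeas_L2.
exists m, D, j, j'; split=> //.
- split=> //.
  + move=> c f g _ _; apply: nearW => p _; apply/matrixP => l k.
    by rewrite !mxE; ring.
  + move=> f g f2 g2; rewrite /ipv; under eq_bigr do rewrite !jE ip_mulop.
    rewrite -ip_sumr//; last first.
      by move=> l; apply: bmeas_L2; [exact: bmeas_conj|exact: bmeas_L2].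
    apply: ip_aer; [exact: L2_meas| |exact: L2_meas|].
      apply: cmeas_sum => l; apply: L2_meas.
      by apply: bmeas_L2; [exact: bmeas_conj|exact: bmeas_L2].
    apply: filterS (@ae_neq0 R) => p p0 _; rewrite -[RHS]mul1r -(v1 p0) /gramk mulr_suml.
    by apply: eq_bigr => l _; rewrite /mulop mulrA.
- split=> [y y2|x y x2 y2].
    by apply: L2_sum => l; apply: (bmeas_L2 _ (y2 l)); exact: bmeas_conj.
  rewrite /ipv; under [RHS]eq_bigr do rewrite jE ip_mulop.
  rewrite -ip_sumr// => l; by apply: (bmeas_L2 _ (y2 l)); exact: bmeas_conj.
- move=> [b B] SB f f2; apply: nearW => p _.
  rewrite /DE /U0 /=; set q := su2_rot (invmx B) p.
  have jq : j f q = f q *: colw v q by apply/matrixP => l k; rewrite !mxE mulrC.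
  rewrite jq -scalemxAr -v_rot// /q su2_rotVK//.
  by apply/matrixP => l k; rewrite !mxE; ring.
- move=> Delta mD f f2.
  have E := POL_eq_kinS hF hT ht mD bv FR f2.
  apply: filterS E => p /(_ I) E _; rewrite E; apply: eq_bigr => l _.
  rewrite /mulop /liftv mxE; congr (_ * F _ p); apply/funext => q.
  rewrite mxE; congr (Ecan _ _ q); apply/funext => r; rewrite mxE.
  by congr (F' _ r); apply/funext => s; rewrite mxE.
Qed.

End covariant.
End finite_rank_kernel.

(** * Intertwining isometries as multiplication operators *)

Section finite_trace.
Context {R : realType} (F F' : wave R -> wave R).
Hypothesis hF : is_fourier F F'.
Local Notation mu := (@leb3 R).
Local Notation cmeas := (@cmeasurable R _ (R3 R) setT).
Local Notation L1 := (@Lpow R 1).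

Lemma L2_dom_mul (f g : wave R) : dominated f -> L2 g -> L2 (fun p => (f p)^*%C * g p).
Proof.
move=> [mf [C C0 fC]] g2; apply: (@L2_bmul _ C) => //; first exact: cmeas_conj.
move=> p; rewrite normc_conj (le_trans (fC p))// -[leRHS]mulr1.
by rewrite ler_wpM2l// gau_le1.
Qed.

Variables (n : nat) (D : 'M[R[i]]_2 -> 'M[R[i]]_n) (j : wave R -> spinor R n)
  (j' : spinor R n -> wave R).
Hypotheses (D_rep : is_unitary_rep D) (j_isom : isometryv j).
Hypothesis j_adj : is_adjoint L2 ip (@L2v R n) (@ipv R n) j j'.
Hypothesis j_cov : forall g, ISU2 g -> forall f, L2 f ->
  j (U0 g f) = DE D g (j f) %[ae mu].

Let j2 f l : L2 f -> L2 (fun p => j f p l 0).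
Proof. by move=> f2; have [h _ _] := j_isom; exact: h. Qed.

Let D1 : D 1%:M = 1%:M.
Proof.
have S1 := @SU21 R; have := rep_mul D_rep S1 S1; rewrite mulmx1 => E.
have U := unitarymx_unit (rep_unitary D_rep S1).
by rewrite -(mulKmx U (D 1%:M)) -E mulVmx.
Qed.

Let modulate b (f : wave R) : wave R := fun p => expi (- dot3 b p) * f p.

Let modulate_L2 b f : L2 f -> L2 (modulate b f).
Proof.
move=> f2; apply: (@L2_bmul _ 1) => //.
  by apply: cmeas_expi; apply: measurable_funN; exact: measurable_phase.
by move=> p; rewrite normc_expi.
Qed.

Let j_modulate b f : L2 f -> \forall p \ae mu, forall l,
  j (modulate b f) p l 0 = modulate b (fun q => j f q l 0) p.
Proof.
move=> f2; have := j_cov (g := (b, 1%:M)) (@SU21 R) f2.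
have -> : U0 (b, 1%:M) f = modulate b f.
  by apply/funext => p; rewrite /U0 /= invmx1 su2_rot1.
apply: filterS => p /(_ I) -> l.
by rewrite /DE /= invmx1 su2_rot1 D1 mul1mx mxE.
Qed.

Let single l (eta : wave R) : spinor R n :=
  fun p => \col_k (if k == l then eta p else 0).

Let single_L2 l eta : L2 eta -> L2v (single l eta).
Proof.
move=> e2 k; rewrite /single; under eq_fun do rewrite mxE.
by case: (k == l) => //; exact: L2_0.
Qed.

Let ip_single l eta f : L2 eta -> L2 f ->
  ip eta (fun p => j f p l 0) = (ip f (j' (single l eta)))^*%C.
Proof.
move=> e2 f2; have [a1 a2] := j_adj; rewrite a2//; last exact: single_L2.
rewrite /ipv (bigD1 l)//= big1 ?addr0 => [|k kl].
  rewrite ip_conj//; last exact: j2.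
  by congr (ip _ _)^*%C; apply/funext => p; rewrite mxE eqxx.
rewrite ipE -[RHS](cint0 (R := R)); congr cint; apply/funext => p.
by rewrite mxE (negbTE kl) mulr0.
Qed.

(* Commutation with all modulations makes [j] a multiplication operator. *)
Let j_local l eta f : dominated eta -> dominated f ->
  \forall p \ae mu, (eta p)^*%C * j f p l 0 = f p * (j' (single l eta) p)^*%C.
Proof.
move=> de df; have e2 := dom_L2 de; have f2 := dom_L2 df.
have [a1 a2] := j_adj; have y2 := a1 _ (single_L2 l e2).
set y := j' (single l eta) in y2 *.
have L2c (g : wave R) : L2 g -> L2 (fun p => (g p)^*%C).
  move=> [mg oo]; split; first exact: cmeas_conj.
  by under eq_integral do rewrite normc_conj.
have fc : dominated (fun p => (f p)^*%C) := dom_conj df.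
have u1 : L1 (fun p => (eta p)^*%C * j f p l 0) by apply: L2_mul => //; exact: j2.
have v1 : L1 (fun p => f p * (y p)^*%C).
  by have := L2_mul (dom_L2 fc) (L2c _ y2); under eq_fun do rewrite conjcK.
have u2 : L2 (fun p => (eta p)^*%C * j f p l 0) by apply: L2_dom_mul => //; exact: j2.
have v2 : L2 (fun p => f p * (y p)^*%C).
  by have := L2_dom_mul fc (L2c _ y2); under eq_fun do rewrite conjcK.
suff : (fun p => (eta p)^*%C * j f p l 0 - f p * (y p)^*%C) = (fun=> 0) %[ae mu].
  by apply: filterS => p /(_ I) /eqP; rewrite subr_eq0 => /eqP.
apply: (ft_eq0 hF); [exact: L1B|exact: L2B|].
apply: nearW => b; rewrite /ft; under [X in cint _ X]eq_fun do rewrite mulrBr.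
rewrite cintB; last 2 first.
- by apply: L1_phase => //; apply: measurable_funN; exact: measurable_phase.
- by apply: L1_phase => //; apply: measurable_funN; exact: measurable_phase.
have fb2 := modulate_L2 b f2.
(* The two Fourier integrals at b are two evaluations of the inner product of eta with the l-th
   component of j(exp(-ibp) f): one commutes the phase with j, the other passes to the adjoint. *)
have E : ip eta (fun p => j (modulate b f) p l 0) =
    cint setT (fun p => expi (- dot3 b p) * ((eta p)^*%C * j f p l 0)).
  rewrite (ip_aer (h := modulate b (fun p => j f p l 0))).
  - by rewrite ipE; congr cint; apply/funext => p; rewrite /modulate mulrCA.
  - exact: L2_meas.
  - by apply: L2_meas; exact: j2.
  - by apply/L2_meas/modulate_L2/j2.
  - by apply: filterS (j_modulate b f2) => p H _; exact: H.
rewrite -E ip_single// ipE -cint_conj; last exact: L2_mul.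
apply/eqP; rewrite subr_eq0; apply/eqP; congr cint; apply/funext => p.
by rewrite conjcM conjcK /modulate mulrA.
Qed.

(** The candidate for the multiplier, read off from the action of j on the nowhere vanishing
    Gaussian. *)
Let ratio l : wave R := fun p => (gau p)^-1%:C * j (fun q => (gau q)%:C) p l 0.

Let gau_neq0 p : (gau p)%:C != 0 :> R[i].
Proof. by rewrite (inj_eq (@complexI R) _ 0) gt_eqF ?gau_gt0. Qed.

Let g2 : L2 (fun q => (gau q)%:C : R[i]) := dom_L2 (@dom_gau R).

Let ratio_gau l p : (gau p)%:C * ratio l p = j (fun q => (gau q)%:C) p l 0.
Proof. by rewrite /ratio mulrA -realCM divff ?mul1r// gt_eqF ?gau_gt0. Qed.

Let ratio_meas l : cmeas (ratio l).
Proof.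
apply: cmeasM; last by apply: L2_meas; exact: j2.
by apply: cmeas_real; apply: measurable_inv; [exact: measurable_gau|exact: gau_ge0].
Qed.

Let adj_ratio l eta : dominated eta ->
  \forall p \ae mu, (eta p)^*%C * ratio l p = (j' (single l eta) p)^*%C.
Proof.
move=> de; apply: filterS (j_local l de (@dom_gau R)) => p E.
by apply: (mulfI (gau_neq0 p)); rewrite -E mulrCA ratio_gau.
Qed.

(** With the Gaussian as eta, the adjoint term is eliminated between [j_local] for f and for the
    Gaussian. *)
Let j_ratio l f : dominated f -> \forall p \ae mu, j f p l 0 = ratio l p * f p.
Proof.
move=> df; apply: filterS2 (j_local l (@dom_gau R) df) (adj_ratio l (@dom_gau R)) => p E1 E2.
apply: (mulfI (gau_neq0 p)); move: E1 E2; rewrite !conjc_real => -> <-.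
by rewrite mulrC -mulrA.
Qed.

(** For dominated eta, the inner product of eta with gau times ([gramk ratio] - 1) is <j eta, j gau>
    - <eta, gau>, which vanishes because j is isometric. *)
Let ratio_norm : \forall p \ae mu, gramk ratio p p = 1.
Proof.
pose h : wave R := fun p => (gau p)%:C * (gramk ratio p p - 1).
have hE p : h p = \sum_l (ratio l p)^*%C * j (fun q => (gau q)%:C) p l 0 - (gau p)%:C.
  rewrite /h mulrBr mulr1 /gramk mulr_sumr; congr (_ - _); apply: eq_bigr => l _.
  by rewrite mulrCA ratio_gau.
have mh : cmeas h.
  rewrite (_ : h = fun p => h p)//; under eq_fun do rewrite hE.
  apply: cmeasB; last exact: L2_meas.
  apply: cmeas_sum => l; apply: cmeasM; first exact: cmeas_conj.
  by apply: L2_meas; exact: j2.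
have term_L1 eta l : L2 eta ->
    L1 (fun p => (j eta p l 0)^*%C * j (fun q => (gau q)%:C) p l 0).
  by move=> e2; apply: L2_mul; exact: j2.
have etahE eta : dominated eta -> (fun p => (eta p)^*%C * h p) =
    (fun p => \sum_l (j eta p l 0)^*%C * j (fun q => (gau q)%:C) p l 0 -
      (eta p)^*%C * (gau p)%:C) %[ae mu].
  move=> de.
  have H : \forall p \ae mu, forall l, j eta p l 0 = ratio l p * eta p.
    by apply: filter_forall => l; exact: j_ratio.
  apply: filterS H => p H _; rewrite hE mulrBr; congr (_ - _).
rewrite mulr_sumr; apply: eq_bigr => l _; rewrite H (conjcM (ratio l p)) mulrA.
by rewrite [X in X * _]mulrC.
have rhs_L1 eta : dominated eta -> L1 (fun p =>
    \sum_l (j eta p l 0)^*%C * j (fun q => (gau q)%:C) p l 0 - (eta p)^*%C * (gau p)%:C).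
  move=> de; have e2 := dom_L2 de.
  by apply: L1B; [apply: L1_sum => l; exact: term_L1|exact: L2_mul].
have meta eta : dominated eta -> cmeas (fun p => (eta p)^*%C * h p).
  by move=> [me _]; apply: cmeasM => //; exact: cmeas_conj.
have h0 : h = (fun=> 0) %[ae mu].
  apply: test_ae0 => //.
    have dg := @dom_gau R.
    have m1 := meta _ dg; have [m2 oo] := rhs_L1 _ dg.
    rewrite (_ : (fun p => (gau p)%:C * h p) = fun p => (gau p)%:C^*%C * h p); last first.
      by apply/funext => p; rewrite conjc_real.
    have i := L1_normc (rhs_L1 _ dg).
    split=> //.
    rewrite (ae_eq_integral (fun p => (Normc.normc
      (\sum_l (j (fun q => (gau q)%:C) p l 0)^*%C * j (fun q => (gau q)%:C) p l 0 -
      ((gau p)%:C)^*%C * (gau p)%:C) ^+ 1)%:E))//.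
    - by apply/measurable_EFinP/measurable_funX/measurable_normc.
    - by apply/measurable_EFinP/measurable_funX/measurable_normc.
    - by apply: filterS (etahE _ dg) => p /(_ I) E _; rewrite E.
  move=> eta de; have e2 := dom_L2 de.
  rewrite (cint_ae (meta _ de) (L1_meas (rhs_L1 _ de)) (etahE _ de)).
  rewrite cintB; [|by apply: L1_sum => l; exact: term_L1|exact: L2_mul].
  rewrite cint_sum; last by move=> l; exact: term_L1.
  have [_ _ iso] := j_isom; have := iso _ _ e2 g2.
  by rewrite /ipv => E; apply/eqP; rewrite subr_eq0 -ipE -E.
apply: filterS h0 => p /(_ I) /eqP; rewrite mulf_eq0 (negbTE (gau_neq0 p))/=.
by rewrite subr_eq0 => /eqP.
Qed.

(** By [ratio_norm] the multiplier is bounded by 1 only almost everywhere; cutting it off makes it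
    bounded at every point. *)
Let f l : wave R := fun p =>
  (\1_[set q | Normc.normc (ratio l q) <= 1] p)%:C * ratio l p.

Let f_ratio : \forall p \ae mu, forall l, f l p = ratio l p.
Proof.
apply: filterS ratio_norm => p E l.
by rewrite /f indicE mem_set ?mul1r//; exact: normc_gramk.
Qed.

Let bf l : bmeas (f l).
Proof.
split.
  apply: cmeasM => //; apply: cmeas_real; apply: measurable_indic.
  rewrite -[X in measurable X]setTI.
  have := measurable_normc (ratio_meas l) measurableT (@measurable_itv R `]-oo, 1]).
  by congr measurable; congr (_ `&` _); apply/seteqP; split => p /=; rewrite in_itv.
exists 1 => p; rewrite /f indicE; case: (boolP (_ \in _)) => [|_].
  by rewrite inE/= mul1r.
by rewrite mul0r Normc.normc0.
Qed.

(** The passage from dominated functions to L^2 is by duality: tested against a dominated eta, a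
    component of j phi becomes phi tested against the adjoint of eta, which [adj_ratio]
    identifies. *)
Let jE l phi : L2 phi -> (fun p => j phi p l 0) = mulop (f l) phi %[ae mu].
Proof.
move=> phi2; apply: test_L2_ae; [exact: j2|exact: bmeas_L2|].
move=> eta de; have e2 := dom_L2 de.
have [a1 a2] := j_adj; have y2 := a1 _ (single_L2 l e2).
rewrite ip_single// ipE -cint_conj; last exact: L2_mul.
rewrite ipE; apply: cint_ae.
- apply: cmeas_conj; apply: cmeasM; first by apply: cmeas_conj; exact: L2_meas.
  exact: L2_meas.
- apply: cmeasM; first by apply: cmeas_conj; exact: L2_meas.
  by apply: L2_meas; exact: bmeas_L2.
- apply: filterS2 (adj_ratio l de) f_ratio => p E1 E2 _.
  by rewrite conjcM conjcK -E1 -E2 /mulop; ring.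
Qed.

Let j'E y : L2v y -> j' y = (fun p => \sum_l (f l p)^*%C * y p l 0) %[ae mu].
Proof.
move=> y2; have [a1 a2] := j_adj.
have t2 l : L2 (fun p => (f l p)^*%C * y p l 0).
  by apply: (bmeas_L2 _ (y2 l)); exact: bmeas_conj.
apply: test_L2_ae; [exact: a1|exact: L2_sum|].
move=> eta /dom_L2 e2; rewrite a2// ip_sumr//; apply: eq_bigr => l _.
rewrite (ip_ael _ _ _ (jE l e2)).
- exact: ip_mulop.
- by apply: L2_meas; exact: j2.
- by apply: L2_meas; exact: bmeas_L2.
- exact: L2_meas (y2 l).
Qed.

Lemma trace_eq_kinS : exists v : 'I_n -> wave R, (forall l, bmeas (v l)) /\
  forall Delta, measurable Delta -> forall phi, L2 phi ->
    j' (liftv F (liftv (Ecan Delta) (liftv F' (j phi)))) = kinS F F' v Delta phi %[ae mu].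
Proof.
exists f; split=> // Delta mD phi phi2.
have lE l : (fun p => liftv F (liftv (Ecan Delta) (liftv F' (j phi))) p l 0) =
    ENW F F' Delta (fun p => j phi p l 0).
  apply/funext => p; rewrite /liftv mxE; congr (F _ p); apply/funext => q.
  rewrite mxE; congr (Ecan _ _ q); apply/funext => r; rewrite mxE.
  by [].
have y2 : L2v (liftv F (liftv (Ecan Delta) (liftv F' (j phi)))).
  by move=> l; rewrite lE; apply: (ENW_L2 hF) => //; exact: j2.
have H : \forall p \ae mu, forall l, ENW F F' Delta (fun p => j phi p l 0) p =
    ENW F F' Delta (mulop (f l) phi) p.
  apply: filter_forall => l; apply/aeE; apply: (ENW_ae hF mD).
  - exact: j2.
  - exact: bmeas_L2.
  - exact: jE.
apply: filterS2 (j'E y2) H => p /(_ I) E1 E2 _; rewrite E1.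
apply: eq_bigr => l _; rewrite /mulop -E2.
by rewrite -lE.
Qed.

End finite_trace.

Lemma finite_rank_of_trace {R : realType} (F F' : wave R -> wave R)
  (T : set (R3 R) -> wave R -> wave R) (t : R3 R -> R3 R -> R[i]) :
  is_fourier F F' -> is_POL T -> is_kernel T t -> finite_POL F F' T ->
  exists n (f : 'I_n -> wave R), (forall l, bmeas (f l)) /\
    \forall kp \ae (leb3 \x leb3)%E, off0 t kp.1 kp.2 = gramk f kp.1 kp.2.
Proof.
move=> hF hT ht [n [D [j [j' [D_rep j_isom j_adj j_cov TE]]]]].
have [f [bf E]] := trace_eq_kinS hF D_rep j_isom j_adj j_cov.
exists n, f; split=> //; apply: (finite_rank_kernel_of_kinS hF hT ht) => // Delta mD phi phi2.
by apply: filterS2 (TE _ mD _ phi2) (E _ mD _ phi2) => p /(_ I) -> /(_ I).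
Qed.

Theorem mainTheorem13 (R : realType)
  (F F' : wave R -> wave R)
  (T : set (R3 R) -> wave R -> wave R)
  (t : R3 R -> R3 R -> R[i])
  (hF : is_fourier F F') (hT : is_POL T) (ht : is_kernel T t) :
  (finite_POL F F' T <-> is_finite_kernel T t) /\
  (is_finite_kernel T t <-> kinematic_deformation F F' T).
Proof.
(* All three statements are compared with one weaker condition: almost everywhere the kernel is a
   finite sum with bounded measurable components, with no covariance required of them. *)
have fin n (f : 'I_n -> wave R) : (forall l, bmeas (f l)) ->
    (\forall kp \ae (leb3 \x leb3)%E, off0 t kp.1 kp.2 = gramk f kp.1 kp.2) ->
    finite_POL F F' T /\ is_finite_kernel T t.
  move=> bf FR; have [m [D [v [D_rep [bv iv] v_rot v1 FRv]]]] := gramk_covariant hF hT ht bf FR.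
  split; first exact: (gramk_is_trace hF hT ht D_rep bv v_rot v1 FRv).
  exact: (gramk_is_finite ht D_rep bv iv v_rot v1 FRv).
split; split.
- by move=> /(finite_rank_of_trace hF hT ht)[n [f [bf /(fin _ _ bf)[]]]].
- by move=> /(finite_rank_of_finite_kernel)[n [f [bf /(fin _ _ bf)[]]]].
- move=> /(finite_rank_of_finite_kernel)[n [f [bf FR]]].
  exact: (deformation_of_finite_rank hF hT ht bf FR).
- by move=> /(finite_rank_of_deformation hF hT ht)[n [f [bf /(fin _ _ bf)[]]]].
Qed.
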